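(* Let $p\in[0,\infty)$. For any Poisson measure $\pi_M(dx,dt)$ on $\mathbb{R}\times[0,\infty)$ with intensity measure $dx\,dt$, there a.s. exists a unique LFFP$(p)$ (driven by $\pi_M$). Furthermore, it can be constructed graphically and its restriction to any finite box $[0,T]\times[-n,n]$ (times in $[0,T]$, space in $[-n,n]$) can be perfectly simulated.
   Context: Cones. For $p\ge 0$, $(x,t)\in\mathbb{R}\times[0,\infty)$ put $\Lambda^p_{(x,t)}=\{(x+z,\,t-p|z|): |z|\le t/p\}$ (with $1/0=\infty$, so $\Lambda^0_{(x,t)}=\{(z,t):z\in\mathbb{R}\}$). For $(y,s)\in\Lambda^p_{(x,t)}$ let $\Lambda^p_{(x,t)}(y,s)=\{(z,t-p|z-x|): z \text{ between } x \text{ and } y, \text{ endpoints included}\}$ be the part of $\Lambda^p_{(x,t)}$ joining $(y,s)$ to $(x,t)$. LFFP$(p)$. Let $\pi_M$ be a Poisson measure on $\mathbb{R}\times[0,\infty)$ with intensity $dx\,dt$. A process $(Z_t(x),H_t(x),F_t(x))_{t\ge0,x\in\mathbb{R}}$ with values in $\mathbb{R}_+\times\mathbb{R}_+\times\mathbb{N}$, such that a.s. for all $x$ the map $t\mapsto(Z_t(x),H_t(x))$ is càdlàg, is a LFFP$(p)$ ($p$-limit forest fire process) if a.s., for all $t\ge0$ and $x\in\mathbb{R}$, $$Z_t(x)=\int_0^t \mathbf 1_{\{Z_s(x)<1\}}ds-\sum_{s\le t}(F_s(x)\wedge1),$$ $$H_t(x)=\int_0^t Z_{s-}(x)\mathbf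 1_{\{Z_{s-}(x)<1\}}\pi_M(\{x\}\times ds)-\int_0^t\mathbf 1_{\{H_s(x)>0\}}ds,$$ $$F_t(x)=\iint_{(y,s)\in\Lambda^p_{(x,t)}}\mathbf 1_{\{\forall (r,v)\in\Lambda^p_{(x,t)}(y,s):\ Z_{v-}(r)=1\text{ and }H_{v-}(r)=0\}}\pi_M(dy,ds).$$ ''Constructed graphically / perfectly simulated on a box $[0,T]\times[-n,n]$'' means: there is an a.s. finite random space interval $J\supset[-n,n]$ such that the values of the process on the box are obtained exactly by an explicit finite algorithm from the (a.s. finitely many) marks of $\pi_M$ in $J\times[0,T]$. *)

(* Defs.v *)
From mathcomp Require Import all_boot all_order all_algebra.
From mathcomp Require Import all_classical all_reals all_analysis.
From mathcomp Require Import measurable_realfun.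

Set Implicit Arguments.
Unset Strict Implicit.
Unset Printing Implicit Defensive.

Import Order.TTheory GRing.Theory Num.Theory.
Import numFieldNormedType.Exports.

Local Open Scope classical_set_scope.
Local Open Scope ring_scope.

Section PoissonMeasure.
Context {R : realType}.

(* dx dt on R x [0, oo), seen as a measure on R x R; the first coordinate is
   space, the second one is time. *)
Definition intensity (B : set (R * R)) : \bar R :=
  (lebesgue_measure \x lebesgue_measure)%E (B `&` (setT `*` `[0, +oo[)).

Definition independent_rvs {d} {W : measurableType d} (P : probability W R)
    (m : nat) (X : 'I_m -> W -> \bar R) :=
  forall A : 'I_m -> set (\bar R), (forall i, measurable (A i)) ->
  P (\bigcap_i (X i @^-1` A i)) = (\prod_i P (X i @^-1` A i))%E.

(* The kernel type makes w |-> M w B measurable for every measurable B.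
   The formula for the Poisson law is also correct for r = 0, as 0 ^+ 0 = 1. *)
Record poisson_measure {d} {W : measurableType d} (P : probability W R)
    (M : R.-ker W ~> (R * R)%type) : Prop := {
  poisson_counting : forall w (B : set (R * R)), measurable B ->
    M w B = +oo%E \/ exists k : nat, M w B = k%:R%:E;
  poisson_law_fin : forall (B : set (R * R)) (r : R), measurable B ->
    intensity B = r%:E -> forall k : nat,
    P [set w | M w B = k%:R%:E] = (expR (- r) * r ^+ k / k`!%:R)%:E;
  poisson_law_oo : forall B : set (R * R), measurable B ->
    intensity B = +oo%E -> P [set w | M w B = +oo%E] = 1%E;
  poisson_indep : forall (m : nat) (B : 'I_m -> set (R * R)),
    (forall i, measurable (B i)) ->
    (forall i j, i != j -> B i `&` B j = set0) ->
    independent_rvs P (fun i w => M w (B i)) }.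

End PoissonMeasure.

Section LFFP.
Context {R : realType}.

(* p * |z| <= t is |z| <= t / p with the convention 1 / 0 = oo (as t >= 0). *)
Definition cone (p x t : R) : set (R * R) :=
  [set q | exists2 z, p * `|z| <= t & q = (x + z, t - p * `|z|)].

(* The part of [cone p x t] joining its point of abscissa y to (x, t); for a
   point (y, s) of the cone, s is determined by y. *)
Definition cone_part (p x t y : R) : set (R * R) :=
  [set q | exists2 z, Num.min x y <= z <= Num.max x y &
                      q = (z, t - p * `|z - x|)].

(* f_{t-}, with the convention f_{0-} = f_0. *)
Definition left_lim (f : R -> R) (t : R) : R :=
  if 0 < t then lim (f s @[s --> t^'-]) else f t.

(* Only the values of f on [0, oo) matter. *)
Definition cadlag (f : R -> R) :=
  (forall t : R, 0 <= t -> f s @[s --> t^'+] --> f t) /\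
  (forall t : R, 0 < t -> cvg (f s @[s --> t^'-])).

Definition nonneg_path (Z H : R -> R -> R) :=
  forall (t x : R), 0 <= t -> 0 <= Z t x /\ 0 <= H t x.

(* [burning p Z H x t (y, s)]: a match falling at (y, s) in [cone p x t]
   starts a fire which reaches (x, t). *)
Definition burning (p : R) (Z H : R -> R -> R) (x t : R) : set (R * R) :=
  [set q | forall r, cone_part p x t q.1 r ->
    left_lim (Z ^~ r.1) r.2 = 1 /\ left_lim (H ^~ r.1) r.2 = 0].

(* The equations of the LFFP(p) driven by a fixed realization m of the Poisson
   measure; the first argument of Z, H and F is the time. They are stated in
   \bar R, so they contain the finiteness of the integrals and of the sum. *)
Record LFFP_path (p : R) (m : {measure set (R * R) -> \bar R})
    (Z H : R -> R -> R) (F : R -> R -> nat) : Prop := {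
  LFFP_cadlag : forall x, cadlag (Z ^~ x) /\ cadlag (H ^~ x);
  LFFP_Z : forall (t x : R), 0 <= t ->
    ((Z t x)%:E =
     \int[lebesgue_measure]_(s in `[0%R, t]) (\1_[set u | (Z u x < 1)%R] s)%:E
     - \esum_(s in [set s | 0 <= s <= t]%R) (minn (F s x) 1)%:R%:E)%E;
  LFFP_H : forall (t x : R), 0 <= t ->
    ((H t x)%:E =
     \int[m]_(q in [set x] `*` `]0%R, t])
       (left_lim (Z ^~ x) q.2 *
        \1_[set u | left_lim (Z ^~ x) u < 1] q.2)%R%:E
     - \int[lebesgue_measure]_(s in `[0%R, t])
         (\1_[set u | (0 < H u x)%R] s)%:E)%E;
  LFFP_F : forall (t x : R), 0 <= t ->
    ((F t x)%:R%:E =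
     \int[m]_(q in cone p x t) (\1_(burning p Z H x t) q)%:E)%E }.

Record LFFP {d} {W : measurableType d} (P : probability W R) (p : R)
    (M : R.-ker W ~> (R * R)%type)
    (Z H : W -> R -> R -> R) (F : W -> R -> R -> nat) : Prop := {
  LFFP_mZ : forall (t x : R), 0 <= t -> measurable_fun setT (fun w => Z w t x);
  LFFP_mH : forall (t x : R), 0 <= t -> measurable_fun setT (fun w => H w t x);
  LFFP_mF : forall (t x : R), 0 <= t -> measurable_fun setT (fun w => F w t x);
  LFFP_ge0 : forall w, nonneg_path (Z w) (H w);
  LFFP_ae : {ae P, forall w, LFFP_path p (M w) (Z w) (H w) (F w)} }.

End LFFP.

(* A small first-order language for exact algorithms on real numbers: programs
   handle real numbers, pairs and lists by exact arithmetic, comparisons of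
   real numbers and iteration over lists. The only constant is 1, so a program
   is a finite object in which no real parameter can be hidden, and every
   program terminates. *)
Section Algorithms.

Inductive ty := Unit | Real | Pair of ty & ty | List of ty.

Inductive prog : ty -> ty -> Type :=
| Id A : prog A A
| Comp A B C : prog B C -> prog A B -> prog A C
| Bang A : prog A Unit
| Fst A B : prog (Pair A B) A
| Snd A B : prog (Pair A B) B
| Tuple A B C : prog A B -> prog A C -> prog A (Pair B C)
| One : prog Unit Real
| Add : prog (Pair Real Real) Real
| Sub : prog (Pair Real Real) Real
| Mul : prog (Pair Real Real) Real
| Inv : prog Real Real
| IfLe A B : prog A Real -> prog A Real -> prog A B -> prog A B -> prog A B
| Nil A : prog Unit (List A)
| Cons A : prog (Pair A (List A)) (List A)
| Fold E A B : prog (Pair E (Pair A B)) B -> prog E B ->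
    prog (Pair E (List A)) B.

Variable R : realType.

Fixpoint val_of (A : ty) : Type :=
  match A with
  | Unit => unit
  | Real => R
  | Pair A B => (val_of A * val_of B)%type
  | List A => seq (val_of A)
  end.

Fixpoint run {A B : ty} (f : prog A B) : val_of A -> val_of B :=
  match f in prog A B return val_of A -> val_of B with
  | Id _ => fun a => a
  | Comp _ _ _ g f => fun a => run g (run f a)
  | Bang _ => fun=> tt
  | Fst _ _ => fun a => a.1
  | Snd _ _ => fun a => a.2
  | Tuple _ _ _ f g => fun a => (run f a, run g a)
  | One => fun=> 1
  | Add => fun a => a.1 + a.2
  | Sub => fun a => a.1 - a.2
  | Mul => fun a => a.1 * a.2
  | Inv => fun a => a^-1
  | IfLe _ _ x y f g => fun a => if run x a <= run y a then run f a else run g a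
  | Nil _ => fun=> [::]
  | Cons _ => fun a => a.1 :: a.2
  | Fold _ _ _ f b => fun a =>
      foldr (fun h acc => run f (a.1, (h, acc))) (run b a.1) a.2
  end.

End Algorithms.

(* Input: p, a query point (t, x), and a list of marks (space, time).
   Output: the values of Z, H and F at the query point. *)
Definition simulator :=
  prog (Pair (Pair Real (Pair Real Real)) (List (Pair Real Real)))
       (Pair Real (Pair Real Real)).

Section Simulation.
Context {R : realType}.

Definition simulate (alg : simulator) (p t x : R) (s : seq (R * R)) :
    R * (R * R) := run (R := R) alg ((p, (t, x)), s).

(* s lists, in some order and with multiplicities, the atoms of m in D, and m
   has finitely many of them and no other mass in D. *)
Definition lists_marks (m : {measure set (R * R) -> \bar R}) (D : set (R * R))
    (s : seq (R * R)) :=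
  forall B, measurable B -> (m (B `&` D) = \sum_(q <- s) \d_q B)%E.

(* J = [a w, b w]. *)
Definition perfectly_simulated {d} {W : measurableType d}
    (P : probability W R) (p : R) (M : R.-ker W ~> (R * R)%type)
    (Z H : W -> R -> R -> R) (F : W -> R -> R -> nat)
    (alg : simulator) (T n : R) :=
  exists a b : W -> R,
  [/\ measurable_fun setT a, measurable_fun setT b,
      forall w, a w <= - n /\ n <= b w &
      {ae P, forall w,
        let D := `[a w, b w] `*` `[0, T] in
        (exists s, lists_marks (M w) D s) /\
        forall s, lists_marks (M w) D s ->
        forall (t x : R), 0 <= t <= T -> - n <= x <= n ->
        simulate alg p t x s = (Z w t x, (H w t x, (F w t x)%:R))}].

End Simulation.

(* Main.v *)
(* A fire started by the mark q burns the site x exactly at the time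
   arrival p q x, provided that every site between q.1 and x is clear when the
   front passes: it has not burnt during the last unit of time, and no smaller
   fire is still extinguishing there. Thus the path is a function of the relation
   "q burns x", which satisfies a fixed-point equation (fire_system). Only a
   finite number of marks matters in a bounded window; their fronts cut the line
   into finitely many cells, and the equation is solved by induction on the rank
   of (q, x) in the order of arrival times, which also yields an algorithm.

   The window is finite because only a bounded space interval matters. For p > 0
   this is the space covered by the backward cones. For p = 0 we look for an
   interval of length 1 where the marks up to time T fall in a prescribed pattern:
   the interval is covered by fires at times 9/8, 2 (9/8), 3 (9/8), ..., and each
   time two marks fall at its two ends shortly before it has recovered, so that
   no fire ever crosses it. Such patterns have a probability bounded below and
   are independent for disjoint intervals, hence they occur on both sides of any
   box. *)

Require Import Defs.
From mathcomp Require Import all_boot all_order all_algebra.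
From mathcomp Require Import all_classical all_reals all_analysis.
From mathcomp Require Import measurable_realfun ring lra zify.

Set Implicit Arguments.
Unset Strict Implicit.
Unset Printing Implicit Defensive.

Import Order.TTheory GRing.Theory Num.Theory.
Import numFieldNormedType.Exports.

Local Open Scope classical_set_scope.
Local Open Scope ring_scope.

(** The equation is antitone: more fires mean fewer clear sites. Cells are cut at the marks and
    where two fronts meet with a delay of -1, 0 or 1, because recovery compares arrival times up to
    one unit; inside a cell every such comparison is constant.

    At one site the integral equations leave no freedom once the burn times are known: a burn lowers
    Z by one, Z is at most 1 before it, and nonnegativity makes it exactly 0 afterwards. Time 0 acts
    on the state like a burn.

    A mark at t after a burn at u in (t - 1, t) blocks its site until 2t - u. This doubling makes
    barriers possible for p = 0: a period slightly above the recovery time 1 and guard marks at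
    phase about 7/8 give a block that outlasts the period, with slack 1/16 so that the pattern has
    positive probability.

    Measurability of the solution comes from the simulator: every program preserves measurability,
    and the solution is an eventual value of its outputs. *)

Lemma count_lt (T : eqType) (a1 a2 : pred T) (l : seq T) (e : T) :
  subpred a1 a2 -> e \in l -> a2 e -> ~~ a1 e -> (count a1 l < count a2 l)%N.
Proof.
move=> sub; elim: l => // h l ih; rewrite inE => /orP[/eqP <-|el] a2e a1e /=.
  by rewrite (negbTE a1e) a2e add0n add1n ltnS sub_count.
rewrite -addnS leq_add// ?ih//.
by case: (boolP (a1 h)) => // /sub ->.
Qed.

(** * Cells of a line cut at finitely many points *)

Section rep.
Context {R : realType}.
Implicit Types (C : seq R) (r c : R).

Definition between (a b r : R) : bool := Num.min a b <= r <= Num.max a b.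

Lemma betweenE a b r : between a b r = (a <= r <= b) || (b <= r <= a).
Proof.
rewrite /between; have [ab|ba] := leP a b.
  case: (boolP (a <= r <= b)) => //= /negP h; apply/esym/negP => /andP[h1 h2].
  by apply: h; apply/andP; split; lra.
case: (boolP (b <= r <= a)) => /=; rewrite ?orbT ?orbF// => /negP h.
by apply/esym/negP => /andP[h1 h2]; apply: h; apply/andP; split; lra.
Qed.

Lemma betweenl (a b : R) : between a b a.
Proof. by rewrite betweenE lexx andbT le_total. Qed.

Lemma betweenr (a b : R) : between a b b.
Proof. by rewrite betweenE lexx andbT le_total. Qed.

Lemma between_trans (a b c d : R) :
  between a b c -> between a c d -> between a b d.
Proof.
rewrite !betweenE => /orP[]/andP[h1 h2] /orP[]/andP[h3 h4]; apply/orP.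
- by left; apply/andP; split; lra.
- by left; apply/andP; split; lra.
- by right; apply/andP; split; lra.
- by right; apply/andP; split; lra.
Qed.

Definition same_cell C r r' := forall c, c \in C -> ~~ between r r' c.

(** The default 0 makes [below C < above C] hold even for empty [C]. The two values stand in for the
    missing ends of the unbounded cells. *)
Definition below C := \big[Num.min/0]_(c <- C) c - 1.
Definition above C := \big[Num.max/0]_(c <- C) c + 1.
Definition lower C r := \big[Num.max/below C]_(c <- C | c <= r) c.
Definition upper C r := \big[Num.min/above C]_(c <- C | r <= c) c.
(** A point of [C] is its own representative, since both bounds collapse to it. Any other point goes
    to the centre of its open cell, unbounded cells being truncated. *)
Definition rep C r := (lower C r + upper C r) / 2.

Definition midpoints C := [seq (c + c') / 2 | c <- C, c' <- C].

Lemma mem_midpoints C : {subset C <= midpoints C}.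
Proof.
move=> c cC; apply/allpairsP; exists (c, c); split => //=; lra.
Qed.

Lemma below_lt C c : c \in C -> below C < c.
Proof.
move=> cC; rewrite /below.
have : \big[Num.min/0]_(c <- C) c <= c by exact: (@bigmin_inf_seq _ _ _ _ _ c).
lra.
Qed.

Lemma above_gt C c : c \in C -> c < above C.
Proof.
move=> cC; rewrite /above.
have : c <= \big[Num.max/0]_(c <- C) c by exact: (@bigmax_sup_seq _ _ _ _ _ c).
lra.
Qed.

Lemma lower_mem C r : lower C r = below C \/ (lower C r \in C /\ lower C r <= r).
Proof.
rewrite /lower; move: (below C) => x; elim: C => [|c l ih]; first by rewrite big_nil; left.
rewrite big_cons; case: ifPn => [cr|_]; last first.
  by case: ih => [->|[m h]]; [left|right; rewrite inE m orbT].
case: (leP c) => _; last by right; split => //; exact: mem_head.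
by case: ih => [->|[m h]]; [left|right; rewrite inE m orbT].
Qed.

Lemma upper_mem C r : upper C r = above C \/ (upper C r \in C /\ r <= upper C r).
Proof.
rewrite /upper; move: (above C) => x; elim: C => [|c l ih]; first by rewrite big_nil; left.
rewrite big_cons; case: ifPn => [cr|_]; last first.
  by case: ih => [->|[m h]]; [left|right; rewrite inE m orbT].
case: (leP c) => _; first by right; split => //; exact: mem_head.
by case: ih => [->|[m h]]; [left|right; rewrite inE m orbT].
Qed.

Lemma le_lower C c r : c \in C -> c <= r -> c <= lower C r.
Proof. by move=> cC cr; exact: (@bigmax_sup_seq _ _ _ _ _ c). Qed.

Lemma ge_upper C c r : c \in C -> r <= c -> upper C r <= c.
Proof. by move=> cC cr; exact: (@bigmin_inf_seq _ _ _ _ _ c). Qed.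

Lemma lower_homo C : {homo lower C : r r' / r <= r'}.
Proof.
move=> r r' rr'; have [->|[m h]] := lower_mem C r; first exact: bigmax_ge_id.
by apply: le_lower => //; exact: le_trans rr'.
Qed.

Lemma upper_homo C : {homo upper C : r r' / r <= r'}.
Proof.
move=> r r' rr'; have [->|[m h]] := upper_mem C r'; first exact: bigmin_le_id.
by apply: ge_upper => //; exact: le_trans h.
Qed.

(** Together with [rep_id], monotonicity preserves betweenness as seen from a mark, so that ranks
    can be measured at representatives. *)
Lemma rep_homo C : {homo rep C : r r' / r <= r'}.
Proof.
move=> r r' rr'; rewrite /rep.
have := lower_homo C rr'; have := upper_homo C rr'; lra.
Qed.

Lemma rep_id C c : c \in C -> rep C c = c.
Proof.
move=> cC; rewrite /rep.
have := le_lower cC (lexx c); have := ge_upper cC (lexx c).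
have := below_lt cC; have := above_gt cC.
by case: (lower_mem C c) => [->|[_ ?]]; case: (upper_mem C c) => [->|[_ ?]]; lra.
Qed.

Lemma below_lt_above C : below C < above C.
Proof.
rewrite /below /above.
have : \big[Num.min/0]_(c <- C) c <= 0 by exact: bigmin_le_id.
have : 0 <= \big[Num.max/0]_(c <- C) c by exact: bigmax_ge_id.
lra.
Qed.

Lemma lower_lt_upper C r : r \notin C -> lower C r < upper C r.
Proof.
move=> rC; case: (lower_mem C r) => [->|[m h]].
  case: (upper_mem C r) => [->|[m' _]]; first exact: below_lt_above.
  exact: below_lt.
case: (upper_mem C r) => [->|[m' h']]; first exact: above_gt.
rewrite lt_neqAle (le_trans h h') andbT; apply/eqP => e.
by move: rC; rewrite (_ : r = lower C r) ?m//; lra.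
Qed.

Lemma same_cell_rep C r : r \notin C -> same_cell C r (rep C r).
Proof.
move=> rC c cC; rewrite betweenE; apply/negP.
have lu := lower_lt_upper rC; rewrite /rep => /orP[]/andP[h1 h2].
  have := ge_upper cC h1; lra.
have := le_lower cC h2; lra.
Qed.

Lemma same_cell_sym C r r' : same_cell C r r' -> same_cell C r' r.
Proof. by move=> h c /h; rewrite !betweenE orbC. Qed.

Lemma same_cell_sub C r r' a : same_cell C r r' -> between r r' a ->
  same_cell C r a.
Proof.
move=> h ra c cC; apply/negP => rac; have /negP := h _ cC; apply.
exact: between_trans ra rac.
Qed.

Lemma same_cell_le C r r' c : same_cell C r r' -> c \in C -> (c <= r) = (c <= r').
Proof.
move=> h cC; have := h _ cC; rewrite betweenE negb_or !negb_and.
move=> /andP[/orP[]h1 /orP[]h2]; apply/idP/idP; lra.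
Qed.

Lemma same_cell_ge C r r' c : same_cell C r r' -> c \in C -> (r <= c) = (r' <= c).
Proof.
move=> h cC; have := h _ cC; rewrite betweenE negb_or !negb_and.
move=> /andP[/orP[]h1 /orP[]h2]; apply/idP/idP; lra.
Qed.

Lemma same_cell_rep_eq C r r' : same_cell C r r' -> rep C r = rep C r'.
Proof.
move=> h; rewrite /rep /lower /upper; congr ((_ + _) / _).
  rewrite big_seq_cond [RHS]big_seq_cond; apply: eq_bigl => c.
  by case: (boolP (c \in C)) => //= cC; rewrite (same_cell_le h).
rewrite big_seq_cond [RHS]big_seq_cond; apply: eq_bigl => c.
by case: (boolP (c \in C)) => //= cC; rewrite (same_cell_ge h).
Qed.

Definition reps C := midpoints (below C :: above C :: C).

Lemma rep_mem C r : rep C r \in reps C.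
Proof.
apply/allpairsP; exists (lower C r, upper C r); split => //=.
  by case: (lower_mem C r) => [->|[h _]]; rewrite !inE ?eqxx// h !orbT.
by case: (upper_mem C r) => [->|[h _]]; rewrite !inE ?eqxx ?orbT// h !orbT.
Qed.

(** Between two points of [C] the cell is bounded, so its representative involves no artificial end.
    The algorithm can therefore use [midpoints C] instead of [reps C]. *)
Lemma rep_mem_in C a b r : a \in C -> b \in C -> between a b r ->
  rep C r \in midpoints C.
Proof.
wlog ab : a b / a <= b => [H aC bC|].
  have [/H|/ltW/H ba] := leP a b; first exact.
  by rewrite betweenE orbC -betweenE; exact: ba.
move=> aC bC; rewrite /between (min_idPl ab) (max_idPr ab) => /andP[h1 h2].
apply/allpairsP; exists (lower C r, upper C r); split => //=.
  have [e|[]//] := lower_mem C r.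
  by have := le_lower aC h1; have := below_lt aC; rewrite e; lra.
have [e|[]//] := upper_mem C r.
by have := ge_upper bC h2; have := above_gt bC; rewrite e; lra.
Qed.

End rep.

(** * The fixed-point equation for fires and its rank *)

Section fire_system.
Context {R : realType} (p : R).
Hypothesis p_ge0 : 0 <= p.
Implicit Types (q : R * R) (Q : set (R * R)) (b : R * R -> R -> Prop).
Implicit Types (s : seq (R * R)) (C : seq R) (K : set (R * R)).

Definition arrival q (x : R) : R := q.2 + p * `|x - q.1|.

(** A burn at u followed by a mark at t in (u, u + 1) starts an extinction of length t - u, hence
    active until 2t - u. Time 0 serves as a burn because the site starts empty. The test names any
    burn in (t - 1, t) rather than the last one before t; the spacing of burns makes this the
    same. *)
Definition passable (A B : set R) (v : R) : Prop :=
  [/\ 1 <= v, forall u, B u -> ~~ (v - 1 < u < v) &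
      forall t u, A t -> u = 0 \/ B u ->
        ~~ [&& t - 1 < u, u < t, t < v & v < t + t - u]].

Definition column Q (r : R) : set R := [set t | Q (r, t)].

Definition burns b (r : R) : set R :=
  [set u | exists2 q, b q r & arrival q r = u].

Definition clear Q b (r v : R) := passable (column Q r) (burns b r) v.

Definition fire_system Q b := forall q x, b q x <->
  Q q /\ forall r, between q.1 x r -> clear Q b r (arrival q r).

(** Passability is antitone in both sets, and only strictly earlier marks and burns matter; the
    second fact is what makes the equation well founded. *)
Lemma passable_sub (A A' B B' : set R) v :
  (forall t, A' t -> t < v -> A t) -> (forall u, B' u -> u < v -> B u) ->
  passable A B v -> passable A' B' v.
Proof.
move=> sA sB [v1 hB hA]; split => //.
  move=> u Bu; apply/negP => /andP[h1 h2].
  by have /negP := hB u (sB _ Bu h2); apply; rewrite h1.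
move=> t u At Bu; apply/negP => /and4P[h1 h2 h3 h4].
have Bu' : u = 0 \/ B u.
  by case: Bu => [->|Bu]; [left|right; apply: sB => //; apply: lt_trans h3].
by have /negP := hA t u (sA _ At h3) Bu'; apply; apply/and4P.
Qed.

Lemma arrival_self q : arrival q q.1 = q.2.
Proof. by rewrite /arrival subrr normr0 mulr0 addr0. Qed.

Lemma arrival_ge q x : q.2 <= arrival q x.
Proof. by rewrite /arrival lerDl mulr_ge0. Qed.

Lemma arrival_between q x r : between q.1 x r -> arrival q r <= arrival q x.
Proof.
move=> h; rewrite /arrival lerD2l ler_wpM2l//.
move: h; rewrite betweenE => /orP[]/andP[h1 h2].
  by rewrite !ger0_norm; lra.
by rewrite !ler0_norm; lra.
Qed.

(** The equation for [(q, x)] relies on the pairs [(q', r)] such that [r] lies on the path of [q]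
    and [q'] passes [r] first; the rank decreases strictly along this dependence. *)
Definition rank_on s (rk : R * R -> R -> nat) :=
  forall q q' x r, q \in s -> q' \in s -> between q.1 x r ->
    arrival q' r < arrival q r -> (rk q' r < rk q x)%N.

Definition past_closed K := forall r u v, K (r, v) -> u <= v -> K (r, u).

(** With [past_closed], this keeps in [K] all that the equation looks at for a fire ending in [K]:
    its path and the past of each site of the path. *)
Definition fire_closed K b := forall q x, b q x -> K (x, arrival q x) ->
  forall r, between q.1 x r -> K (r, arrival q r).

(** By antitony, [b] at [(q, x)] is carried to [b'] through the reverse implication at smaller
    ranks; hence the two implications have to be proved in one induction. *)
Lemma fire_system_half s Q Q' b b' K rk q x :
  rank_on s rk -> past_closed K -> fire_closed K b -> fire_closed K b' ->
  (forall q, K q -> Q q <-> Q' q) -> (forall q, K q -> Q q -> q \in s) ->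
  fire_system Q b -> fire_system Q' b' ->
  (forall q' r, q' \in s -> (rk q' r < rk q x)%N -> K (r, arrival q' r) ->
     b q' r <-> b' q' r) ->
  K (x, arrival q x) -> b q x -> b' q x.
Proof.
move=> hrk pK fK fK' QQ' Qs sb sb' ih Kx bx.
have Kpath := fK _ _ bx Kx.
have Kq : K q by have := Kpath _ (betweenl q.1 x); rewrite arrival_self -surjective_pairing.
have [Qq hx] := (sb q x).1 bx.
have qs : q \in s by exact: Qs.
apply/sb'; split; first exact/QQ'.
move=> r rq; have Kr := Kpath _ rq.
apply: passable_sub (hx r rq) => [t Q't tv|u [q' b'q' <-] tv].
  by apply/QQ' => //; apply: pK Kr (ltW tv).
have Kq'r : K (r, arrival q' r) by apply: pK Kr (ltW tv).
have Kq' : K q'.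
  by have := fK' _ _ b'q' Kq'r _ (betweenl q'.1 r); rewrite arrival_self -surjective_pairing.
have q's : q' \in s by apply: Qs => //; apply/QQ' => //; have [] := (sb' q' r).1 b'q'.
by exists q' => //; apply/ih => //; exact: hrk tv.
Qed.

Lemma fire_system_agree s Q Q' b b' K rk :
  rank_on s rk -> past_closed K -> fire_closed K b -> fire_closed K b' ->
  (forall q, K q -> Q q <-> Q' q) -> (forall q, K q -> Q q -> q \in s) ->
  fire_system Q b -> fire_system Q' b' ->
  forall q x, K (x, arrival q x) -> b q x <-> b' q x.
Proof.
move=> hrk pK fK fK' QQ' Qs sb sb'.
have Q's : forall q, K q -> Q' q -> q \in s by move=> q Kq /QQ' h; apply: Qs => //; apply: h.
have Q'Q : forall q, K q -> Q' q <-> Q q by move=> q Kq; split => /QQ'; apply.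
suff H n : forall q x, (rk q x < n)%N -> K (x, arrival q x) -> b q x <-> b' q x.
  by move=> q x; apply: (H (rk q x).+1).
elim: n => // n ih q x rn Kx; split.
  apply: (fire_system_half hrk pK fK fK' QQ' Qs sb sb') => // q' r _ lt.
  by apply: ih; apply: leq_trans lt _.
apply: (fire_system_half hrk pK fK' fK Q'Q Q's sb' sb) => // q' r _ lt K'.
by rewrite (ih q' r)//; apply: leq_trans lt _.
Qed.

(* Abscissas where a front of i meets a front of j, possibly delayed by 1. *)
Definition crossing (i j : R * R) (e : R) : R :=
  (j.2 - i.2 + e + p * (i.1 + j.1)) / (2 * p).

(** The abscissas of the marks are cut points because fronts bend there and because the extinction
    test concerns only columns that carry a mark. Inside a cell, only comparisons of arrival times
    remain. *)
Definition critical s C := (forall q, q \in s -> q.1 \in C) /\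
  forall i j e, i \in s -> j \in s -> e \in [:: -1; 0; 1] ->
    crossing i j e \in C.

Lemma crossingE (i j : R * R) e : p != 0 ->
  2 * p * crossing i j e = j.2 - i.2 + e + p * (i.1 + j.1).
Proof. by move=> p0; rewrite /crossing mulrC mulfVK// mulf_neq0// pnatr_eq0. Qed.

Lemma same_cell_crossing s C r r' i j e : critical s C -> same_cell C r r' ->
  i \in s -> j \in s -> e \in [:: -1; 0; 1] ->
  (r < crossing i j e -> r' < crossing i j e) /\
  (crossing i j e < r -> crossing i j e < r').
Proof.
move=> [_ hC] h si sj se; have {hC}cC := hC _ _ _ si sj se.
have := same_cell_le h cC; have := same_cell_ge h cC.
by rewrite !ltNge => -> ->.
Qed.

(** On one side of both marks, the difference of the arrival times is constant. Between the marks it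
    is affine with slope of modulus 2p and meets the level [e] only at a crossing. For p = 0 it is
    constant everywhere. *)
Lemma same_cell_arrival s C r r' i j e : critical s C -> same_cell C r r' ->
  i \in s -> j \in s -> (e == 0) || (e == 1) ->
  arrival i r < arrival j r + e -> arrival i r' < arrival j r' + e.
Proof.
move=> hC h si sj e01; rewrite /arrival.
have [p0|p0] := eqVneq p 0; first by rewrite p0 !mul0r.
have p_gt0 : 0 < p by rewrite lt_neqAle eq_sym p0.
have [|c1 _] := same_cell_crossing (e := e) hC h si sj.
  by rewrite !inE e01 orbT.
have [|_ c2] := same_cell_crossing (e := - e) hC h sj si.
  by rewrite !inE eqr_opp oppr_eq0; case/orP: e01 => ->; rewrite ?orbT.
have := crossingE i j e p0; have := crossingE j i (- e) p0.
move: (crossing i j e) (crossing j i (- e)) c1 c2 => c c' c1 c2 E' E.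
have M a a' : a < a' -> 2 * p * a < 2 * p * a'.
  by move=> ?; rewrite ltr_pM2l// mulr_gt0.
have M' a a' : 2 * p * a < 2 * p * a' -> a < a'.
  by rewrite ltr_pM2l// mulr_gt0.
have := same_cell_le h (hC.1 _ si); have := same_cell_le h (hC.1 _ sj).
have [ir|ir] := leP i.1 r; have [jr|jr] := leP j.1 r => /esym jr' /esym ir'.
- rewrite !ger0_norm; lra.
- move: jr' => /negbT; rewrite -ltNge => jr'.
  rewrite (ger0_norm (_ : 0 <= r - i.1)) ?(ger0_norm (_ : 0 <= r' - i.1)); [|lra|lra].
  rewrite (ltr0_norm (_ : r - j.1 < 0)) ?(ltr0_norm (_ : r' - j.1 < 0)); [|lra|lra].
  move=> D; have /c1/M : r < c by apply: M'; lra.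
  lra.
- move: ir' => /negbT; rewrite -ltNge => ir'.
  rewrite (ger0_norm (_ : 0 <= r - j.1)) ?(ger0_norm (_ : 0 <= r' - j.1)); [|lra|lra].
  rewrite (ltr0_norm (_ : r - i.1 < 0)) ?(ltr0_norm (_ : r' - i.1 < 0)); [|lra|lra].
  move=> D; have /c2/M : c' < r by apply: M'; lra.
  lra.
- move: ir' jr' => /negbT; rewrite -ltNge => ir' /negbT; rewrite -ltNge => jr'.
  rewrite !ltr0_norm; lra.
Qed.

(** Replacing the site by its representative leaves finitely many pairs to count and makes the rank
    constant on cells. *)
Definition rank s C q x :=
  count (fun e : R * R * R => arrival e.1 e.2 < arrival q (rep C x))
        [seq (j, c) | j <- s, c <- reps C].

Lemma rep_arrival s C r i j : critical s C -> i \in s -> j \in s ->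
  arrival i r < arrival j r -> arrival i (rep C r) < arrival j (rep C r).
Proof.
move=> hC si sj h; have [rC|rC] := boolP (r \in C); first by rewrite rep_id.
rewrite -[ltRHS]addr0.
by apply: (same_cell_arrival hC (same_cell_rep rC) si sj); rewrite ?eqxx// addr0.
Qed.

Lemma between_rep C q x r : q.1 \in C -> between q.1 x r ->
  between q.1 (rep C x) (rep C r).
Proof.
move=> qC; rewrite !betweenE -{3 4}(rep_id qC).
by move=> /orP[]/andP[h1 h2]; apply/orP; [left|right]; apply/andP; split; exact: rep_homo.
Qed.

(** The inequality is strict because the pair [(q', rep C r)] is counted for [(q, x)] but not for
    [(q', r)]. *)
Lemma rankP s C : critical s C -> rank_on s (rank s C).
Proof.
move=> hC q q' x r sq sq' h lt; apply: (@count_lt _ _ _ _ (q', rep C r)).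
- move=> [j c] /= /lt_le_trans; apply.
  apply: le_trans (arrival_between (between_rep (hC.1 _ sq) h)).
  exact/ltW/(rep_arrival hC).
- by apply: allpairs_f => //; exact: rep_mem.
- rewrite /=; apply: lt_le_trans (arrival_between (between_rep (hC.1 _ sq) h)).
  exact: (rep_arrival hC).
- by rewrite /= ltxx.
Qed.

End fire_system.

Lemma between_beyond {R : realType} (a x r r' : R) : (a <= x) = (a <= r) ->
  between a r r' -> ~~ between a x r' -> between x r r'.
Proof.
rewrite !betweenE negb_or !negb_and -!ltNge => e h.
have [ax|ax] := leP a x; move: e h; [rewrite ax => /esym ar|
  rewrite leNgt ax /= => /esym/negbT; rewrite -ltNge => ar];
  move=> /orP[]/andP[h1 h2] /andP[/orP[]h3 /orP[]h4]; apply/orP;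
  by [left; apply/andP; split; lra|right; apply/andP; split; lra].
Qed.

Lemma between_exit {R : realType} (a c r r' : R) :
  (a <= r) = (a <= r') -> (r <= a) = (r' <= a) ->
  between a c r -> ~~ between a c r' -> between r r' c.
Proof.
rewrite !betweenE negb_or !negb_and -!ltNge => e e'.
move=> /orP[]/andP[h1 h2]; move: e e'.
  rewrite h1 => /esym h _ /andP[/orP[]h3 /orP[]h4]; apply/orP;
  by [left; apply/andP; split; lra|right; apply/andP; split; lra].
rewrite h2 => _ /esym h /andP[/orP[]h3 /orP[]h4]; apply/orP;
by [left; apply/andP; split; lra|right; apply/andP; split; lra].
Qed.

(** * Finitely many marks: existence, and constancy on cells *)

Section finite_marks.
Context {R : realType} (p : R).
Hypothesis p_ge0 : 0 <= p.
Implicit Types (q : R * R) (Q : set (R * R)) (b : R * R -> R -> Prop).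
Implicit Types (s S : seq (R * R)) (C T : seq R) (K : set (R * R)).

Local Notation arrival := (arrival p).
Local Notation clear := (clear p).
Local Notation fire_system := (fire_system p).

(** Iterates of an antitone map may oscillate; they are used only beyond the rank, where
    [iter_fire_stable] freezes them. *)
Fixpoint iter_fire s n q x : Prop :=
  if n is n'.+1 then
    q \in s /\ forall r, between q.1 x r ->
      clear [set` s] (iter_fire s n') r (arrival q r)
  else False.

Lemma iter_fire_mem s n q x : iter_fire s n q x -> q \in s.
Proof. by case: n => // n []. Qed.

Lemma iter_fire_stable s rk n m q x : rank_on p s rk ->
  (rk q x < n)%N -> (rk q x < m)%N -> iter_fire s n q x <-> iter_fire s m q x.
Proof.
move=> hrk; elim: n m q x => // n ih [//|m] q x rn rm.
split => -[qs h]; split => // r hr; apply: passable_sub (h r hr) => // u [q' hq' <-] lt;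
  exists q' => //; have q's := iter_fire_mem hq'; have lt' := hrk _ _ _ _ qs q's hr lt.
- by apply/(ih m) => //; exact: leq_trans lt' _.
- by apply/(ih m) => //; exact: leq_trans lt' _.
Qed.

Lemma fire_system_exists s C : critical p s C -> exists b, fire_system [set` s] b.
Proof.
move=> hC; have hrk := rankP p_ge0 hC; set rk := rank p s C in hrk.
exists (fun q x => iter_fire s (rk q x).+1 q x) => q x.
split=> -[qs h]; split => // r hr; apply: passable_sub (h r hr) => // u [q' hq' <-] lt;
  exists q' => //; have q's := iter_fire_mem hq'; have lt' := hrk _ _ _ _ qs q's hr lt.
- exact: (iter_fire_stable hrk lt' (ltnSn _)).2 hq'.
- exact: (iter_fire_stable hrk lt' (ltnSn _)).1 hq'.
Qed.

Section solution.
Variables (s : seq (R * R)) (C : seq R) (b : R * R -> R -> Prop).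
Hypotheses (hC : critical p s C) (sb : fire_system [set` s] b).
Let rk := rank p s C.
Let hrk : rank_on p s rk. Proof. exact: rankP. Qed.

Lemma fire_mem q x : b q x -> q \in s.
Proof. by case/sb. Qed.

Lemma fire_time_ge1 q x : b q x -> 1 <= q.2.
Proof. by case/sb => _ /(_ _ (betweenl _ _))[]; rewrite arrival_self. Qed.

Lemma passable_same_cell q r r' : same_cell C r r' -> q \in s -> 1 <= q.2 ->
  (forall q', arrival q' r < arrival q r -> b q' r <-> b q' r') ->
  clear [set` s] b r (arrival q r) -> clear [set` s] b r' (arrival q r').
Proof.
move=> h qs q1 ih [_ hB _]; split.
- exact: le_trans q1 (arrival_ge p_ge0 _ _).
- move=> _ [q' bq' <-]; apply/negP => /andP[h1 h2].
  have q's := fire_mem bq'.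
  have lt : arrival q' r < arrival q r.
    rewrite -[ltRHS]addr0.
    by apply: (same_cell_arrival p_ge0 hC (same_cell_sym h)); rewrite ?eqxx// addr0.
  have /negP := hB (arrival q' r) (ex_intro2 _ _ q' ((ih q' lt).2 bq') erefl).
  apply; rewrite lt andbT ltrBlDr.
  by apply: (same_cell_arrival p_ge0 hC (same_cell_sym h)); rewrite ?eqxx ?orbT// -ltrBlDr.
(* A mark in the column of [r'] would put [r'] in [C], so the extinction test is vacuous inside a
   cell. *)
- move=> t u /= ts _; have := h _ (hC.1 _ ts); by rewrite betweenr.
Qed.

(** The path to [r'] exceeds the path to [r] only inside the cell, where clearness at [r] can be
    transported: the earlier fires met there have smaller rank. *)
Lemma fire_same_cell q r r' : same_cell C r r' -> b q r -> b q r'.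
Proof.
have [n rn] := ubnP (rk q r); elim: n q r r' rn => // n ih q r r'; rewrite ltnS => rn h bq.
have qs := fire_mem bq; have [_ hq] := (sb q r).1 bq.
apply/sb; split => // r'' hr''.
have [/hq//|hn] := boolP (between q.1 r r'').
have hr : between r r' r''.
  by apply: between_beyond hr'' hn; rewrite (same_cell_le h (hC.1 _ qs)).
have hrr'' := same_cell_sub h hr.
apply: (passable_same_cell hrr'' qs (fire_time_ge1 bq) _ (hq _ (betweenr _ _))).
move=> q' lt; split => bq'.
  apply: (ih q' r r'') => //.
  exact: leq_trans (hrk qs (fire_mem bq') (betweenr _ _) lt) rn.
apply: (ih q' r'' r) => //; last exact: same_cell_sym.
rewrite /rk /rank -(same_cell_rep_eq hrr'').
exact: leq_trans (hrk qs (fire_mem bq') (betweenr _ _) lt) rn.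
Qed.

Lemma between_midpoint (a c1 c2 r : R) : between a ((c1 + c2) / 2) r ->
  between a c1 r \/ between a c2 r.
Proof.
rewrite !betweenE => /orP[]/andP[h1 h2]; have [h|h] := leP c1 c2.
- by right; apply/orP; left; apply/andP; split; lra.
- by left; apply/orP; left; apply/andP; split; lra.
- by left; apply/orP; right; apply/andP; split; lra.
- by right; apply/orP; right; apply/andP; split; lra.
Qed.

(** An intermediate site outside [C] is replaced by its representative if that is still on the way
    to [c], and by [c] otherwise; the replacement lies in the same cell. *)
Lemma fire_midpoints q c : q \in s -> c \in midpoints C -> b q c <->
  forall c', c' \in midpoints C -> between q.1 c c' ->
    clear [set` s] b c' (arrival q c').
Proof.
move=> qs cT; split => [/sb[_ h] c' _ hc'|h]; first exact: h.
have q1 : 1 <= q.2.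
  have [] := h q.1; rewrite ?arrival_self ?betweenl//.
  exact/mem_midpoints/hC.1.
apply/sb; split => // r hr.
have [rC|rC] := boolP (r \in C); first by apply: h => //; exact: mem_midpoints.
have hcell := same_cell_rep rC.
suff [r' hr' [c'T hc']] : exists2 r', same_cell C r' r &
    r' \in midpoints C /\ between q.1 c r'.
  apply: passable_same_cell (h _ c'T hc') => // q' _.
  by split; apply: fire_same_cell => //; exact: same_cell_sym.
have [rc|rc] := boolP (between q.1 c (rep C r)).
  exists (rep C r); [exact: same_cell_sym|split => //].
  have [c' c'C hc'] : exists2 c', c' \in C & between q.1 c' r.
    move: cT => /allpairsP[[c1 c2] /= [c1C c2C cE]].
    move: hr; rewrite cE => /between_midpoint[]h'; first by exists c1.
    by exists c2.
  exact: rep_mem_in (hC.1 _ qs) c'C hc'.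
exists c; last by split => //; exact: betweenr.
apply: same_cell_sym; apply: (same_cell_sub hcell).
have qC := hC.1 _ qs.
by apply: between_exit hr rc; [exact: same_cell_le hcell qC|exact: same_cell_ge hcell qC].
Qed.

End solution.
End finite_marks.

(** * The algorithm on lists of marks *)

Section algorithm.
Context {R : realType} (p : R).
Implicit Types (q : R * R) (b : R * R -> R -> Prop).
Implicit Types (s S : seq (R * R)) (C T U : seq R).

Local Notation arrival := (arrival p).

(** [S] lists pairs of a site and a burn time. The pair [(r, 0)] is added for the extinction test
    only; for recovery, time 0 is dealt with by [1 <= v]. *)
Definition passableb s S (r v : R) : bool :=
  [&& 1 <= v,
      all (fun e => ~~ [&& e.1 == r, v - 1 < e.2 & e.2 < v]) S &
      all (fun k => all (fun e => ~~ [&& k.1 == r, e.1 == r, k.2 - 1 < e.2,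
        e.2 < k.2, k.2 < v & v < k.2 + k.2 - e.2]) ((r, 0) :: S)) s].

Definition reaches s S T q x : bool :=
  all (fun c => between q.1 x c ==> passableb s S c (arrival q c)) T.

Definition fire_step s T S : seq (R * R) :=
  [seq (e.2, arrival e.1 e.2) |
     e <- [seq e <- [seq (q, c) | q <- s, c <- T] | reaches s S T e.1 e.2]].

(** The list of pairs serves only as a counter: its length bounds the number of rounds needed. *)
Definition fire_table s T : seq (R * R) :=
  foldr (fun _ => fire_step s T) [::] [seq (q, c) | q <- s, c <- T].

(** The query site is itself a cut point, so that it is one of the midpoints at which the table is
    exact. *)
Definition critical_points s x : seq R :=
  x :: [seq q.1 | q <- s] ++
  flatten [seq flatten [seq [:: crossing p i j (-1); crossing p i j 0;
                                crossing p i j 1] | j <- s] | i <- s].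

Definition fire_times s x : seq R :=
  let T := midpoints (critical_points s x) in
  let S := fire_table s T in
  [seq arrival q x | q <- [seq q <- s | reaches s S T q x]].

Definition last_time U (t : R) := \big[Num.max/0]_(u <- U | u <= t) u.
Definition last_before U (t : R) := \big[Num.max/0]_(u <- U | u < t) u.
Definition Zval U t := Num.min 1 (t - last_time U t).
(** The amount $Z_{t-}1_{Z_{t-}<1}$ that a mark at t adds to H. *)
Definition jump U t :=
  let z := Num.min 1 (t - last_before U t) in if z < 1 then z else 0.
(** The first suitable mark of the list decides, which is right when abscissas are distinct: a
    column then holds at most one mark. *)
Definition Hval U s x t :=
  foldr (fun k h => if (k.1 == x) && (k.2 <= t)
                    then Num.max 0 (jump U k.2 - (t - k.2)) else h) 0 s.

Definition forest_fire t x s : R * (R * R) :=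
  let U := fire_times s x in
  (Zval U t, (Hval U s x t, (count_mem t U)%:R)).

Hypothesis p_ge0 : 0 <= p.

Lemma critical_pointsP s x : critical p s (critical_points s x).
Proof.
split => [q qs|i j e si sj se]; rewrite inE mem_cat; apply/orP; right; apply/orP.
  by left; apply: map_f.
right; apply/flattenP; eexists; first by apply/mapP; exists i.
apply/flattenP; eexists; first by apply/mapP; exists j.
by move: se; rewrite !inE => /or3P[] /eqP ->; rewrite eqxx ?orbT.
Qed.

Lemma passablebP s S r v :
  reflect (passable (column [set` s] r) [set u | (r, u) \in S] v)
          (passableb s S r v).
Proof.
apply: (iffP and3P) => -[v1 h1 h2]; split => //.
- move=> u uS; apply/negP => /andP[a a']; have /negP := allP h1 _ uS.
  by apply; rewrite /= eqxx a.
- move=> t u /= ts hu; apply/negP => h; have /allP/(_ (r, u)) := allP h2 _ ts.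
  rewrite inE /= !eqxx /= => /(_ _)/negP; apply => //.
  by case: hu => [->|->]; rewrite ?eqxx ?orbT.
- apply/allP => -[a u] eS; apply/negP => /and3P[/= /eqP ar u1 u2].
  have rS : (r, u) \in S by rewrite -ar.
  by have /negP := h1 u rS; apply; rewrite u1.
- apply/allP => -[a t] ks; apply/allP => -[c u] eS.
  apply/negP => /and5P[/= /eqP ar /eqP cr a1 a2 /andP[a3 a4]].
  have rs : column [set` s] r t by rewrite /column /= -ar.
  have uS : u = 0 \/ (r, u) \in S.
    by move: eS; rewrite inE xpair_eqE cr => /orP[/andP[_ /eqP ->]|]; [left|right].
  by have /negP := h2 t u rs uS; apply; apply/and4P.
Qed.

Lemma mem_fire_step s T S r u : ((r, u) \in fire_step s T S) <->
  exists2 q, q \in s & [/\ r \in T, reaches s S T q r & u = arrival q r].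
Proof.
split => [/mapP[[q c]]|[q qs [rT h ->]]].
  rewrite mem_filter => /andP[h /allpairsP[[q' c'] /= [q's c'T [e1 e2]]]] [-> ->].
  by exists q; [rewrite e1|rewrite e2; split => //; rewrite -e2].
apply/mapP; exists (q, r) => //; rewrite mem_filter h /=.
exact: allpairs_f.
Qed.

Section correctness.
Variables (s : seq (R * R)) (C : seq R) (b : R * R -> R -> Prop).
Hypotheses (hC : critical p s C) (sb : fire_system p [set` s] b).
Let T := midpoints C.
Let before q x := count (fun e : R * R * R => arrival e.1 e.2 < arrival q x)
                        [seq (q, c) | q <- s, c <- T].

Let reaches_fire S q c : q \in s -> c \in T ->
  (forall c' u, c' \in T -> between q.1 c c' -> u < arrival q c' ->
    (c', u) \in S <-> burns p b c' u) ->
  reaches s S T q c <-> b q c.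
Proof.
move=> qs cT key; rewrite (fire_midpoints p_ge0 hC sb qs cT); split.
  move=> /allP h c' c'T hc'; have := h _ c'T; rewrite hc' => /passablebP.
  by apply: passable_sub => // u bu lt; apply/key.
move=> h; apply/allP => c' c'T; apply/implyP => hc'; apply/passablebP.
by apply: passable_sub (h _ c'T hc') => // u bu lt; apply/key.
Qed.

(** After n rounds the entries with at most n earlier arrivals are final, because an entry that
    influences [(q, c)] has strictly fewer arrivals before it. *)
Lemma reachesP n q c : q \in s -> c \in T -> (before q c <= n)%N ->
  reaches s (iter n (fire_step s T) [::]) T q c <-> b q c.
Proof.
elim: n q c => [|n ih] q c qs cT bn; apply: reaches_fire => // c' u c'T hc' lt.
  split => // -[q' bq' e]; exfalso.
  move: bn; rewrite leqn0; apply/negP; rewrite -lt0n -has_count.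
  apply/hasP; exists (q', c').
    by apply: allpairs_f => //; exact: fire_mem sb _ _ bq'.
  by rewrite /= e; apply: lt_le_trans lt (arrival_between p_ge0 _).
have blt q' : q' \in s -> arrival q' c' = u -> (before q' c' <= n)%N.
  move=> q's e; rewrite -ltnS; apply: leq_trans _ bn.
  have lt' : u < arrival q c by apply: lt_le_trans lt (arrival_between p_ge0 _).
  apply: (@count_lt _ _ _ _ (q', c')).
  - by move=> [j d] /= h; apply: lt_trans h _; rewrite e.
  - exact: allpairs_f.
  - by rewrite /= e.
  - by rewrite /= ltxx.
rewrite iterS mem_fire_step; split => [[q' q's [_ h e]]|[q' bq' e]].
  by exists q' => //; apply/ih => //; exact: blt.
have q's := fire_mem sb bq'.
by exists q' => //; split => //; apply/ih => //; exact: blt.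
Qed.

Lemma reaches_table q c : q \in s -> c \in T ->
  reaches s (fire_table s T) T q c <-> b q c.
Proof.
move=> qs cT; have -> : fire_table s T =
    iter (size [seq (q, c) | q <- s, c <- T]) (fire_step s T) [::].
  by rewrite /fire_table; elim: [seq (q, c) | q <- s, c <- T] => // a l /= ->.
by apply: reachesP => //; exact: count_size.
Qed.

End correctness.

Lemma fire_timesE s x b : fire_system p [set` s] b ->
  fire_times s x = [seq arrival q x | q <- [seq q <- s | `[<b q x>]]].
Proof.
move=> sb; rewrite /fire_times; congr map; apply: eq_in_filter => q qs.
have hC := critical_pointsP s x.
have xT : x \in midpoints (critical_points s x).
  by apply: mem_midpoints; exact: mem_head.
by apply/idP/asboolP => /(reaches_table hC sb qs xT).
Qed.

End algorithm.

(** * Programs that compute the algorithm *)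

Section combinators.
Import Defs.
Implicit Types (E A B : ty).

Definition pone E : prog E Real := Comp One (Bang E).
Definition pzero E : prog E Real := Comp Sub (Tuple (pone E) (pone E)).
Definition padd E (a b : prog E Real) := Comp Add (Tuple a b).
Definition psub E (a b : prog E Real) := Comp Sub (Tuple a b).
Definition pmul E (a b : prog E Real) := Comp Mul (Tuple a b).
Definition pinv E (a : prog E Real) := Comp Inv a.
Definition pfst E A B (a : prog E (Pair A B)) := Comp (Fst A B) a.
Definition psnd E A B (a : prog E (Pair A B)) := Comp (Snd A B) a.
Definition pcons E A (a : prog E A) l := Comp (Cons A) (Tuple a l).
Definition pnil E A : prog E (List A) := Comp (Nil A) (Bang E).

(* Booleans are coded by 0 and 1. *)
Definition pif E A (c : prog E Real) (a b : prog E A) := IfLe (pone E) c a b.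
Definition ple E (a b : prog E Real) := IfLe a b (pone E) (pzero E).
Definition pnot E (a : prog E Real) := pif a (pzero E) (pone E).
Definition pand E (a b : prog E Real) := pif a b (pzero E).
Definition por E (a b : prog E Real) := pif a (pone E) b.
Definition plt E (a b : prog E Real) := pnot (ple b a).
Definition peq E (a b : prog E Real) := pand (ple a b) (ple b a).

(* The weakening of a program to an environment extended by a variable. *)
Definition wk E X A (a : prog E A) : prog (Pair E X) A := Comp a (Fst E X).
Definition var E X : prog (Pair E X) X := Snd E X.

(** The environment and the two arguments of the body are rearranged into nested pairs, so that
    bodies are written with [wk] and [var] in the manner of de Bruijn indices. *)
Definition pfold E A B (f : prog (Pair (Pair E A) B) B) (b : prog E B)
    (l : prog E (List A)) : prog E B :=
  Comp (Fold (Comp f (Tuple (Tuple (Fst _ _) (Comp (Fst _ _) (Snd _ _)))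
                            (Comp (Snd _ _) (Snd _ _)))) b)
       (Tuple (Id E) l).
Definition pall E A (f : prog (Pair E A) Real) (l : prog E (List A)) :=
  pfold (pand (wk _ f) (var _ Real)) (pone E) l.
Definition pmap E A B (f : prog (Pair E A) B) (l : prog E (List A)) :=
  pfold (pcons (wk _ f) (var _ (List B))) (pnil E B) l.
Definition pfilter E A (f : prog (Pair E A) Real) (l : prog E (List A)) :=
  pfold (pif (wk _ f) (pcons (wk _ (var E A)) (var _ (List A))) (var _ (List A)))
        (pnil E A) l.
Definition pcat E A (l l' : prog E (List A)) :=
  pfold (pcons (wk _ (var E A)) (var _ (List A))) l' l.
Definition pflatmap E A B (f : prog (Pair E A) (List B)) (l : prog E (List A)) :=
  pfold (pcat (wk _ f) (var _ (List B))) (pnil E B) l.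
Definition ppairs E A B (l : prog E (List A)) (l' : prog E (List B)) :=
  pflatmap (pmap (Tuple (wk _ (var E A)) (var _ B)) (wk _ l')) l.

Context {R : realType}.
Local Notation run := (@run R).

Lemma run_pfold E A B (f : prog (Pair (Pair E A) B) B) b l e :
  run (pfold f b l) e =
  foldr (fun h acc => run f ((e, h), acc)) (run b e) (run l e).
Proof. by []. Qed.

Lemma run_pfold_eq E A B (f : prog (Pair (Pair E A) B) B) b l e
    (g : val_of R A -> val_of R B -> val_of R B) :
  (forall h acc, run f ((e, h), acc) = g h acc) ->
  run (pfold f b l) e = foldr g (run b e) (run l e).
Proof. by move=> h; rewrite run_pfold; elim: (run l e) => //= a m ->. Qed.

Lemma run_pcons E A (a : prog E A) l e :
  run (pcons a l) e = run a e :: run l e.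
Proof. by []. Qed.

Lemma run_var E X (e : val_of R E) (x : val_of R X) : run (var E X) (e, x) = x.
Proof. by []. Qed.

Lemma run_pzero E e : run (pzero E) e = 0 :> R.
Proof. exact: subrr. Qed.

Lemma run_padd E (a b : prog E Real) e :
  run (padd a b) e = (run a e : R) + run b e :> R.
Proof. by []. Qed.

Lemma run_psub E (a b : prog E Real) e :
  run (psub a b) e = (run a e : R) - run b e :> R.
Proof. by []. Qed.

Lemma run_pif E A (c : prog E Real) (a b : prog E A) (d : bool) e : run c e = d%:R :> R ->
  run (pif c a b) e = if d then run a e else run b e.
Proof.
by move=> h; rewrite /= h; case: d {h} => /=; rewrite ?lexx// leNgt ltr01.
Qed.

Lemma run_ple E (a b : prog E Real) e :
  run (ple a b) e = ((run a e : R) <= run b e)%R%:R :> R.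
Proof. by rewrite /= subrr; case: ifP. Qed.

Lemma run_pnot E (a : prog E Real) (d : bool) (e : val_of R E) : run a e = d%:R :> R ->
  run (pnot a) e = (~~ d)%:R :> R.
Proof. by move=> h; rewrite (run_pif _ _ h) run_pzero; case: d h. Qed.

Lemma run_pand E (a b : prog E Real) (d d' : bool) (e : val_of R E) : run a e = d%:R :> R ->
  run b e = d'%:R :> R -> run (pand a b) e = (d && d')%:R :> R.
Proof. by move=> h h'; rewrite (run_pif _ _ h) run_pzero; case: d h. Qed.

Lemma run_por E (a b : prog E Real) (d d' : bool) (e : val_of R E) : run a e = d%:R :> R ->
  run b e = d'%:R :> R -> run (por a b) e = (d || d')%:R :> R.
Proof. by move=> h h'; rewrite (run_pif _ _ h); case: d h. Qed.

Lemma run_plt E (a b : prog E Real) e :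
  run (plt a b) e = ((run a e : R) < run b e)%R%:R :> R.
Proof. by rewrite (run_pnot (run_ple _ _ _)) ltNge. Qed.

Lemma run_peq E (a b : prog E Real) e :
  run (peq a b) e = ((run a e : R) == run b e)%:R :> R.
Proof. by rewrite (run_pand (run_ple _ _ _) (run_ple _ _ _)) eq_le. Qed.

Lemma run_pall E A (f : prog (Pair E A) Real) l (d : pred (val_of R A)) e :
  (forall a, run f (e, a) = (d a)%:R :> R) ->
  run (pall f l) e = (all d (run l e))%:R :> R.
Proof.
move=> h; rewrite run_pfold; elim: (run l e) => // a m ih.
exact: (run_pand (a := wk _ f) (b := var _ Real) (e := ((e, a), _)) (h a) ih).
Qed.

Lemma run_pmap E A B (f : prog (Pair E A) B) l e :
  run (pmap f l) e = [seq run f (e, a) | a <- run l e].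
Proof. by rewrite run_pfold; elim: (run l e) => //= a m ->. Qed.

Lemma run_pfilter E A (f : prog (Pair E A) Real) l (d : pred (val_of R A)) e :
  (forall a, run f (e, a) = (d a)%:R :> R) ->
  run (pfilter f l) e = [seq a <- run l e | d a].
Proof.
move=> h; rewrite run_pfold; elim: (run l e) => // a m ih.
by rewrite [RHS]/= -ih; exact: (run_pif (c := wk _ f) _ _ (e := ((e, a), _)) (h a)).
Qed.

Lemma run_pcat E A (l l' : prog E (List A)) e :
  run (pcat l l') e = run l e ++ run l' e.
Proof. by rewrite run_pfold; elim: (run l e) => //= a m ->. Qed.

Lemma run_pflatmap E A B (f : prog (Pair E A) (List B)) l e :
  run (pflatmap f l) e = flatten [seq run f (e, a) | a <- run l e].
Proof.
rewrite run_pfold; elim: (run l e) => // a m ih.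
by rewrite [RHS]/= -ih; exact: (run_pcat (wk _ f) (var _ (List B)) ((e, a), _)).
Qed.

Lemma run_ppairs E A B (l : prog E (List A)) (l' : prog E (List B)) e :
  run (ppairs l l') e = [seq (a, b) | a <- run l e, b <- run l' e].
Proof.
rewrite run_pflatmap; congr flatten; apply: eq_map => a.
Qed.

End combinators.

Section program.
Import Defs.
Implicit Types (E : ty).
Local Notation Mark := (Pair Real Real).

Definition pnorm E (a : prog E Real) := pif (ple (pzero E) a) a (psub (pzero E) a).
Definition pmax E (a b : prog E Real) := pif (plt a b) b a.
Definition pmin E (a b : prog E Real) := pif (plt a b) a b.

Definition parrival E (p : prog E Real) (q : prog E Mark) (x : prog E Real) :=
  padd (psnd q) (pmul p (pnorm (psub x (pfst q)))).

Definition pbetween E (a b r : prog E Real) :=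
  pand (ple (pmin a b) r) (ple r (pmax a b)).

Definition pcrossing E (p : prog E Real) (i j : prog E Mark) (e : prog E Real) :=
  pmul (padd (padd (psub (psnd j) (psnd i)) e) (pmul p (padd (pfst i) (pfst j))))
       (pinv (pmul (padd (pone E) (pone E)) p)).

Definition pmidpoints E (l : prog E (List Real)) :=
  pmap (pmul (padd (pfst (var E Mark)) (psnd (var E Mark)))
             (pinv (padd (pone _) (pone _)))) (ppairs l l).

Definition ppassable E (s S : prog E (List Mark)) (r v : prog E Real) :=
  pand (ple (pone E) v)
  (pand (pall (pnot (pand (peq (pfst (var E Mark)) (wk _ r))
                    (pand (plt (psub (wk _ v) (pone _)) (psnd (var E Mark)))
                          (plt (psnd (var E Mark)) (wk _ v))))) S)
        (pall (pall (let k := wk Mark (var E Mark) in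
                     let e := var (Pair E Mark) Mark in
                     let r := wk Mark (wk Mark r) in
                     let v := wk Mark (wk Mark v) in
                     pnot (pand (peq (pfst k) r)
                          (pand (peq (pfst e) r)
                          (pand (plt (psub (psnd k) (pone _)) (psnd e))
                          (pand (plt (psnd e) (psnd k))
                          (pand (plt (psnd k) v)
                                (plt v (psub (padd (psnd k) (psnd k)) (psnd e)))))))))
                    (pcons (Tuple (wk Mark r) (pzero _)) (wk Mark S))) s)).

Definition preaches E (p : prog E Real) (s S : prog E (List Mark))
    (T : prog E (List Real)) (q : prog E Mark) (x : prog E Real) :=
  pall (let c := var E Real in
        por (pnot (pbetween (pfst (wk _ q)) (wk _ x) c))
            (ppassable (wk _ s) (wk _ S) c (parrival (wk _ p) (wk _ q) c))) T.

Definition pfire_step E (p : prog E Real) (s : prog E (List Mark))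
    (T : prog E (List Real)) (S : prog E (List Mark)) :=
  let e := var E (Pair Mark Real) in
  pmap (Tuple (psnd e) (parrival (wk _ p) (pfst e) (psnd e)))
       (pfilter (preaches (wk _ p) (wk _ s) (wk _ S) (wk _ T) (pfst e) (psnd e))
                (ppairs s T)).

Definition pfire_table E (p : prog E Real) (s : prog E (List Mark))
    (T : prog E (List Real)) :=
  pfold (pfire_step (wk _ (wk _ p)) (wk _ (wk _ s)) (wk _ (wk _ T))
                    (var (Pair E (Pair Mark Real)) (List Mark)))
        (pnil E Mark) (ppairs s T).

Definition pcritical_points E (p : prog E Real) (s : prog E (List Mark))
    (x : prog E Real) :=
  pcons x (pcat (pmap (pfst (var E Mark)) s)
    (pflatmap (pflatmap
      (let i := wk Mark (var E Mark) in let j := var (Pair E Mark) Mark in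
       let p := wk Mark (wk Mark p) in
       pcons (pcrossing p i j (psub (pzero _) (pone _)))
      (pcons (pcrossing p i j (pzero _))
      (pcons (pcrossing p i j (pone _)) (pnil _ _)))) (wk _ s)) s)).

Definition pfire_times_with E (p : prog E Real) (s : prog E (List Mark))
    (x : prog E Real) (T : prog E (List Real)) (S : prog E (List Mark)) :=
  pmap (parrival (wk _ p) (var E Mark) (wk _ x))
       (pfilter (preaches (wk _ p) (wk _ s) (wk _ S) (wk _ T) (var E Mark) (wk _ x)) s).

Definition plet E A B (a : prog E A) (b : prog (Pair E A) B) : prog E B :=
  Comp b (Tuple (Id E) a).

Definition pfire_times E (p : prog E Real) (s : prog E (List Mark))
    (x : prog E Real) :=
  plet (pmidpoints (pcritical_points p s x))
    (plet (pfire_table (wk _ p) (wk _ s) (var E _))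
       (pfire_times_with (wk _ (wk _ p)) (wk _ (wk _ s)) (wk _ (wk _ x))
          (wk _ (var E _)) (var _ _))).

(** The comparison [c] is a parameter, so that one program yields both [last_time] and
    [last_before]. *)
Definition plast E (c : forall E, prog E Real -> prog E Real -> prog E Real)
    (U : prog E (List Real)) (t : prog E Real) :=
  pfold (let u := wk Real (var E Real) in let a := var (Pair E Real) Real in
         pif (c _ u (wk _ (wk _ t))) (pmax u a) a) (pzero E) U.

Definition pZval E (U : prog E (List Real)) (t : prog E Real) :=
  pmin (pone E) (psub t (plast ple U t)).

Definition pjump E (U : prog E (List Real)) (t : prog E Real) :=
  plet (pmin (pone E) (psub t (plast plt U t)))
       (pif (plt (var E _) (pone _)) (var E _) (pzero _)).

Definition pHval E (U : prog E (List Real)) (s : prog E (List Mark))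
    (x t : prog E Real) :=
  pfold (let k := wk Real (var E Mark) in let h := var (Pair E Mark) Real in
         let U := wk Real (wk Mark U) in let t := wk Real (wk Mark t) in
         pif (pand (peq (pfst k) (wk _ (wk _ x))) (ple (psnd k) t))
             (pmax (pzero _) (psub (pjump U (psnd k)) (psub t (psnd k)))) h)
        (pzero E) s.

Definition pcount E (U : prog E (List Real)) (t : prog E Real) :=
  pfold (let u := wk Real (var E Real) in let a := var (Pair E Real) Real in
         padd (peq u (wk _ (wk _ t))) a) (pzero E) U.

Definition pforest_fire : simulator :=
  let E := Pair (Pair Real (Pair Real Real)) (List (Pair Real Real)) in
  let p := pfst (pfst (Id E)) in
  let t := pfst (psnd (pfst (Id E))) in
  let x := psnd (psnd (pfst (Id E))) in
  let s := psnd (Id E) in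
  plet (pfire_times p s x)
    (let U := var E (List Real) in
     Tuple (pZval U (wk _ t))
           (Tuple (pHval U (wk _ s) (wk _ x) (wk _ t)) (pcount U (wk _ t)))).

Context {R : realType}.
Local Notation run := (@run R).

Lemma run_plet E A B (a : prog E A) (b : prog (Pair E A) B) e :
  run (plet a b) e = run b (e, run a e).
Proof. by []. Qed.

Lemma run_pnorm E (a : prog E Real) e : run (pnorm a) e = `|run a e|.
Proof.
rewrite (run_pif _ _ (run_ple _ _ _)) run_pzero; case: ifPn => h.
  by rewrite ger0_norm.
by rewrite ltr0_norm ?ltNge// /= subrr sub0r.
Qed.

Lemma run_pmax E (a b : prog E Real) e : run (pmax a b) e = Num.max (run a e) (run b e).
Proof. by rewrite (run_pif _ _ (run_plt _ _ _)) maxElt. Qed.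

Lemma run_pmin E (a b : prog E Real) e : run (pmin a b) e = Num.min (run a e) (run b e).
Proof. by rewrite (run_pif _ _ (run_plt _ _ _)) minElt. Qed.

Lemma run_parrival E (p : prog E Real) q x e :
  run (parrival p q x) e = arrival (run p e) (run q e) (run x e).
Proof. by rewrite /arrival -[`|_|](run_pnorm (psub x (pfst q))). Qed.

Lemma run_pbetween E (a b r : prog E Real) e :
  run (pbetween a b r) e = (between (run a e) (run b e) (run r e))%:R :> R.
Proof. by rewrite (run_pand (run_ple _ _ _) (run_ple _ _ _)) run_pmin run_pmax. Qed.

Lemma run_pmidpoints E (l : prog E (List Real)) e :
  run (pmidpoints l) e = midpoints (run l e).
Proof.
rewrite run_pmap run_ppairs /midpoints map_flatten -map_comp.
by congr flatten; apply: eq_map => a /=; rewrite -map_comp; apply: eq_map.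
Qed.

Lemma run_ppassable E s S r v (e : val_of R E) : run (ppassable s S r v) e =
  (passableb (run s e) (run S e) (run r e) (run v e))%:R :> R.
Proof.
apply: run_pand; first exact: run_ple.
apply: run_pand; apply: run_pall => a.
  by do ![apply: run_pnot|apply: run_pand|apply: run_peq|apply: run_plt].
have -> : (run r e, 0) :: run S e =
    run (pcons (Tuple (wk Mark r) (pzero _)) (wk Mark S)) (e, a).
  by rewrite /= subrr.
apply: run_pall => c.
by do ![apply: run_pnot|apply: run_pand|apply: run_peq|apply: run_plt].
Qed.

Lemma run_preaches E p s S T q x (e : val_of R E) :
  run (preaches p s S T q x) e =
  (reaches (run p e) (run s e) (run S e) (run T e) (run q e) (run x e))%:R :> R.
Proof.
apply: run_pall => c; rewrite implybE; apply: run_por.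
  exact/run_pnot/run_pbetween.
by rewrite run_ppassable run_parrival.
Qed.

Lemma run_pfire_step E p s T S (e : val_of R E) : run (pfire_step p s T S) e =
  fire_step (run p e) (run s e) (run T e) (run S e).
Proof.
rewrite run_pmap (run_pfilter _ (d := fun a : val_of R (Pair Mark Real) => reaches (run p e) (run s e)
  (run S e) (run T e) a.1 a.2)); last by move=> a; exact: run_preaches.
rewrite run_ppairs; apply: eq_map => a.
exact: (congr1 (pair a.2) (run_parrival (wk _ p) (pfst (var _ _)) (psnd (var _ _)) (e, a))).
Qed.

Lemma run_pfire_table E p s T (e : val_of R E) : run (pfire_table p s T) e =
  fire_table (run p e) (run s e) (run T e).
Proof.
rewrite run_pfold run_ppairs /fire_table.
elim: [seq (a, b) | a <- run s e, b <- run T e] => // a l ih.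
rewrite [RHS]/= -ih; set S := foldr _ _ l.
exact: (run_pfire_step (wk _ (wk _ p)) (wk _ (wk _ s)) (wk _ (wk _ T)) (var _ _)
  ((e, a, S) : val_of R (Pair (Pair E (Pair Mark Real)) (List Mark)))).
Qed.

Lemma run_pcritical_points E p s x (e : val_of R E) :
  run (pcritical_points p s x) e =
  critical_points (run p e) (run s e) (run x e).
Proof.
rewrite /critical_points /pcritical_points.
rewrite run_pcons run_pcat run_pmap run_pflatmap.
congr (_ :: _ ++ flatten _); apply: eq_map => i.
rewrite run_pflatmap; congr flatten; apply: eq_map => j.
by rewrite /= /crossing subrr sub0r.
Qed.

Lemma run_pfire_times E p s x (e : val_of R E) :
  run (pfire_times p s x) e = fire_times (run p e) (run s e) (run x e).
Proof.
rewrite /pfire_times run_plet run_plet.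
set a := run (pmidpoints _) e.
have aE : a = midpoints (critical_points (run p e) (run s e) (run x e)).
  by rewrite /a run_pmidpoints run_pcritical_points.
set S := run (pfire_table _ _ _) _.
have SE : S = fire_table (run p e) (run s e) a by rewrite /S run_pfire_table.
rewrite run_pmap (run_pfilter _ (d := fun q : val_of R Mark =>
  reaches (run p e) (run s e) S a q (run x e))); last first.
  by move=> q; rewrite run_preaches.
rewrite /fire_times -aE -SE; apply: eq_map => q.
by rewrite run_parrival.
Qed.

Lemma run_plast E (c : forall E, prog E Real -> prog E Real -> prog E Real)
    (d : rel R) U t (e : val_of R E) :
  (forall E (a b : prog E Real) e, run (c E a b) e = (d (run a e) (run b e))%:R :> R) ->
  run (plast c U t) e =
  foldr (fun u a => if d u (run t e) then Num.max u a else a) 0 (run U e).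
Proof.
move=> h; rewrite (run_pfold_eq _ _ (g := fun u a : val_of R Real =>
  if d u (run t e) then Num.max (u : R) a else a)) ?run_pzero// => u a.
by rewrite (run_pif _ _ (h _ _ _ _)) run_pmax.
Qed.

Lemma bigmaxr_foldr (P : pred R) U :
  foldr (fun u a => if P u then Num.max u a else a) 0 U =
  \big[Num.max/0]_(u <- U | P u) u.
Proof. by elim: U => [|u U ih]; rewrite ?big_nil// big_cons /= ih. Qed.

Lemma run_pZval E U t (e : val_of R E) :
  run (pZval U t) e = Zval (run U e) (run t e).
Proof.
rewrite run_pmin /Zval /last_time -bigmaxr_foldr.
by rewrite -(run_plast (c := ple) (d := <=%R) _ _ _ run_ple).
Qed.

Lemma run_pjump E U t (e : val_of R E) :
  run (pjump U t) e = jump (run U e) (run t e).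
Proof.
rewrite /pjump run_plet /jump /last_before -bigmaxr_foldr.
rewrite -(run_plast (c := plt) (d := <%R) _ _ _ run_plt).
by rewrite (run_pif _ _ (run_plt _ _ _)) run_var run_pzero run_pmin.
Qed.

Lemma run_pHval E U s x t (e : val_of R E) :
  run (pHval U s x t) e = Hval (run U e) (run s e) (run x e) (run t e).
Proof.
rewrite (run_pfold_eq _ _ (g := fun (k : val_of R Mark) (h : val_of R Real) =>
  if (k.1 == run x e :> R) && ((k.2 : R) <= run t e)
  then Num.max 0 (jump (run U e) k.2 - (run t e - k.2)) else h)) ?run_pzero// => k h.
rewrite (run_pif _ _ (run_pand (run_peq _ _ _) (run_ple _ _ _))) run_pmax run_pzero.
rewrite run_psub run_pjump.
by [].
Qed.

Lemma run_pcount E U t (e : val_of R E) :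
  run (pcount U t) e = (count_mem (run t e : R) (run U e))%:R.
Proof.
rewrite (run_pfold_eq _ _ (g := fun (u : val_of R Real) (a : val_of R Real) =>
  (u == run t e :> R)%:R + a : R)) ?run_pzero; last first.
  by move=> u a; rewrite run_padd run_peq.
by elim: (run U e) => //= u l ->; rewrite natrD.
Qed.

Lemma simulate_forest_fire (p t x : R) s :
  simulate pforest_fire p t x s = forest_fire p t x s.
Proof.
rewrite /simulate /forest_fire /pforest_fire run_plet.
set e := (p, (t, x), s).
set U := run (pfire_times _ _ _) _.
have UE : U = fire_times p s x by rewrite /U run_pfire_times.
pose e' : val_of R (Pair (Pair (Pair Real Mark) (List Mark)) (List Real)) := (e, U).
rewrite -UE; congr (_, (_, _)).
- exact: (run_pZval (var _ _) (wk _ (pfst (psnd (pfst (Id _))))) e').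
- exact: (run_pHval (var _ _) (wk _ (psnd (Id _))) (wk _ (psnd (psnd (pfst (Id _)))))
           (wk _ (pfst (psnd (pfst (Id _))))) e').
- exact: (run_pcount (var _ _) (wk _ (pfst (psnd (pfst (Id _))))) e').
Qed.

End program.

(** * Measurability of the outputs of programs *)

Lemma measurable_invr (R : realType) :
  measurable_fun [set: R] (fun x : R => x^-1).
Proof.
have -> : [set: R] = [set~ 0] `|` [set 0].
  by apply/seteqP; split => // x _; have [->|/eqP] := eqVneq x 0; [right|left].
have mC : measurable [set~ (0 : R)] by exact: measurableC.
apply/measurable_funU => //; split; last first.
  apply: (eq_measurable_fun (cst (0 : R))) => [x|].
    by rewrite inE => /= ->; rewrite invr0.
  exact: measurable_cst.
apply: subspace_continuous_measurable_fun => //.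
apply: continuous_in_subspaceT => x; rewrite inE => /= /eqP x0.
exact: inv_continuous.
Qed.

Section run_measurable.
Import Defs.
Context {R : realType} {d} {W : measurableType d}.
Local Notation val_of := (@val_of R).
Local Notation run := (@run R).

Fixpoint dflt (A : ty) : val_of A :=
  match A with
  | Unit => tt
  | Real => 0
  | Pair A B => (dflt A, dflt B)
  | List A => [::]
  end.

(** This replaces a measurable structure on lists: a list-valued map qualifies when each set of
    constant length is measurable and each entry is measurable on it. *)
Fixpoint mval (A : ty) : set W -> (W -> val_of A) -> Prop :=
  match A return set W -> (W -> val_of A) -> Prop with
  | Unit => fun _ _ => True
  | Real => fun D g => measurable_fun D (g : W -> R)
  | Pair A B => fun D g => mval D (fun w => (g w).1) /\ mval D (fun w => (g w).2)
  | List A => fun D g => forall k, measurable (D `&` [set w | size (g w) = k]) /\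
      forall i, (i < k)%N ->
        mval (D `&` [set w | size (g w) = k]) (fun w => nth (dflt A) (g w) i)
  end.

Lemma mval_sub A (D D' : set W) (g : W -> val_of A) :
  measurable D -> measurable D' -> D' `<=` D -> mval D g -> mval D' g.
Proof.
elim: A D D' g => [//||A ihA B ihB|A ihA] D D' g mD mD' DD' /=.
- exact: measurable_funS.
- by move=> [h1 h2]; split; [exact: (ihA D)|exact: (ihB D)].
- move=> h k; have [h1 h2] := h k.
  have E : D' `&` [set w | size (g w) = k] = D' `&` (D `&` [set w | size (g w) = k]).
    by rewrite setIA (setIidl DD').
  have mk : measurable (D' `&` [set w | size (g w) = k]) by rewrite E; exact: measurableI.
  split => // i ik; apply: ihA (h2 i ik) => //.
  exact: setSI.
Qed.

Lemma mval_eq A (D : set W) (g g' : W -> val_of A) :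
  {in D, g =1 g'} -> mval D g -> mval D g'.
Proof.
elim: A D g g' => [//||A ihA B ihB|A ihA] D g g' e /=.
- exact: eq_measurable_fun.
- move=> [h1 h2]; split.
    by apply: ihA h1 => w wD; rewrite e.
  by apply: ihB h2 => w wD; rewrite e.
- move=> h k; have [h1 h2] := h k.
  have E : D `&` [set w | size (g' w) = k] = D `&` [set w | size (g w) = k].
    by apply/seteqP; split => w [Dw /= sk]; split => //=; [rewrite e|rewrite -e]; rewrite ?inE.
  rewrite E; split => // i ik; apply: ihA (h2 i ik) => w /set_mem[Dw _].
  by rewrite e// inE.
Qed.

Lemma mval_set0 A (g : W -> val_of A) : mval set0 g.
Proof.
elim: A g => [//||A ihA B ihB|A ihA] g //=; first exact: measurable_fun_set0.
by move=> k; rewrite set0I.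
Qed.

Lemma mval_bigcup A (D : set W) (F : (set W)^nat) (g : W -> val_of A) :
  (forall n, measurable (F n)) -> D = \bigcup_n F n ->
  (forall n, mval (F n) g) -> mval D g.
Proof.
move=> mF ->; elim: A F g mF => [//||A ihA B ihB|A ihA] F g mF h /=.
- exact/measurable_fun_bigcup.
- by split; [apply: ihA => // n; have [] := h n|apply: ihB => // n; have [] := h n].
- move=> k; rewrite setI_bigcupl; split.
    by apply: bigcup_measurable => n _; have [] := h n k.
  by move=> i ik; apply: ihA => n; have [h1 h2] := h n k => //; exact: h2.
Qed.

Lemma mval_setU A (D1 D2 : set W) (g : W -> val_of A) :
  measurable D1 -> measurable D2 ->
  mval D1 g -> mval D2 g -> mval (D1 `|` D2) g.
Proof.
move=> m1 m2 h1 h2; apply: (mval_bigcup (F := bigcup2 D1 D2)).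
- by move=> [|[|n]] /=.
- by rewrite bigcup2E.
- by move=> [|[|n]] //=; exact: mval_set0.
Qed.

Lemma mval_foldr (E A B : ty) (f : prog (Pair E (Pair A B)) B) (D : set W)
    (e : W -> val_of E) (b : W -> val_of B) (I : Type) (r : seq I) (h : I -> W -> val_of A) :
  (forall g, mval D g -> mval D (run f \o g)) ->
  mval D e -> mval D b -> (forall i, mval D (h i)) ->
  mval D (fun w => foldr (fun h acc => run f (e w, (h, acc))) (b w) [seq h i w | i <- r]).
Proof.
move=> hf he hb hh; elim: r => // i r ih.
pose t w := foldr (fun h acc => run f (e w, (h, acc))) (b w) [seq h i w | i <- r].
exact: (hf (fun w => (e w, (h i w, t w)) : val_of (Pair E (Pair A B)))
           (conj he (conj (hh i) ih))).
Qed.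

(** A comparison splits the domain in two, and a fold becomes a bounded composition once the length
    of its list is fixed. This is why the domain [D] is arbitrary. *)
Lemma run_measurable (A B : ty) (f : prog A B) (D : set W) (g : W -> val_of A) :
  measurable D -> mval D g -> mval D (run f \o g).
Proof.
elim: f D g => {A B}.
- by [].
- by move=> A B C f ihf h ihh D g mD /(ihh _ _ mD)/(ihf _ _ mD).
- by [].
- by move=> A B D g mD [].
- by move=> A B D g mD [].
- by move=> A B C f ihf h ihh D g mD hg; split; [exact: ihf|exact: ihh].
- by move=> D g mD _; exact: measurable_cst.
- by move=> D g mD [h1 h2]; exact: measurable_funD.
- by move=> D g mD [h1 h2]; exact: measurable_funB.
- by move=> D g mD [h1 h2]; exact: measurable_funM.
- move=> D g mD h; apply: (measurableT_comp (@measurable_invr R)); exact: h.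
- move=> A B a iha b ihb f ihf h ihh D g mD hg.
  have ma := iha _ _ mD hg; have mb := ihb _ _ mD hg.
  set D1 := D `&` [set w | (run a (g w) : R) <= run b (g w)].
  have m1 : measurable D1 by exact: measurable_fun_le.
  have m2 : measurable (D `\` D1) by exact: measurableD.
  have -> : D = D1 `|` (D `\` D1) by rewrite setDUK//; exact: subIsetl.
  apply: mval_setU => //.
    apply: (@mval_eq _ _ (run f \o g)).
      by move=> w /set_mem[_ /= ->].
    by apply: ihf => //; apply: mval_sub hg => //; exact: subIsetl.
  apply: (@mval_eq _ _ (run h \o g)).
    move=> w /set_mem[Dw] /=; case: ifP => // le; case; split => //.
  by apply: ihh => //; apply: mval_sub hg => //; exact: subDsetl.
- move=> A D g mD _ k /=; split => [|i].
    have [->|k0] := eqVneq k 0%N.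
      by rewrite (_ : [set _ | _] = setT) ?setIT//; apply/seteqP.
    by rewrite (_ : [set _ | _] = set0) ?setI0//; apply/seteqP; split => // w /= /esym/eqP; rewrite (negbTE k0).
  case: k => // k _; rewrite (_ : _ `&` _ = set0); first exact: mval_set0.
  by apply/seteqP; split => // w [].
- move=> A D g mD [h1 h2] [|k] /=.
    by split => //; rewrite (_ : [set _ | _] = set0) ?setI0//; apply/seteqP; split.
  have E : D `&` [set w | (size (g w).2).+1 = k.+1] = D `&` [set w | size (g w).2 = k].
    by congr (_ `&` _); apply/seteqP; split => w /=; [case|move=> ->].
  rewrite E; have [h3 h4] := h2 k; split => // -[|i] ik /=; last exact: h4.
  by apply: mval_sub h1 => //; exact: subIsetl.
- move=> E A B f ihf b ihb D g mD [h1 h2].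
  apply: (mval_bigcup (F := fun k => D `&` [set w | size (g w).2 = k])).
  + by move=> k; case: (h2 k).
  + by apply/seteqP; split => [w Dw|w [k _ []]//]; exists (size (g w).2).
  + move=> k; have [mk hk] := h2 k; set D' := D `&` _ in mk hk *.
    have h1' : mval D' (fun w => (g w).1) by apply: mval_sub h1 => //; exact: subIsetl.
    pose h (i : 'I_k) w := nth (dflt A) (g w).2 i.
    apply: (@mval_eq _ _ (fun w => foldr (fun a acc => run f ((g w).1, (a, acc)))
        (run b (g w).1) [seq h i w | i <- enum 'I_k])); last first.
      by apply: mval_foldr => //; [move=> u; exact: ihf|exact: ihb|move=> i; exact: hk].
    move=> w /set_mem[Dw /= sk]; congr foldr.
    apply: (@eq_from_nth _ (dflt A)); rewrite size_map size_enum_ord ?sk// => i ik.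
    by rewrite (nth_map (Ordinal ik)) ?size_enum_ord// /h nth_enum_ord.
Qed.

End run_measurable.

(** * The equations at a single site *)

Section site.
Context {R : realType}.
Implicit Types (U : seq R) (S : set R) (A z h : R -> R).

(* A t is the time spent in S during [0, t]. *)
Record occupation S (T : R) A : Prop := {
  occ0 : A 0 = 0;
  occ_ge : forall a b, 0 <= a -> a <= b -> b <= T -> A a <= A b;
  occ_le : forall a b, 0 <= a -> a <= b -> b <= T -> A b - A a <= b - a;
  occ_in : forall a b, 0 <= a -> a <= b -> b <= T ->
    (forall u, a < u < b -> S u) -> A b - A a = b - a;
  occ_out : forall a b, 0 <= a -> a <= b -> b <= T ->
    (forall u, a < u < b -> ~ S u) -> A b = A a }.

Lemma last_time_mem U t : last_time U t = 0 \/
  last_time U t \in U /\ last_time U t <= t.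
Proof.
rewrite /last_time; elim: U => [|u U ih]; first by rewrite big_nil; left.
rewrite big_cons; case: ifPn => [ut|_]; last first.
  by case: ih => [->|[m ?]]; [left|right; rewrite inE m orbT].
case: (leP u) => _; last by right; rewrite mem_head.
by case: ih => [->|[m ?]]; [left|right; rewrite inE m orbT].
Qed.

Lemma last_before_mem U t : last_before U t = 0 \/
  last_before U t \in U /\ last_before U t < t.
Proof.
rewrite /last_before; elim: U => [|u U ih]; first by rewrite big_nil; left.
rewrite big_cons; case: ifPn => [ut|_]; last first.
  by case: ih => [->|[m ?]]; [left|right; rewrite inE m orbT].
case: (leP u) => _; last by right; rewrite mem_head.
by case: ih => [->|[m ?]]; [left|right; rewrite inE m orbT].
Qed.

Lemma last_time_ge0 U t : 0 <= last_time U t.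
Proof. exact: bigmax_ge_id. Qed.

Lemma last_before_ge0 U t : 0 <= last_before U t.
Proof. exact: bigmax_ge_id. Qed.

Lemma last_time_le U t : 0 <= t -> last_time U t <= t.
Proof. by case: (last_time_mem U t) => [->|[]]. Qed.

Lemma last_before_lt U t : 0 < t -> last_before U t < t.
Proof. by case: (last_before_mem U t) => [->|[]]. Qed.

Lemma last_time_max U t u : u \in U -> u <= t -> u <= last_time U t.
Proof. by move=> uU ut; exact: (@bigmax_sup_seq _ _ _ _ _ u). Qed.

Lemma last_before_max U t u : u \in U -> u < t -> u <= last_before U t.
Proof. by move=> uU ut; exact: (@bigmax_sup_seq _ _ _ _ _ u). Qed.

Lemma last_time_eq U a t : 0 <= a -> a = 0 \/ a \in U -> a <= t ->
  (forall u, u \in U -> a < u -> t < u) -> last_time U t = a.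
Proof.
move=> a0 aU at' h; apply/eqP; rewrite eq_le; apply/andP; split; last first.
  by case: aU => [->|aU]; [exact: last_time_ge0|exact: last_time_max].
case: (last_time_mem U t) => [->//|[lU lt]].
by rewrite leNgt; apply/negP => /(h _ lU); rewrite ltNge lt.
Qed.

Lemma last_time_before U s t : last_before U t <= s -> s < t ->
  last_time U s = last_before U t.
Proof.
move=> ls st; apply: last_time_eq => //; first exact: last_before_ge0.
  by case: (last_before_mem U t) => [|[]]; [left|right].
move=> u uU lu; apply: lt_le_trans st _.
by rewrite leNgt; apply/negP => /(last_before_max uU); rewrite leNgt lu.
Qed.

Lemma count_le_before U s t : last_before U t <= s -> s < t ->
  count (fun u => u <= s) U = count (fun u => u < t) U.
Proof.
move=> ls st; apply: eq_in_count => u uU.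
apply/idP/idP => [us|ut]; first exact: le_lt_trans us st.
by apply: le_trans ls; exact: last_before_max.
Qed.

Lemma count_le_lt U t : uniq U -> t \in U ->
  count (fun u => u <= t) U = (count (fun u => u < t) U).+1.
Proof.
move=> uU tU; rewrite -[RHS]addn1.
have -> : 1%N = count_mem t U by rewrite count_uniq_mem// tU.
have e : predU (fun u => u < t) (pred1 t) =1 (fun u => u <= t).
  by move=> u /=; rewrite le_eqVlt orbC.
rewrite -(eq_count e) -[LHS]addn0 -(count_predUI (fun u => u < t) (pred1 t)).
congr (_ + _)%N; apply/esym/eqP; rewrite -leqn0 leqNgt -has_count; apply/hasPn => u _ /=.
by rewrite negb_and -leNgt; case: eqVneq => [->|]; rewrite ?lexx ?orbT.
Qed.

Lemma growth S T A z a b : occupation S T A -> 0 <= a -> a <= b -> b <= T ->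
  (forall u, a <= u <= b -> S u <-> z u < 1) ->
  z a <= 1 -> (forall t, a <= t <= b -> z t = z a + (A t - A a)) ->
  forall t, a <= t <= b -> z t = Num.min 1 (z a + (t - a)).
Proof.
move=> occ a0 ab bT hS za hz t /andP[at' tb].
have below t' : a <= t' <= b -> z a + (t' - a) <= 1 -> z t' = z a + (t' - a).
  move=> /andP[at1 tb1] h; rewrite hz ?at1//; congr (_ + _).
  apply: (occ_in occ) => //; first exact: le_trans bT.
  move=> u /andP[au ut]; apply/hS; first by apply/andP; split; lra.
  rewrite hz; last by apply/andP; split; lra.
  have : A u - A a <= u - a by apply: (occ_le occ) => //; lra.
  lra.
case: leP => h; last first.
  by apply: below; [rewrite at'|exact: ltW].
set c := a + (1 - z a).
have ct : c <= t by rewrite /c; lra.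
have ac : a <= c by rewrite /c; lra.
have zc : z c = 1.
  by rewrite below /c; [lra|apply/andP; split; rewrite /c in ct *; lra|lra].
have ge1 u : c <= u <= b -> 1 <= z u.
  move=> /andP[cu ub]; rewrite -zc (hz c) ?(hz u); [|apply/andP; split; lra..].
  by rewrite lerD2l lerB//; apply: (occ_ge occ) => //; lra.
rewrite (hz t) ?at'//.
have -> : A t = A c.
  apply: (occ_out occ) => //; [lra|lra|] => u /andP[cu ut].
  have uab : a <= u <= b by apply/andP; split; lra.
  move=> /(hS u uab); have : 1 <= z u by apply: ge1; apply/andP; split; lra.
  lra.
by rewrite -(hz c) ?zc//; apply/andP; split; lra.
Qed.

Lemma count_last_time U a t : 0 <= a -> a <= t -> last_time U t <= a ->
  count (fun u => u <= a) U = count (fun u => u <= t) U.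
Proof.
move=> a0 at' la; apply: eq_in_count => u uU.
apply/idP/idP => [ua|ut]; first exact: le_trans at'.
by apply: le_trans la; exact: last_time_max.
Qed.

Lemma Zval_le1 U t : Zval U t <= 1.
Proof. by rewrite ge_min lexx. Qed.

(** Induction on the number of burns. Before a burn z is at most 1, so the unit drop leaves at most
    0; nonnegativity makes this exactly 0, and [growth] applies until the next burn. *)
Lemma Z_unique S T A z U : occupation S T A -> uniq U ->
  (forall u, u \in U -> 0 <= u) ->
  (forall u, 0 <= u <= T -> S u <-> z u < 1) ->
  (forall t, 0 <= t <= T -> 0 <= z t) ->
  (forall t, 0 <= t <= T -> z t = A t - (count (fun u => u <= t) U)%:R) ->
  forall t, 0 <= t <= T -> z t = Zval U t.
Proof.
move=> occ uU U0 hS z0 hz t.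
have [n] := ubnP (count (fun u => u <= t) U); elim: n t => // n ih t.
rewrite ltnS => cn /andP[t0 tT].
set a := last_time U t.
have a0 : 0 <= a by exact: last_time_ge0.
have at' : a <= t by exact: last_time_le.
have zab u : a <= u <= t -> z u = z a + (A u - A a).
  move=> /andP[au ut]; rewrite (hz u); last by apply/andP; split; lra.
  rewrite (hz a); last by apply/andP; split; lra.
  have -> : count (fun v => v <= u) U = count (fun v => v <= a) U.
    rewrite (count_last_time a0 at' (lexx _)).
    by apply: count_last_time => //; exact: le_trans au.
  lra.
have za : z a = 0.
  have [aU|aU] := boolP (a \in U); last first.
    have a00 : a = 0.
      by case: (last_time_mem U t) => //; rewrite -/a (negbTE aU) => -[].
    rewrite hz ?a00 ?lexx ?(le_trans t0)// (occ0 occ).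
    rewrite (_ : count _ _ = 0%N) ?subrr//; apply/eqP; rewrite -leqn0 leqNgt -has_count.
    apply/hasPn => u uU'; rewrite -ltNge lt_neqAle U0// andbT; apply/eqP => u0.
    by move: aU; rewrite a00 u0 uU'.
  have aT : 0 <= a <= T by rewrite a0 (le_trans at').
  have ca := count_le_lt uU aU.
  (* A burn at time 0 would make z negative there, since [A 0 = 0]. *)
  have [a_gt0|] := ltP 0 a; last first.
    move=> a_le0; have a00 : a = 0 by apply/eqP; rewrite eq_le a0 a_le0.
    have := z0 a aT; rewrite hz// ca a00 (occ0 occ) sub0r oppr_ge0.
    by rewrite leNgt ltr0n.
  set a' := last_before U a.
  have a'0 : 0 <= a' by exact: last_before_ge0.
  have a'a : a' < a by exact: last_before_lt.
  have zs s : a' <= s -> s < a -> z a <= a - s.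
    move=> a's sa; have sT : 0 <= s <= T by apply/andP; split; lra.
    have cs := count_le_before a's sa.
    have : z s <= 1.
      rewrite ih ?Zval_le1//; apply: leq_trans cn.
      by rewrite cs -ca; apply: sub_count => u /= ua; exact: le_trans at'.
    rewrite hz// (hz a)// ca cs -natr1.
    have : A a - A s <= a - s by apply: (occ_le occ); lra.
    lra.
  have za0 := z0 a aT; apply/eqP; rewrite eq_le za0 andbT leNgt; apply/negP => za_gt0.
  (* This replaces the limit as s tends to a. The point [a - z a / 2] contradicts [zs], unless the
     previous burn [a'] comes after it, and then [a'] does. *)
  have [h|h] := leP a' (a - z a / 2).
    by have := zs (a - z a / 2) h; lra.
  by have := zs a' (lexx _) a'a; lra.
rewrite (growth occ a0 at' tT _ _ zab) ?za ?at' ?lexx//.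
- by rewrite add0r.
- by move=> u /andP[au ut]; apply: hS; apply/andP; split; lra.
Qed.

Definition spaced U := (forall u, u \in U -> 1 <= u) /\
  (forall u v, u \in U -> v \in U -> u < v -> u + 1 <= v).

(** Burns are at least one unit apart, so each gap contributes exactly 1 to [A], which balances the
    unit drop at its end. *)
Lemma Z_equation S T A U : occupation S T A -> uniq U -> spaced U ->
  (forall u, 0 <= u <= T -> S u <-> Zval U u < 1) ->
  forall t, 0 <= t <= T ->
  Zval U t = A t - (count (fun u => u <= t) U)%:R.
Proof.
move=> occ uU [U1 sU] hS t /andP[t0 tT].
(* the time spent below 1 after a burn at a, up to t before the next one *)
have gain a : 0 <= a -> a = 0 \/ a \in U -> forall t, a <= t <= T ->
    (forall u, u \in U -> a < u -> t <= u) -> A t - A a = Num.min 1 (t - a).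
  move=> a0 aU {t0 tT}t /andP[at' tT] h.
  have ZE u : a < u < t -> Zval U u = Num.min 1 (u - a).
    move=> /andP[au ut]; rewrite /Zval (@last_time_eq _ a)//; first lra.
    by move=> v vU av; apply: lt_le_trans ut _; exact: h.
  have Sin u : a < u < t -> u < a + 1 -> S u.
    move=> aut ua; apply/hS; first by move: aut => /andP[? ?]; apply/andP; split; lra.
    by rewrite ZE// gt_min; apply/orP; right; lra.
  case: leP => ta; last first.
    apply: (occ_in occ) => // u aut; apply: Sin => //; move: aut => /andP[]; lra.
  have -> : A t = A (a + 1).
    apply: (occ_out occ); [lra|lra|lra|move=> u /andP[au ut]].
    move=> /(hS u _)/=; have aut : a < u < t by apply/andP; split; lra.
    rewrite ZE// => /(_ _); rewrite min_l; last lra.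
    by rewrite ltxx => H; have : false by apply: H; apply/andP; split; lra.
  rewrite (occ_in occ); [lra|lra|lra|lra|move=> u /andP[au ut]].
  by apply: Sin => //; apply/andP; split; lra.
have at_burn : forall a, a <= T -> a = 0 \/ a \in U ->
    A a = (count (fun u => u <= a) U)%:R.
  move=> {t t0 tT}a; have [n] := ubnP (count (fun u => u <= a) U).
  elim: n a => // n ih a; rewrite ltnS => cn aT [->|aU].
    rewrite (occ0 occ) (_ : count _ _ = 0%N)//; apply/eqP.
    rewrite -leqn0 leqNgt -has_count; apply/hasPn => u /U1 u1; rewrite -ltNge; lra.
  have a1 := U1 _ aU.
  set a' := last_before U a.
  have a'0 : 0 <= a' by exact: last_before_ge0.
  have a'a : a' < a by apply: last_before_lt; lra.
  have a'U : a' = 0 \/ a' \in U.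
    by case: (last_before_mem U a) => [|[]]; [left|right].
  have ca := count_le_lt uU aU.
  have ca' := count_le_before (lexx a') a'a.
  have Aa' : A a' = (count (fun u => u <= a') U)%:R.
    apply: ih => //; [by rewrite ca' -ltnS -ca|lra].
  have := gain a' a'0 a'U a; rewrite Aa' ca' ca -natr1 min_l.
    move=> /(_ _ _)/eqP; rewrite subr_eq addrC => /(_ _ _)/eqP; apply.
      by apply/andP; split; lra.
    move=> u uU' a'u; rewrite leNgt; apply/negP => ua.
    by have := last_before_max uU' ua; rewrite leNgt a'u.
  by case: a'U => [->|a'U]; [lra|have := sU _ _ a'U aU a'a; lra].
set a := last_time U t.
have a0 : 0 <= a by exact: last_time_ge0.
have at' : a <= t by exact: last_time_le.
have aU : a = 0 \/ a \in U by case: (last_time_mem U t) => [|[]]; [left|right].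
rewrite -(count_last_time a0 at' (lexx _)) -at_burn//; last lra.
rewrite gain//; first by rewrite at' tT.
move=> u uU' au; apply/ltW; rewrite ltNge; apply/negP => ut.
by have := last_time_max uU' ut; rewrite leNgt au.
Qed.

(** After the mark at [s0], [growth] applies to [1 - h]; before it, nonnegativity and the equation
    force 0. A column without mark is the case [J = 0]. *)
Lemma H_unique S T B h s0 J : occupation S T B -> 0 <= J ->
  (forall u, 0 <= u <= T -> S u <-> 0 < h u) ->
  (forall t, 0 <= t <= T -> 0 <= h t) -> 0 <= s0 ->
  (forall t, 0 <= t <= T -> h t = (if s0 <= t then J else 0) - B t) ->
  forall t, 0 <= t <= T ->
  h t = if s0 <= t then Num.max 0 (J - (t - s0)) else 0.
Proof.
move=> occ J0 hS h0 s00 hh t /andP[t0 tT].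
have B0 u : 0 <= u <= T -> 0 <= B u.
  by move=> /andP[u0 uT]; rewrite -(occ0 occ); exact: (occ_ge occ).
have hlt u : 0 <= u <= T -> u < s0 -> h u = 0.
  move=> uT us; have := h0 u uT; have := B0 u uT; rewrite hh// (leNgt s0) us /=; lra.
case: leP => st; last by apply: hlt => //; rewrite t0.
have Bs0 : B s0 = 0.
  rewrite -(occ0 occ); apply: (occ_out occ) => //; first lra.
  move=> u /andP[u0 us]; have uT : 0 <= u <= T by apply/andP; split; lra.
  by move=> /(hS u uT); rewrite hlt// ltxx.
pose z u := 1 - h u.
have hs0 : h s0 = J by rewrite hh ?lexx ?Bs0 ?subr0// s00; lra.
have := @growth S T B z s0 t occ s00 st tT _ _ _ t.
rewrite st lexx /z hs0 => /(_ _ _ _ isT) H.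
suff : 1 - h t = Num.min 1 (1 - J + (t - s0)).
  by case: leP => ?; case: leP => ?; lra.
apply: H => //.
- move=> u /andP[su ut]; rewrite hS; last by apply/andP; split; lra.
  by split; lra.
- lra.
- move=> u /andP[su ut]; rewrite (hh u); last by apply/andP; split; lra.
  by rewrite su Bs0; lra.
Qed.

Lemma H_equation S T B s0 J : occupation S T B -> 0 <= J -> 0 <= s0 ->
  (forall u, 0 <= u <= T -> S u <-> s0 <= u < s0 + J) ->
  forall t, 0 <= t <= T ->
  (if s0 <= t then Num.max 0 (J - (t - s0)) else 0) =
  (if s0 <= t then J else 0) - B t.
Proof.
move=> occ J0 s00 hS t /andP[t0 tT].
have Bs u : 0 <= u <= T -> u <= s0 -> B u = 0.
  move=> /andP[u0 uT] us; rewrite -(occ0 occ); apply: (occ_out occ) => //.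
  move=> v /andP[v0 vu]; have vT : 0 <= v <= T by apply/andP; split; lra.
  by move=> /(hS v vT)/andP[]; lra.
case: leP => st; last by rewrite Bs ?subr0 ?t0//; exact: ltW.
have Bs0 : B s0 = 0 by apply: Bs; rewrite ?lexx// s00; lra.
have Bin u : s0 <= u <= T -> u <= s0 + J -> B u = u - s0.
  move=> /andP[su uT] uJ; rewrite -[LHS]subr0 -Bs0; apply: (occ_in occ) => //.
  move=> v /andP[sv vu]; apply/hS; apply/andP; split; lra.
have [tJ|tJ] := leP t (s0 + J).
  by rewrite Bin ?st// max_r; lra.
rewrite max_l; last lra.
have -> : B t = B (s0 + J).
  apply: (occ_out occ); [lra|lra|lra|move=> u /andP[u1 u2]].
  have uT : 0 <= u <= T by apply/andP; split; lra.
  by move=> /(hS u uT)/andP[]; lra.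
rewrite Bin; [lra|apply/andP; split; lra|lra].
Qed.

End site.

(** * Occupation times, sums over burns and integrals against atoms *)

Section analysis.
Context {R : realType}.
Local Notation mu := (@lebesgue_measure R).

(** The approximations evaluate f at the next grid point strictly to the right: they are step
    functions and converge by right continuity. *)
Lemma right_continuous_measurable (f : R -> R) :
  (forall t : R, 0 <= t -> f s @[s --> t^'+] --> f t) ->
  measurable_fun (`[0, +oo[%classic : set R) f.
Proof.
move=> hf.
pose h (n : nat) (u : R) := f ((Num.floor (u * n.+1%:R) + 1)%:~R / n.+1%:R).
apply: (@measurable_fun_cvg _ _ _ _ h) => [n _ B mB|t].
  have -> : h n @^-1` B = \bigcup_(k : int)
      (`[k%:~R / n.+1%:R, (k + 1)%:~R / n.+1%:R[%classic `&`
       [set _ | B (f ((k + 1)%:~R / n.+1%:R))]).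
    apply/seteqP; split => u /=.
      move=> Bu; exists (Num.floor (u * n.+1%:R)) => //=.
      by rewrite in_itv /= ler_pdivrMr// ltr_pdivlMr// floor_itv.
    move=> [k _ /= [+ Bk]]; rewrite in_itv /= ler_pdivrMr// ltr_pdivlMr// => hk.
    by rewrite /h (floor_def hk).
  apply: measurableI => //; apply: countable_bigcupT_measurable => [|k].
    exact: countableP.
  apply: measurableI => //; have [Bk|Bk] := pselect (B (f ((k + 1)%:~R / n.+1%:R))).
    by rewrite (_ : [set _ | _] = setT)//; apply/seteqP; split.
  by rewrite (_ : [set _ | _] = set0)//; apply/seteqP; split.
rewrite /= in_itv /= andbT => t0; move/cvg_at_rightP: (hf t t0); apply; split => [n|].
  by rewrite ltr_pdivlMr//; have /andP[] := floor_itv (t * n.+1%:R).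
apply: (@squeeze_cvgr _ _ _ _ (cst t) (fun n => t + harmonic n)).
- near=> n; apply/andP; split.
    by apply/ltW; rewrite ltr_pdivlMr//; have /andP[] := floor_itv (t * n.+1%:R).
  rewrite ler_pdivrMr// /harmonic mulrDl mulVf// intrD lerD2r.
  by have /andP[] := floor_itv (t * n.+1%:R).
- exact: cvg_cst.
- rewrite -[X in _ --> X]addr0; apply: cvgD; first exact: cvg_cst.
  exact: cvg_harmonic.
Unshelve. all: by end_near. Qed.

Lemma occupationP (S : set R) (T : R) : 0 <= T -> measurable (S `&` `[0, T]) ->
  (forall t, t <= T -> measurable (S `&` `[0, t])) /\
  occupation S T (fun t => fine (mu (S `&` `[0, t]))).
Proof.
move=> T0 mS.
have mSt t : t <= T -> measurable (S `&` `[0, t]).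
  move=> tT; rewrite (_ : _ `&` _ = (S `&` `[0, T]) `&` `[0, t]).
    exact: measurableI.
  rewrite -setIA; congr (_ `&` _); apply/seteqP; split => u /=; rewrite !in_itv /=.
    by move=> /andP[u0 ut]; rewrite u0 ut (le_trans ut).
  by case.
split => //.
have mSab a b : 0 <= a -> b <= T -> measurable (S `&` `]a, b]).
  move=> a0 bT; rewrite (_ : _ `&` _ = (S `&` `[0, b]) `&` `]a, b]).
    by apply: measurableI => //; exact: mSt.
  rewrite -setIA; congr (_ `&` _); apply/seteqP; split => u /=; rewrite !in_itv /=.
    by move=> /andP[au ub]; rewrite au ub (le_trans a0 (ltW au)).
  by case.
have muab a b : 0 <= a -> a <= b -> b <= T -> (mu (S `&` `]a, b]) <= (b - a)%:E)%E.
  move=> a0 ab bT; apply: le_trans (_ : mu `]a, b] <= _)%E.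
    by apply: le_measure; rewrite ?inE//; exact: mSab.
  rewrite lebesgue_measure_itv /= lte_fin; case: ifPn => // _.
  by rewrite lee_fin subr_ge0.
have fin_mu t : 0 <= t -> t <= T -> mu (S `&` `[0, t]) \is a fin_num.
  move=> t0 tT; rewrite ge0_fin_numE//; apply: le_lt_trans (_ : mu `[0%R, t] < _)%E.
    by apply: le_measure; rewrite ?inE//; exact: mSt.
  by rewrite lebesgue_measure_itv /=; case: ifPn => _; rewrite ?ltry.
have E a b : 0 <= a -> a <= b -> b <= T ->
    fine (mu (S `&` `[0, b])) = fine (mu (S `&` `[0, a])) + fine (mu (S `&` `]a, b])).
  move=> a0 ab bT; rewrite (_ : S `&` `[0, b] = (S `&` `[0, a]) `|` (S `&` `]a, b])).
    rewrite measureU; [|by apply: mSt; exact: le_trans ab bT|exact: mSab|].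
      rewrite fineD// ?fin_mu//; first exact: le_trans bT.
      rewrite ge0_fin_numE//; apply: le_lt_trans (muab _ _ a0 ab bT) _; exact: ltry.
    apply/seteqP; split => // u [[_ /=]] + [_ /=]; rewrite !in_itv /=.
    by move=> /andP[_ ua] /andP[]; rewrite ltNge ua.
  rewrite -setIUr; congr (_ `&` _); apply/seteqP; split => u /=; rewrite !in_itv /=.
    by move=> /andP[u0 ub]; have [ua|ua] := leP u a; [left|right]; rewrite ?u0 ?ub.
  case=> /andP[h1 h2]; [rewrite h1 (le_trans h2)//|rewrite h2 andbT].
  exact: le_trans (ltW h1).
have mu_fin a b : 0 <= a -> a <= b -> b <= T -> mu (S `&` `]a, b]) \is a fin_num.
  move=> a0 ab bT; rewrite ge0_fin_numE//.
  exact: le_lt_trans (muab _ _ a0 ab bT) (ltry _).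
split.
- rewrite [X in fine X](_ : _ = 0%E)//; apply/eqP; rewrite eq_le measure_ge0 andbT.
  apply: le_trans (_ : mu `[0%R, 0%R] <= _)%E.
    by apply: le_measure; rewrite ?inE//; exact: mSt.
  by rewrite lebesgue_measure_itv /= ltxx.
- by move=> a b a0 ab bT; rewrite (E a b)// lerDl fine_ge0.
- move=> a b a0 ab bT; rewrite (E a b)// addrC addKr -lee_fin fineK ?mu_fin//.
  exact: muab.
- move=> a b a0 ab bT h; rewrite (E a b)// addrC addKr; apply/eqP.
  rewrite -eqe fineK ?mu_fin// eq_le muab//=.
  apply: le_trans (_ : mu `]a, b[ <= _)%E.
    by rewrite lebesgue_measure_itv /= lte_fin; case: ltP => // ba; rewrite lee_fin subr_le0.
  apply: le_measure; rewrite ?inE//; first exact: mSab.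
  by move=> u; rewrite /= !in_itv /= => /andP[au ub]; split; [apply: h; rewrite au|rewrite au ltW].
- move=> a b a0 ab bT h; rewrite (E a b)// [X in _ + fine X](_ : _ = 0%E) ?addr0//.
  apply/eqP; rewrite eq_le measure_ge0 andbT.
  apply: le_trans (_ : mu [set b] <= _)%E; last by rewrite lebesgue_measure_set1.
  apply: le_measure; rewrite ?inE//; first exact: mSab.
  move=> u [Su]; rewrite /= in_itv /= le_eqVlt => /andP[au /orP[/eqP //|ub]].
  by exfalso; apply: (h u) => //; rewrite au.
Qed.

Lemma integral_occupation (S : set R) (t : R) : 0 <= t ->
  measurable (S `&` `[0, t]) ->
  (\int[mu]_(s in `[0%R, t]) (\1_S s)%:E)%E = (fine (mu (S `&` `[0, t])))%:E.
Proof.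
move=> t0 mS; rewrite (_ : (\int[mu]_(s in `[0%R, t]) (\1_S s)%:E)%E =
    (\int[mu]_(s in `[0%R, t]) (\1_(S `&` `[0, t]) s)%:E)%E).
  rewrite integral_indic// -setIA setIid fineK// ge0_fin_numE//.
  apply: le_lt_trans (_ : mu `[0%R, t] < _)%E.
    by apply: le_measure; rewrite ?inE.
  by rewrite lebesgue_measure_itv /=; case: ifPn => _; rewrite ?ltry.
apply: eq_integral => s /set_mem ts; congr EFin.
by rewrite !indicE in_setI (mem_set ts) andbT.
Qed.

Lemma esum_count (F : R -> nat) (U : seq R) (t : R) : uniq U -> (forall u, u \in U -> 0 <= u) ->
  (forall u, 0 <= u <= t -> (0 < F u)%N <-> u \in U) ->
  (\esum_(s in [set s | 0 <= s <= t]%R) (minn (F s) 1)%:R%:E)%E =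
  (count (fun u => (u <= t)%R) U)%:R%:E :> \bar R.
Proof.
move=> uU U0 hF.
set V := [seq u <- U | u <= t].
have VE : [set s | 0 <= s <= t] `&` [set s | (0 < F s)%N] = [set` V].
  apply/seteqP; split => u /=; rewrite mem_filter.
    by move=> [ut /hF uU']; rewrite uU'//; case/andP: ut => _ ->.
  move=> /andP[ut uU']; have ut0 : 0 <= u <= t by rewrite (U0 _ uU') ut.
  by split => //; apply/hF.
rewrite (esumID [set s | (0 < F s)%N]); last by move=> s _; rewrite lee_fin.
rewrite [X in (_ + X)%E]esum1 ?adde0; last first.
  by move=> s [_ /= /negP]; rewrite -eqn0Ngt => /eqP ->; rewrite min0n.
rewrite VE esum_fset; [|exact: finite_seq|by move=> s _; rewrite lee_fin].
rewrite -fsbig_seq ?filter_uniq// (eq_big_seq (fun=> 1%E)); last first.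
  move=> u; rewrite mem_filter => /andP[ut uU'].
  have ut0 : 0 <= u <= t by rewrite (U0 _ uU') ut.
  by have -> : minn (F u) 1 = 1%N by apply/minn_idPr/hF.
rewrite -size_filter -/V; elim: V {VE} => [|v V ih]; first by rewrite big_nil.
by rewrite big_cons ih /= -nat1r EFinD.
Qed.

(** Finiteness of the set of burn times is thus drawn from the equation for Z alone, before anything
    is known about the fires. *)
Lemma esum_finite_times (F : R -> nat) (t c : R) :
  (\esum_(s in [set s | 0 <= s <= t]%R) (minn (F s) 1)%:R%:E)%E = c%:E ->
  exists2 U, uniq U & forall u, u \in U <-> 0 <= u <= t /\ (0 < F u)%N.
Proof.
move=> hc; set V := [set s | 0 <= s <= t] `&` [set s | (0 < F s)%N].
have [/finite_seqP[U UE]|infV] := pselect (finite_set V).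
  exists (undup U); first exact: undup_uniq.
  move=> u; rewrite mem_undup; have := congr1 (fun A => A u) UE.
  by rewrite /V /= => <-; split.
have : (\esum_(i in V) (minn (F i) 1)%:R%:E)%E = +oo%E :> \bar R.
  rewrite -(infinite_card_dirac R infV); apply: eq_esum => u Vu.
  rewrite diracE mem_set//; case: Vu => _ /= Fu.
  by rewrite (minn_idPr _).
move: hc; rewrite (esumID [set s | (0 < F s)%N]); last by move=> s _; rewrite lee_fin.
rewrite [X in (_ + X)%E]esum1 ?adde0.
  by rewrite -/V => ->.
by move=> s [_ /= /negP]; rewrite -eqn0Ngt => /eqP ->; rewrite min0n.
Qed.

Lemma left_lim_eq (f g : R -> R) (a v : R) : 0 <= a -> a < v ->
  (forall s, a < s < v -> f s = g s) -> {for v, continuous g} ->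
  cvg (f s @[s --> v^'-]) /\ left_lim f v = g v.
Proof.
move=> a0 av fg cg.
have H : f s @[s --> v^'-] --> g v.
  apply: cvg_trans (cvg_at_left_filter cg); apply: near_eq_cvg; near=> s.
  by apply/esym/fg/andP; split; near: s; [exact: nbhs_left_gt|exact: nbhs_left_lt].
split; first by apply/cvg_ex; exists (g v).
by rewrite /left_lim (le_lt_trans a0 av); exact/cvg_lim.
Unshelve. all: by end_near. Qed.

End analysis.

Section concentration.
Import HBNNSimple.

(* No measurability of f is needed: the integral of a nonnegative function is a
   supremum over the simple functions below it. *)
Lemma integral_concentrated {d} {T : measurableType d} {R : realType}
    (m : {measure set T -> \bar R}) (D E : set T) (f : T -> \bar R) :
  measurable D -> measurable E -> E `<=` D -> m (D `\` E) = 0%E ->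
  (forall x, D x -> 0 <= f x)%E ->
  (\int[m]_(x in D) f x = \int[m]_(x in E) f x)%E.
Proof.
move=> mD mE ED DE0 f0; rewrite !ge0_integralE//; last by move=> x /ED/f0.
apply/eqP; rewrite eq_le; apply/andP; split.
  apply/ge_ereal_sup => _ [h /= hf <-].
  pose h' := proj_nnsfun h mE.
  apply/ereal_sup_ubound; exists h' => /=.
    move=> x; have := hf x; rewrite /h' /= mindicE !patchE.
    case: ifPn => xD; case: ifPn => xE.
    + by rewrite mulr1.
    + by rewrite mulr0.
    + by move: xD; rewrite (mem_set (ED _ (set_mem xE))).
    + by rewrite mulr0.
  rewrite -!integralT_nnsfun [RHS](@ge0_negligible_integral _ _ _ m setT (D `\` E))//.
  - rewrite [RHS]integral_mkcond; apply: eq_integral => x _.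
    rewrite /h' /= mindicE patchE; case: ifPn => [/set_mem[_ xDE]|xDE].
      case: (boolP (x \in E)) => xE; rewrite ?mulr1// mulr0.
      have xD : ~ D x by move=> Dx; apply: xDE; split => //; move/mem_set => h1; rewrite h1 in xE.
      by have := hf x; rewrite patchE memNset// lee_fin => hx; congr EFin; apply/eqP; rewrite eq_le hx andbT; exact: fun_ge0.
    move: xDE; rewrite notin_setE => xDE.
    have [|/contrapT [Dx Ex]] := pselect (~ (D `\` E) x); first by move=> h1; exfalso; apply: xDE.
    by rewrite memNset// mulr0.
  - exact: measurableD.
  - by apply/measurable_EFinP; exact: measurable_funP.
  - by move=> x _; rewrite lee_fin.
apply/ge_ereal_sup => _ [h /= hf <-]; apply/ereal_sup_ubound; exists h => //= x.
apply: le_trans (hf x) _; rewrite !patchE; case: ifPn => xE.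
  by rewrite (mem_set (ED _ (set_mem xE))).
by case: ifPn => // /set_mem; exact: f0.
Qed.

End concentration.

Lemma integral_atom {d} {T : measurableType d} {R : realType}
    (m : {measure set T -> \bar R}) (D : set T) (q : T) (f : T -> R) :
  measurable D -> measurable [set q] -> D q -> m [set q] = 1%E ->
  m (D `\ q) = 0%E -> (forall x, D x -> 0 <= f x) ->
  (\int[m]_(x in D) (f x)%:E = (f q)%:E)%E.
Proof.
move=> mD mq Dq mq1 Dq0 f0; rewrite (@integral_concentrated _ _ _ _ _ [set q])//.
  rewrite (eq_integral (cst (f q)%:E)); last by move=> x /set_mem ->.
  by rewrite integral_cst// mq1 mule1.
by move=> x ->.
Qed.

Lemma integral_null {d} {T : measurableType d} {R : realType}
    (m : {measure set T -> \bar R}) (D : set T) (f : T -> R) :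
  measurable D -> m D = 0%E -> (forall x, D x -> 0 <= f x) ->
  (\int[m]_(x in D) (f x)%:E = 0)%E.
Proof.
move=> mD mD0 f0; rewrite (@integral_concentrated _ _ _ _ _ set0)//.
  by rewrite integral_set0.
by rewrite setD0.
Qed.

Lemma map_uniq_inj (T1 T2 : eqType) (f : T1 -> T2) (s : seq T1) :
  uniq (map f s) -> {in s &, injective f}.
Proof.
elim: s => //= a s ih /andP[fa us] x y; rewrite !inE.
move=> /orP[/eqP ->|xs] /orP[/eqP ->|ys] // e.
- by move: fa; rewrite e map_f.
- by move: fa; rewrite -e map_f.
- exact: ih.
Qed.

(** * Explicit solutions at a site and their left limits *)

Section site_lemmas.
Context {R : realType}.
Local Notation mu := (@lebesgue_measure R).
Implicit Types (U : seq R) (s : seq (R * R)).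

Lemma Hval_none U s x t : (forall k, k \in s -> k.1 != x) -> Hval U s x t = 0.
Proof.
rewrite /Hval; elim: s => //= k s ih h.
rewrite (negbTE (h k _)) ?mem_head//=; apply: ih => k' k's.
by apply: h; rewrite inE k's orbT.
Qed.

Lemma Hval_mem U s t k : uniq (map fst s) -> k \in s ->
  Hval U s k.1 t = if k.2 <= t then Num.max 0 (jump U k.2 - (t - k.2)) else 0.
Proof.
rewrite /Hval; elim: s => //= k' s ih /andP[k's us]; rewrite inE => /orP[/eqP ->|ks].
  rewrite eqxx /=; case: ifPn => // _; apply: (@Hval_none U s) => k'' k''s.
  by apply: contraNneq k's => <-; exact: map_f.
have -> : (k'.1 == k.1) = false.
  by apply: contraNF k's => /eqP ->; exact: map_f.
exact: ih.
Qed.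

Lemma jump_ge0 U t : 0 <= t -> 0 <= jump U t.
Proof.
move=> t0; rewrite /jump; case: ifPn => // _; rewrite le_min ler01 subr_ge0.
by case: (last_before_mem U t) => [->//|[_ /ltW]].
Qed.

Lemma jump0 U : jump U 0 = 0.
Proof.
have h := jump_ge0 U (lexx 0); apply/eqP; rewrite eq_le h andbT /jump.
case: ifPn => // _; rewrite ge_min; apply/orP; right.
by have := last_before_ge0 U 0; lra.
Qed.

Lemma column_integral (m : {measure set (R * R) -> \bar R}) (D : set (R * R)) s x
    (t : R) (g : R * R -> R) :
  lists_marks m D s -> uniq (map fst s) -> [set x] `*` `]0, t] `<=` D ->
  (forall q, q.1 = x -> 0 < q.2 <= t -> 0 <= g q) ->
  (\int[m]_(q in [set x] `*` `]0%R, t]) (g q)%:E)%E =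
  (\sum_(k <- s | (k.1 == x) && (0 < k.2 <= t)) g k)%:E.
Proof.
move=> hs us tD g0; set C := _ `*` _ in tD *.
have mC : measurable C by exact: measurableX.
have g0' q : C q -> 0 <= g q by move=> [/= h1]; rewrite in_itv /=; exact: g0.
have mE B : measurable B -> m (B `&` C) = (\sum_(q <- s) \d_q (B `&` C))%E.
  move=> mB; rewrite -hs; last exact: measurableI.
  by congr (m _); rewrite -setIA (setIidl tD).
have [/hasP[k ks /andP[/eqP kx kt]]|/hasPn nk] :=
    boolP (has (fun k => (k.1 == x) && (0 < k.2 <= t)) s); last first.
  rewrite big_seq_cond big1 ?integral_null//; last first.
    by move=> k /andP[/nk /negbTE ->].
  rewrite -[C]setTI mE// big_seq big1// => q /nk hq; rewrite diracE.
  case: (boolP (q \in _)) => // /set_mem[_ [/= qx]]; rewrite in_itv /= => qt.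
  by move: hq; rewrite qx eqxx qt.
have inj k' : k' \in s -> k'.1 = x -> k' = k.
  move=> k's k'x; by apply: (map_uniq_inj us) => //; rewrite k'x kx.
have us' : uniq s := map_uniq us.
have Ck : C k by split; rewrite /= ?in_itv.
have mk : measurable [set k] by rewrite (_ : [set k] = [set k.1] `*` [set k.2]);
  [exact: measurableX|apply/seteqP; split => [q ->//|[q1 q2] [/= -> ->]]; case: k {Ck ks kx kt inj}].
rewrite (@integral_atom _ _ _ _ _ k)//.
- congr EFin; rewrite big_mkcond (bigD1_seq k)//= kx eqxx kt big_seq_cond big1 ?addr0// => k'.
  move=> /andP[k's k'k]; case: ifPn => // /andP[/eqP k'x _].
  by move: k'k; rewrite (inj k')// eqxx.
- rewrite -[[set k]](setIidl (_ : [set k] `<=` C)); last by move=> q ->.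
  rewrite mE// (bigD1_seq k)//= [X in (_ + X)%E]big1_seq ?adde0; last first.
    by move=> k' /andP[/eqP k'k _]; rewrite diracE memNset// => -[].
  by rewrite diracE mem_set.
- have -> : C `\ k = ~` [set k] `&` C by rewrite setDE setIC.
  rewrite (mE (~` [set k])); last exact: measurableC.
  rewrite big_seq big1// => k' k's; rewrite diracE memNset// => -[/= k'k [/= k'x _]].
  by apply: k'k; exact: inj.
Qed.

End site_lemmas.

Section site_lemmas.
Context {R : realType}.
Local Notation mu := (@lebesgue_measure R).
Implicit Types (U : seq R) (s : seq (R * R)).

Lemma continuous_ramp (c : R) : continuous (fun u : R => Num.min 1 (u - c)).
Proof.
move=> u; apply: (@continuous_min _ _ (cst 1) (fun u : R => u - c)).
  exact: cst_continuous.
by apply: cvgB; [exact: cvg_id|exact: cvg_cst].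
Qed.

Lemma continuous_decay (c j : R) : continuous (fun u : R => Num.max 0 (j - (u - c))).
Proof.
move=> u; apply: (@continuous_max _ _ (cst 0) (fun u : R => j - (u - c))).
  exact: cst_continuous.
apply: continuousB; first exact: cst_continuous.
by apply: cvgB; [exact: cvg_id|exact: cvg_cst].
Qed.

Section explicit_Z.
Variables (z : R -> R) (U : seq R) (T : R).
Hypothesis zE : forall t, 0 <= t <= T -> z t = Zval U t.

Lemma left_lim_Z v : 0 < v <= T ->
  cvg (z s @[s --> v^'-]) /\ left_lim z v = Num.min 1 (v - last_before U v).
Proof.
move=> /andP[v0 vT]; apply: (@left_lim_eq _ z (fun u => Num.min 1 (u - last_before U v)) _ _
  (last_before_ge0 U v) (last_before_lt U v0)).
  move=> s /andP[ls sv]; rewrite zE; last by have := last_before_ge0 U v; lra.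
  by rewrite /Zval (last_time_before (ltW ls) sv).
exact: continuous_ramp.
Qed.

Lemma left_lim_Z_eq1 v : (forall u, u \in U -> 0 <= u) -> 0 <= v <= T -> left_lim z v = 1 <->
  1 <= v /\ forall u, u \in U -> ~~ (v - 1 < u < v).
Proof.
move=> U0 /andP[]; rewrite le_eqVlt => /orP[/eqP <- T0|v0 vT].
  rewrite /left_lim ltxx zE ?lexx// /Zval; split; last by rewrite ler10 => -[].
  by have l0 := last_time_ge0 U 0; case: (leP 1 (0 - _)) => h e; exfalso; lra.
rewrite (left_lim_Z _).2 ?v0//; have l0 := last_before_ge0 U v.
split => [|[v1 h]].
  case: (leP 1 (v - _)) => [h _|h e]; last by exfalso; lra.
  split; first lra.
  move=> u uU; apply/negP => /andP[h1 h2]; have := last_before_max uU h2; lra.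
rewrite min_l//; case: (last_before_mem U v) => [->|[lU lv]]; first lra.
by have := h _ lU; rewrite lv andbT -leNgt; lra.
Qed.

Lemma left_lim_jump v : 0 < v <= T ->
  left_lim z v * \1_[set u | left_lim z u < 1] v = jump U v.
Proof.
move=> vT; rewrite indicE /jump; have [_ e] := left_lim_Z vT.
case: ifPn => h; first by rewrite mem_set ?mulr1//= e.
by rewrite memNset ?mulr0// /= e => h'; rewrite h' in h.
Qed.

End explicit_Z.

Lemma sub_level_measurable (f : R -> R) (T c : R) :
  (forall t : R, 0 <= t -> f s @[s --> t^'+] --> f t) ->
  measurable ([set u | f u < c] `&` `[0, T]).
Proof.
move=> /right_continuous_measurable mf.
have := mf _ _ (measurable_itv `]-oo, c[) => /(_ (measurable_itv _)) h.
rewrite (_ : _ `&` _ = (`[0, +oo[ `&` f @^-1` `]-oo, c[) `&` `[0, T]).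
  exact: measurableI.
apply/seteqP; split => u /=; rewrite !in_itv /= ?andbT; last by case=> -[].
by move=> [h1 /andP[h2 h3]]; rewrite h2 h3.
Qed.

Lemma super_level_measurable (f : R -> R) (T c : R) :
  (forall t : R, 0 <= t -> f s @[s --> t^'+] --> f t) ->
  measurable ([set u | c < f u] `&` `[0, T]).
Proof.
move=> /right_continuous_measurable mf.
have := mf _ _ (measurable_itv `]c, +oo[) => /(_ (measurable_itv _)) h.
rewrite (_ : _ `&` _ = (`[0, +oo[ `&` f @^-1` `]c, +oo[) `&` `[0, T]).
  exact: measurableI.
apply/seteqP; split => u /=; rewrite !in_itv /= ?andbT; last by case=> -[].
by move=> [h1 /andP[h2 h3]]; rewrite h2 h3 andbT.
Qed.

Section site_equations.
Variables (m : {measure set (R * R) -> \bar R}) (D : set (R * R)) (s : seq (R * R)).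
Hypotheses (hs : lists_marks m D s) (us : uniq (map fst s)).
Hypothesis s_ge0 : forall k, k \in s -> 0 <= k.2.
Variables (x T : R).
Hypothesis T0 : 0 <= T.
Hypothesis TD : [set x] `*` `[0, T] `<=` D.

Definition site_Z (z : R -> R) (f : R -> nat) := forall t : R, 0 <= t <= T ->
  ((z t)%:E =
     \int[lebesgue_measure]_(s in `[0%R, t]) (\1_[set u | (z u < 1)%R] s)%:E
     - \esum_(s in [set s | 0 <= s <= t]%R) (minn (f s) 1)%:R%:E)%E.

Definition site_H (z h : R -> R) := forall t : R, 0 <= t <= T ->
  ((h t)%:E =
     \int[m]_(q in [set x] `*` `]0%R, t])
       (left_lim z q.2 * \1_[set u | left_lim z u < 1] q.2)%R%:E
     - \int[lebesgue_measure]_(s in `[0%R, t])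
         (\1_[set u | (0 < h u)%R] s)%:E)%E.

Lemma jump_integral (z : R -> R) U t :
  (forall t, 0 <= t <= T -> z t = Zval U t) -> 0 <= t <= T ->
  (\int[m]_(q in [set x] `*` `]0%R, t])
       (left_lim z q.2 * \1_[set u | left_lim z u < 1] q.2)%R%:E)%E =
  (\sum_(k <- s | (k.1 == x) && (k.2 <= t)) jump U k.2)%:E.
Proof.
move=> zE /andP[t0 tT].
rewrite (column_integral (D := D) hs us).
- congr EFin; rewrite big_seq_cond [RHS]big_seq_cond.
  rewrite [RHS](bigID (fun k => 0 < k.2)) /= [X in _ + X]big1 ?addr0; last first.
    move=> k /andP[/and3P[ks _ _]]; rewrite -leNgt => k0.
    by rewrite (_ : k.2 = 0) ?jump0//; apply/eqP; rewrite eq_le k0 s_ge0.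
  apply: eq_big => [k|k /and3P[_ _ /andP[k0 kt]]].
    by rewrite -!andbA; do 2 congr (_ && _); rewrite andbC.
  by apply: (left_lim_jump zE); rewrite k0 (le_trans kt).
- move=> [q1 q2] [/= ->]; rewrite in_itv /= => /andP[/ltW q0 qt].
  by apply: TD; split => //=; rewrite in_itv /= q0 (le_trans qt).
- move=> q _ /andP[q0 qt]; rewrite (left_lim_jump zE); last by rewrite q0 (le_trans qt).
  by apply: jump_ge0; exact: ltW.
Qed.

Lemma column_sum (f : R -> R) t : (forall k, k \in s -> k.1 != x) ->
  \sum_(k <- s | (k.1 == x) && (k.2 <= t)) f k.2 = 0.
Proof.
by move=> h; rewrite big_seq_cond big1// => k /andP[/h/negbTE ->].
Qed.

Lemma column_sum1 (f : R -> R) t k : k \in s -> k.1 = x ->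
  \sum_(k <- s | (k.1 == x) && (k.2 <= t)) f k.2 = if k.2 <= t then f k.2 else 0.
Proof.
move=> ks kx; rewrite big_mkcond (bigD1_seq k) ?(map_uniq us)//= kx eqxx /=.
rewrite big1_seq ?addr0// => k' /andP[k'k k's]; case: ifPn => // /andP[/eqP k'x _].
by move: k'k; rewrite (map_uniq_inj us k's ks) ?eqxx// k'x kx.
Qed.

Lemma column_case : (forall k, k \in s -> k.1 != x) \/ (exists2 k, k \in s & k.1 = x).
Proof.
have [/hasP[k ks /eqP kx]|/hasPn h] := boolP (has (fun k => k.1 == x) s).
  by right; exists k.
by left.
Qed.

Lemma site_unique (z h : R -> R) (f : R -> nat) :
  (forall t : R, 0 <= t -> z s @[s --> t^'+] --> z t) ->
  (forall t : R, 0 <= t -> h s @[s --> t^'+] --> h t) ->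
  (forall t : R, 0 <= t -> 0 <= z t /\ 0 <= h t) ->
  site_Z z f -> site_H z h ->
  exists U, [/\ uniq U, forall u, u \in U <-> 0 <= u <= T /\ (0 < f u)%N,
    forall t, 0 <= t <= T -> z t = Zval U t &
    forall t, 0 <= t <= T -> h t = Hval U s x t].
Proof.
move=> cz ch pos hz hh.
have [mz occz] := occupationP T0 (sub_level_measurable T 1 cz).
have [mh occh] := occupationP T0 (super_level_measurable T 0 ch).
have zE' t : 0 <= t <= T -> (\esum_(s in [set s | 0 <= s <= t]%R) (minn (f s) 1)%:R%:E)%E =
    (fine (mu ([set u | z u < 1] `&` `[0, t])) - z t)%:E.
  move=> tT; have := hz t tT; move: tT => /andP[t0 tT].
  rewrite integral_occupation//; last exact: mz.
  (* The left-hand side is a real number, so the sum cannot be infinite. *)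
  case: (esum _ _) => [c|//|//].
  by rewrite -EFinB => -[->]; congr EFin; lra.
have T00 : 0 <= T <= T by rewrite T0 lexx.
have [U uU UE] := esum_finite_times (zE' T T00).
have U0 u : u \in U -> 0 <= u by move=> /UE[/andP[]].
have zE : forall t, 0 <= t <= T -> z t = Zval U t.
  apply: (@Z_unique _ _ _ _ z U occz uU U0) => [u _//|t /andP[/pos[]]//|t tT].
  have := zE' t tT; rewrite (@esum_count _ _ U)//; first by move=> [->]; lra.
  move=> u /andP[u0 ut]; move: tT => /andP[_ tT]; split => [fu|/UE[]//].
  by apply/UE; rewrite u0 (le_trans ut).
exists U; split => //.
pose J := fun t => \sum_(k <- s | (k.1 == x) && (k.2 <= t)) jump U k.2.
have hE t : 0 <= t <= T -> h t = J t - fine (mu ([set u | 0 < h u] `&` `[0, t])).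
  move=> tT; have := hh t tT; rewrite (jump_integral zE)//.
  move: tT => /andP[t0 tT]; rewrite integral_occupation//; last exact: mh.
  by rewrite -EFinB => -[->].
move=> t tT; have [nk|[k ks kx]] := column_case.
  rewrite Hval_none//.
  (* A fictitious mark at time 0 with jump 0 represents a column without marks. *)
  have := @H_unique _ _ _ _ h 0 0 occh (lexx _) (fun _ _ => iff_refl _) _ (lexx _) _ t tT.
  rewrite max_l; last by case/andP: tT; lra.
  rewrite if_same; apply=> [u /andP[/pos[]]//|u uT].
  by rewrite hE// /J column_sum// if_same.
rewrite -kx Hval_mem//.
apply: (@H_unique _ _ _ _ h k.2 (jump U k.2) occh _ (fun _ _ => iff_refl _)) => //.
- by apply: jump_ge0; exact: s_ge0.
- by move=> u /andP[/pos[]].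
- exact: s_ge0.
- by move=> u uT; rewrite hE// /J (column_sum1 _ _ ks kx).
Qed.

End site_equations.
End site_lemmas.

Section site_lemmas.
Context {R : realType}.
Local Notation mu := (@lebesgue_measure R).
Implicit Types (U : seq R).

Lemma right_lim_eq (f g : R -> R) (t b : R) : t < b ->
  (forall s, t < s < b -> f s = g s) -> f t = g t -> {for t, continuous g} ->
  f s @[s --> t^'+] --> f t.
Proof.
move=> tb fg -> cg.
apply: cvg_trans (cvg_at_right_filter cg); apply: near_eq_cvg; near=> s.
by apply/esym/fg/andP; split; near: s; [exact: nbhs_right_gt|exact: nbhs_right_lt].
Unshelve. all: by end_near. Qed.

Section explicit_ZH.
Variables (s : seq (R * R)) (x T : R) (U : seq R) (z h : R -> R).
Hypotheses (us : uniq (map fst s)) (s_ge0 : forall k, k \in s -> 0 <= k.2).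
Hypotheses (zE : forall t, 0 <= t <= T -> z t = Zval U t).
Hypotheses (hE : forall t, 0 <= t <= T -> h t = Hval U s x t).

Lemma right_cont_Z t : 0 <= t < T -> z s @[s --> t^'+] --> z t.
Proof.
move=> /andP[t0 tT]; set b := \big[Num.min/T]_(u <- U | t < u) u.
have tb : t < b by rewrite /b; elim/big_ind: _ => // a c ta tc; rewrite lt_min ta.
have bT : b <= T by exact: bigmin_le_id.
apply: (@right_lim_eq _ (fun u => Num.min 1 (u - last_time U t)) _ b) => //.
- move=> u /andP[tu ub]; rewrite zE; last by apply/andP; split; lra.
  rewrite /Zval (@last_time_eq _ _ (last_time U t))//.
  + exact: last_time_ge0.
  + by case: (last_time_mem U t) => [|[]]; [left|right].
  + by have := last_time_le U t0; lra.
  + move=> v vU lv; apply: lt_le_trans ub _.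
    apply: (@bigmin_inf_seq _ _ _ _ _ v) => //.
    by rewrite ltNge; apply/negP => /(last_time_max vU); rewrite leNgt lv.
- by rewrite zE// t0 ltW.
- exact: continuous_ramp.
Qed.

Lemma right_cont_H t : 0 <= t < T -> h s @[s --> t^'+] --> h t.
Proof.
move=> /andP[t0 tT]; have [nk|[k ks kx]] := @column_case _ s x.
  apply: (@right_lim_eq _ (cst 0) _ T) => //.
  + by move=> u /andP[tu ub]; rewrite hE ?Hval_none//; apply/andP; split; lra.
  + by rewrite hE ?Hval_none// t0 ltW.
  + exact: cst_continuous.
have [kt|kt] := leP k.2 t.
  apply: (@right_lim_eq _ (fun u => Num.max 0 (jump U k.2 - (u - k.2))) _ T) => //.
  + move=> u /andP[tu ub]; rewrite hE; last by apply/andP; split; lra.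
    by rewrite -kx Hval_mem// (le_trans kt (ltW tu)).
  + by rewrite hE ?t0 ?(ltW tT)// -kx Hval_mem// kt.
  + exact: continuous_decay.
have kb : t < Num.min T k.2 by rewrite lt_min tT.
apply: (@right_lim_eq _ (cst 0) _ (Num.min T k.2)) => //.
+ move=> u /andP[tu]; rewrite lt_min => /andP[uT uk].
  rewrite hE; last by apply/andP; split; lra.
  by rewrite -kx Hval_mem// leNgt uk.
+ by rewrite hE ?t0 ?(ltW tT)// -kx Hval_mem// leNgt kt.
+ exact: cst_continuous.
Qed.

Lemma left_lim_H_none v : (forall k, k \in s -> k.1 != x) -> 0 < v <= T ->
  cvg (h s @[s --> v^'-]) /\ left_lim h v = 0.
Proof.
move=> nk /andP[v0 vT]; apply: (@left_lim_eq _ h (cst 0) 0 v) => //.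
  move=> u /andP[u0 uv]; rewrite hE ?Hval_none//; apply/andP; split; lra.
exact: cst_continuous.
Qed.

Lemma left_lim_H v k : k \in s -> k.1 = x -> 0 < v <= T ->
  cvg (h s @[s --> v^'-]) /\
  left_lim h v = if k.2 < v then Num.max 0 (jump U k.2 - (v - k.2)) else 0.
Proof.
move=> ks kx /andP[v0 vT]; case: ltP => kv.
  apply: (@left_lim_eq _ h (fun u => Num.max 0 (jump U k.2 - (u - k.2))) k.2 v) => //.
  - exact: s_ge0.
  - move=> u /andP[ku uv]; have := s_ge0 ks => k0.
    by rewrite hE; [rewrite -kx Hval_mem// ltW|apply/andP; split; lra].
  - exact: continuous_decay.
apply: (@left_lim_eq _ h (cst 0) 0 v) => //; last exact: cst_continuous.
move=> u /andP[u0 uv]; rewrite hE; last by apply/andP; split; lra.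
by rewrite -kx Hval_mem// leNgt (lt_le_trans uv kv).
Qed.

Lemma left_cvg v : 0 < v <= T -> cvg (z s @[s --> v^'-]) /\ cvg (h s @[s --> v^'-]).
Proof.
move=> vT; split; first exact: (left_lim_Z zE vT).1.
have [nk|[k ks kx]] := @column_case _ s x.
  exact: (left_lim_H_none nk vT).1.
exact: (left_lim_H ks kx vT).1.
Qed.

(** Spacing identifies the burn in the extinction test: a burn in (t - 1, t), or time 0 in that
    interval, is the last one before the mark at t, so t - u is the jump of H. *)
Lemma site_passable v : spaced U -> 0 <= v <= T ->
  (left_lim z v = 1 /\ left_lim h v = 0) <->
  passable [set t | (x, t) \in s] [set` U] v.
Proof.
move=> [U1 sU] /andP[v0 vT].
have U0 u : u \in U -> 0 <= u by move=> /U1; lra.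
have Z1 := left_lim_Z_eq1 zE U0 (_ : 0 <= v <= T).
have {}Z1 := Z1 _; rewrite v0 vT in Z1; have {}Z1 := Z1 isT.
suff HH : 1 <= v -> (left_lim h v = 0) <->
    forall t u, (x, t) \in s -> u = 0 \/ u \in U ->
        ~~ [&& t - 1 < u, u < t, t < v & v < t + t - u].
  split=> [[/Z1[v1 hU] /(HH v1) h0]|[v1 hU hA]]; first by split.
  by split; [exact/Z1|exact/HH].
move=> v1; have v0T : 0 < v <= T by rewrite vT andbT; lra.
have [nk|[k ks kx]] := @column_case _ s x.
  rewrite (left_lim_H_none nk v0T).2; split => // _ t u ts.
  by have := nk _ ts; rewrite eqxx.
have kE t : (x, t) \in s -> t = k.2.
  by move=> ts; rewrite (map_uniq_inj us ks ts) ?kx.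
rewrite (left_lim_H ks kx v0T).2.
set l := last_before U k.2; have l0 : 0 <= l by exact: last_before_ge0.
have k0 := s_ge0 ks.
case: ltP => kv; last first.
  split => // _ t u /kE ->{t} _; apply/negP => /and4P[_ _]; lra.
have maxE (a : R) : Num.max 0 a = 0 <-> a <= 0.
  by case: leP => // ?; split => //; lra.
rewrite maxE subr_le0; split.
  move=> hj t u /kE ->{t} uU; apply/negP => /and4P[h1 h2 h3 h4].
  have ul : u = l.
    have ul : u <= l.
      by case: uU => [->|uU]; [exact: l0|exact: last_before_max].
    apply/eqP; rewrite eq_le ul /= leNgt; apply/negP => ul'.
    have := last_before_mem U k.2; rewrite -/l => -[e|[lU lk]]; first by case: uU => [|/U1]; lra.
    case: uU => [u0|uU]; first by have := U1 _ lU; lra.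
    by have := sU _ _ uU lU ul'; lra.
  move: hj; rewrite /jump -/l min_r; last lra.
  by rewrite (_ : k.2 - l < 1); lra.
move=> hA; rewrite leNgt; apply/negP => hj.
have : jump U k.2 = k.2 - l /\ k.2 - l < 1.
  move: hj; rewrite /jump -/l; case: ifPn; last lra.
  by case: (leP 1 (k.2 - l)) => //; lra.
move=> [jE jl].
have ku : (x, k.2) \in s by rewrite -kx -surjective_pairing.
have lU : l = 0 \/ l \in U by case: (last_before_mem U k.2) => [|[]]; [left|right].
have /negP := hA _ _ ku lU; apply; apply/and4P; split => //; lra.
Qed.

End explicit_ZH.

Lemma spaced_left_lim (z : R -> R) U T :
  (forall t, 0 <= t <= T -> z t = Zval U t) ->
  (forall u, u \in U -> 0 <= u <= T) ->
  (forall u, u \in U -> left_lim z u = 1) -> spaced U.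
Proof.
move=> zE UT h.
have H u : u \in U -> 1 <= u /\ forall v, v \in U -> ~~ (u - 1 < v < u).
  move=> uU; apply/(left_lim_Z_eq1 zE); [|exact: UT|exact: h].
  by move=> v /UT/andP[].
split => [u /H[]//|u v uU vU uv]; have [_ /(_ _ uU)] := H _ vU.
by rewrite uv andbT -leNgt lerBrDr.
Qed.

Section site_exists.
Variables (m : {measure set (R * R) -> \bar R}) (D : set (R * R)) (s : seq (R * R)).
Hypotheses (hs : lists_marks m D s) (us : uniq (map fst s)).
Hypothesis s_ge0 : forall k, k \in s -> 0 <= k.2.
Variables (x T : R) (U : seq R) (z h : R -> R) (f : R -> nat).
Hypothesis T0 : 0 <= T.
Hypothesis TD : [set x] `*` `[0, T] `<=` D.
Hypotheses (zE : forall t, 0 <= t <= T -> z t = Zval U t).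
Hypotheses (hE : forall t, 0 <= t <= T -> h t = Hval U s x t).
Hypotheses (cz : forall t : R, 0 <= t -> z s @[s --> t^'+] --> z t).
Hypotheses (ch : forall t : R, 0 <= t -> h s @[s --> t^'+] --> h t).
Hypotheses (uU : uniq U) (sU : spaced U).
Hypothesis fU : forall u, 0 <= u <= T -> (0 < f u)%N <-> u \in U.

Lemma site_Z_exists : site_Z T z f.
Proof.
have [mz occz] := occupationP T0 (sub_level_measurable T 1 cz).
move=> t tT; rewrite (zE tT) (@Z_equation _ _ _ _ U occz uU sU) => [|u uT|//].
  rewrite EFinB integral_occupation; [|by case/andP: tT|by case/andP: tT => _; exact: mz].
  congr (_ - _)%E; apply/esym/esum_count => // [u /sU.1|u /andP[u0 ut]]; first lra.
  by apply: fU; rewrite u0; case/andP: tT => _; exact: le_trans.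
by rewrite /= zE.
Qed.

Lemma site_H_exists : site_H m x T z h.
Proof.
have [mh occh] := occupationP T0 (super_level_measurable T 0 ch).
move=> t tT; rewrite (jump_integral hs us s_ge0 TD zE tT).
rewrite integral_occupation; [|by case/andP: tT|by case/andP: tT => _; exact: mh].
rewrite -EFinB; congr EFin; rewrite (hE tT).
have [nk|[k ks kx]] := @column_case _ s x.
  have tT' := andP tT; rewrite Hval_none// column_sum// (occ_out occh (a := 0) (b := t)).
  - by rewrite (occ0 occh) subr0.
  - by [].
  - exact: tT'.1.
  - exact: tT'.2.
  - move=> u /andP[u0 ut] /=; rewrite hE ?Hval_none ?ltxx//.
    by apply/andP; split; lra.
rewrite (column_sum1 us _ _ ks kx) -kx Hval_mem//.
apply: (@H_equation _ _ _ _ k.2 (jump U k.2) occh) => //.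
- by apply: jump_ge0; exact: s_ge0.
- exact: s_ge0.
- move=> u uT /=; rewrite hE// -kx Hval_mem//; case: (leP k.2 u) => ku /=.
    by rewrite lt_max ltxx /=; split; lra.
  by rewrite ltxx.
Qed.

End site_exists.
End site_lemmas.

(** * Atoms of a measure and lists of them *)

Section marks.
Context {R : realType}.
Implicit Types (m : {measure set (R * R) -> \bar R}) (D : set (R * R)).
Implicit Types (s : seq (R * R)) (q : R * R).

Lemma measurable_mark q : measurable [set q].
Proof.
rewrite (_ : [set q] = [set q.1] `*` [set q.2]); first exact: measurableX.
by apply/seteqP; split => [q' ->//|[a b] [/= -> ->]]; case: q.
Qed.

Lemma lists_marks_count m D s q : measurable D -> lists_marks m D s ->
  m ([set q] `&` D) = (count_mem q s)%:R%:E.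
Proof.
move=> mD hs; rewrite hs; last exact: measurable_mark.
elim: s {hs} => [|k s ih]; first by rewrite big_nil.
rewrite big_cons ih /= natrD EFinD; congr (_ + _)%E.
rewrite diracE; have -> // : (k \in [set q]) = (k == q).
by apply/idP/eqP => [/set_mem|->]; [|exact/mem_set].
Qed.

Lemma lists_marks_perm m D s s' : measurable D -> lists_marks m D s ->
  lists_marks m D s' -> perm_eq s s'.
Proof.
move=> mD hs hs'; apply/allP => q _; apply/eqP/eqP.
rewrite -(eqr_nat R) -(inj_eq (@EFin_inj R)); apply/eqP.
by rewrite -(lists_marks_count _ mD hs) -(lists_marks_count _ mD hs').
Qed.

Lemma lists_marks_sub m D D' s : measurable D' -> D' `<=` D ->
  lists_marks m D s -> lists_marks m D' [seq q <- s | q \in D'].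
Proof.
move=> mD' DD' hs B mB; rewrite -{1}(setIidl DD') setIA hs; last exact: measurableI.
rewrite big_filter [RHS]big_mkcond; apply: eq_bigr => q _; rewrite !diracE in_setI.
by case: (q \in D'); rewrite ?andbT ?andbF.
Qed.

(** Atoms are detected by singletons; the sign of the time is imposed because [m] is a measure on
    the whole plane. *)
Definition marks m : set (R * R) := [set q | 0 <= q.2 /\ m [set q] != 0%E].

Lemma mem_marks m D s q : measurable D -> (forall q, D q -> 0 <= q.2) ->
  lists_marks m D s -> q \in s <-> D q /\ marks m q.
Proof.
move=> mD D0 hs; have hc := lists_marks_count q mD hs.
split => [qs|[Dq [_]]].
  have c0 : m ([set q] `&` D) != 0%E.
    by rewrite hc eqe pnatr_eq0 -lt0n -has_count has_pred1.
  have Dq : D q.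
    apply: contrapT => nD; move: c0; rewrite (_ : _ `&` _ = set0) ?measure0 ?eqxx//.
    by apply/seteqP; split => // q' [/= ->].
  split => //; split; first exact: D0.
  by move: c0; rewrite (setIidl _)// => q' ->.
rewrite (_ : [set q] = [set q] `&` D); last by apply/esym/setIidl => q' ->.
by rewrite hc eqe pnatr_eq0 -lt0n -has_count has_pred1.
Qed.

Definition box (a b T : R) : set (R * R) := `[a, b] `*` `[0, T].

Lemma measurable_box a b T : measurable (box a b T).
Proof. exact: measurableX. Qed.

Lemma boxP a b T q : box a b T q <-> [/\ a <= q.1, q.1 <= b, 0 <= q.2 & q.2 <= T].
Proof.
rewrite /box; split => [[/=]|[h1 h2 h3 h4]]; last by split; rewrite /= in_itv /= ?h1 ?h3.
by rewrite !in_itv /= => /andP[? ?] /andP[? ?].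
Qed.

Lemma box_ge0 a b T q : box a b T q -> 0 <= q.2.
Proof. by case/boxP. Qed.

End marks.

(** * Dependence on the marks of a bounded window *)

Section agreement.
Context {R : realType} (p : R).
Hypothesis p_ge0 : 0 <= p.
Implicit Types (Q : set (R * R)) (b : R * R -> R -> Prop) (s : seq (R * R)).

(* In the box [-n, n] x (-oo, T], the fires depend only on the marks in
   [a, c] x [0, T]. *)
Definition localizes Q (n T a c : R) := exists K : set (R * R),
  [/\ past_closed K, forall x t, `|x| <= n -> t <= T -> K (x, t),
      forall q, K q -> 0 <= q.2 -> box a c T q &
      forall Q' b, (forall q, Q' q -> 0 <= q.2) ->
        (forall q, box a c T q -> Q' q <-> Q q) ->
        fire_system p Q' b -> fire_closed p K b].

Lemma localizes_agree Q n T a c Q1 Q2 b1 b2 s :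
  localizes Q n T a c -> (forall q, box a c T q -> Q q -> q \in s) ->
  (forall q, Q1 q -> 0 <= q.2) -> (forall q, Q2 q -> 0 <= q.2) ->
  (forall q, box a c T q -> Q1 q <-> Q q) -> (forall q, box a c T q -> Q2 q <-> Q q) ->
  fire_system p Q1 b1 -> fire_system p Q2 b2 ->
  forall q x, `|x| <= n -> arrival p q x <= T -> b1 q x <-> b2 q x.
Proof.
move=> [K [pK Kn Kbox Kclosed]] hs Q10 Q20 h1 h2 sb1 sb2 q x xn qT.
(* The query site 0 is arbitrary: any critical list for [s] provides a rank. *)
have rk := rankP p_ge0 (critical_pointsP p s 0).
apply: (fire_system_agree rk pK (Kclosed _ _ Q10 h1 sb1) (Kclosed _ _ Q20 h2 sb2) _ _ sb1 sb2).
- move=> k Kk; split => Qk.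
    by apply/h2; [apply: Kbox => //; exact: Q10|apply/h1 => //; apply: Kbox => //; exact: Q10].
  by apply/h1; [apply: Kbox => //; exact: Q20|apply/h2 => //; apply: Kbox => //; exact: Q20].
- move=> k Kk Qk; have kb : box a c T k by apply: Kbox => //; exact: Q10.
  by apply: hs => //; apply/h1.
- exact: Kn.
Qed.

Lemma Zval_eq (U U' : seq R) t : (forall u, u <= t -> (u \in U) = (u \in U')) ->
  Zval U t = Zval U' t.
Proof.
move=> h; rewrite /Zval; congr (Num.min 1 (t - _)).
have le V V' : (forall u, u <= t -> u \in V -> u \in V') -> last_time V t <= last_time V' t.
  move=> h'; case: (last_time_mem V t) => [->|[lV lt]]; first exact: last_time_ge0.
  by apply: last_time_max => //; exact: h'.
by apply/eqP; rewrite eq_le !le// => u ut; rewrite h.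
Qed.

Lemma last_before_eq (U U' : seq R) t : (forall u, u <= t -> (u \in U) = (u \in U')) ->
  last_before U t = last_before U' t.
Proof.
move=> h.
have le V V' : (forall u, u <= t -> u \in V -> u \in V') -> last_before V t <= last_before V' t.
  move=> h'; case: (last_before_mem V t) => [->|[lV lt]]; first exact: last_before_ge0.
  by apply: last_before_max => //; apply: h' => //; exact: ltW.
by apply/eqP; rewrite eq_le !le// => u ut; rewrite h.
Qed.

Lemma Hval_eq (U U' : seq R) s s' x t :
  (forall u, u <= t -> (u \in U) = (u \in U')) ->
  uniq (map fst s) -> uniq (map fst s') ->
  (forall k, k.1 = x -> k.2 <= t -> (k \in s) = (k \in s')) ->
  Hval U s x t = Hval U' s' x t.
Proof.
move=> hU us us' hs.
have half (V : seq R) (r r' : seq (R * R)) : uniq (map fst r) -> uniq (map fst r') ->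
    (forall k, k.1 = x -> k.2 <= t -> (k \in r) = (k \in r')) ->
    (exists2 k, k \in r & k.1 = x /\ k.2 <= t) -> Hval V r x t = Hval V r' x t.
  move=> ur ur' h [k kr [kx kt]]; rewrite -kx !Hval_mem// -?h//.
have out (V : seq R) r : uniq (map fst r) ->
    ~ (exists2 k, k \in r & k.1 = x /\ k.2 <= t) -> Hval V r x t = 0.
  move=> ur nk; have [n|[k ks kx]] := @column_case _ r x; first by rewrite Hval_none.
  by rewrite -kx Hval_mem//; case: ifPn => // kt; exfalso; apply: nk; exists k.
have -> : Hval U s x t = Hval U' s x t.
  rewrite /Hval; elim: {us hs}s => //= k s ->; case: ifPn => // /andP[_ kt].
  rewrite /jump (@last_before_eq U U')// => u uk; apply: hU; exact: le_trans kt.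
have [e|e] := pselect (exists2 k, k \in s & k.1 = x /\ k.2 <= t); first exact: half.
rewrite !out//; apply: contra_not e => -[k ks' [kx kt]].
by exists k => //; rewrite hs.
Qed.

(** The state of a site is a function of its marks and of the fires that reach it up to t. Fires are
    compared rather than their times, since F counts simultaneous arrivals. *)
Lemma forest_fire_eq s s' b b' x t :
  uniq (map fst s) -> uniq (map fst s') ->
  fire_system p [set` s] b -> fire_system p [set` s'] b' ->
  (forall k, k.1 = x -> k.2 <= t -> (k \in s) = (k \in s')) ->
  (forall q, arrival p q x <= t -> b q x <-> b' q x) ->
  forest_fire p t x s = forest_fire p t x s'.
Proof.
move=> us us' sb sb' hs hb.
have memU (r : seq (R * R)) c : fire_system p [set` r] c ->
    forall u, u \in fire_times p r x <-> exists2 q, c q x & arrival p q x = u.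
  move=> sc u; rewrite (fire_timesE p_ge0 x sc); split.
    by move=> /mapP[q]; rewrite mem_filter => /andP[/asboolP cq qr] ->; exists q.
  move=> [q cq <-]; apply/mapP; exists q => //; rewrite mem_filter.
  by apply/andP; split; [exact/asboolP|exact: (fire_mem sc cq)].
have hU u : u <= t -> (u \in fire_times p s x) = (u \in fire_times p s' x).
  move=> ut; apply/idP/idP => [/(memU _ _ sb)|/(memU _ _ sb')] [q bq e].
    by apply/(memU _ _ sb'); exists q => //; apply/hb; rewrite ?e.
  by apply/(memU _ _ sb); exists q => //; apply/hb; rewrite ?e.
rewrite /forest_fire (Zval_eq hU) (Hval_eq hU us us' hs); congr (_, (_, _%:R)).
rewrite (fire_timesE p_ge0 x sb) (fire_timesE p_ge0 x sb').
rewrite !count_map !count_filter -!size_filter; apply/perm_size/uniq_perm.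
- exact/filter_uniq/(map_uniq us).
- exact/filter_uniq/(map_uniq us').
- move=> q; rewrite !mem_filter /=.
  apply/idP/idP => /andP[/andP[/eqP qt /asboolP bq] qs].
    have b'q : b' q x by apply/hb; rewrite ?qt.
    by rewrite qt eqxx (fire_mem sb' b'q) andbT; exact/asboolP.
  have b'q : b q x by apply/hb; rewrite ?qt.
  by rewrite qt eqxx (fire_mem sb b'q) andbT; exact/asboolP.
Qed.

End agreement.

(** * Backward cones and forward fronts *)

Section cones.
Context {R : realType} (p : R).
Implicit Types (q : R * R) (Z H : R -> R -> R).

Lemma arrival_part q x r : between q.1 x r ->
  arrival p q x - p * `|r - x| = arrival p q r.
Proof.
rewrite betweenE /arrival => /orP[]/andP[h1 h2].
  rewrite (ger0_norm (_ : 0 <= x - q.1)); last lra.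
  rewrite (ger0_norm (_ : 0 <= r - q.1)); last lra.
  by rewrite (ler0_norm (_ : r - x <= 0)); lra.
rewrite (ler0_norm (_ : x - q.1 <= 0)); last lra.
rewrite (ler0_norm (_ : r - q.1 <= 0)); last lra.
by rewrite (ger0_norm (_ : 0 <= r - x)); lra.
Qed.

Lemma betweenC (a b r : R) : between a b r = between b a r.
Proof. by rewrite !betweenE orbC. Qed.

(** Read forwards, the backward cone of [(x, t)] is the front of [q]. This is the bridge from the
    integral equations to [clear]. *)
Lemma burningP Z H q x : burning p Z H x (arrival p q x) q <->
  forall r, between q.1 x r -> left_lim (Z ^~ r) (arrival p q r) = 1 /\
                               left_lim (H ^~ r) (arrival p q r) = 0.
Proof.
split=> h.
  move=> r hr; apply: (h (r, arrival p q r)); exists r; last by rewrite arrival_part.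
  by change (is_true (between x q.1 r)); rewrite betweenC.
move=> _ [r hr ->] /=; have hr' : between q.1 x r.
  by rewrite betweenC; exact: hr.
by rewrite arrival_part//; exact: h.
Qed.

Lemma coneP x t q : cone p x t q <-> 0 <= q.2 /\ arrival p q x = t.
Proof.
rewrite /arrival; split=> [[z zt ->]/=|[q0 qt]].
  rewrite subr_ge0; split => //; rewrite opprD addNKr normrN subrK//.
exists (q.1 - x).
  by rewrite distrC -qt; lra.
rewrite addrC subrK distrC -qt addrK; exact: surjective_pairing.
Qed.

Lemma measurable_cone x t : measurable (cone p x t).
Proof.
have mA : measurable_fun [set: R * R] (fun q : R * R => arrival p q x).
  apply: measurable_funD; first exact: measurable_snd.
  apply: measurable_funM; first exact: measurable_cst.
  apply: (measurableT_comp (@normr_measurable R setT)).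
  by apply: measurable_funB; [exact: measurable_cst|exact: measurable_fst].
rewrite (_ : cone p x t = ([set: R * R] `&` snd @^-1` `[0, +oo[%classic) `&`
    ([set: R * R] `&` (fun q : R * R => arrival p q x) @^-1` [set t])).
  apply: measurableI; first by apply: measurable_snd.
  by apply: mA.
rewrite !setTI; apply/seteqP; split => q.
  by move=> /coneP[q0 qt]; split => //=; rewrite in_itv /= q0.
by move=> [/=]; rewrite in_itv /= andbT => q0 qt; apply/coneP.
Qed.

(* Whether a fire reaches (x, t) depends on the abscissa of its mark only, in a
   star-shaped way. *)
Lemma measurable_burning Z H x t : measurable (burning p Z H x t).
Proof.
pose A := [set y : R | burning p Z H x t (y, 0)].
rewrite (_ : burning _ _ _ _ _ = A `*` setT); last first.
  by apply/seteqP; split => q /=; [split|case].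
apply: measurableX => //; apply: is_interval_measurable.
have star y y' : A y -> between x y y' -> A y'.
  move=> Ay hy r [z hz ->] /=; apply: (Ay (z, _)); exists z => //.
  by apply: (between_trans (b := y) hy); exact: hz.
move=> a c Aa Ac z /andP[az zc]; have [zx|xz] := leP z x.
  by apply: (star a) => //; rewrite betweenE; apply/orP; right; rewrite az zx.
by apply: (star c) => //; rewrite betweenE; apply/orP; left; rewrite zc ltW.
Qed.

Lemma box_cover q : 0 <= q.2 -> exists N : nat, box (- N%:R) N%:R N%:R q.
Proof.
move=> q0; have h := archi_boundP (normr_ge0 q.1); have h' := archi_boundP q0.
set i := Num.Def.archi_bound _ in h; set j := Num.Def.archi_bound _ in h'.
have hij : i%:R <= (i + j)%:R :> R by rewrite ler_nat leq_addr.
have hji : j%:R <= (i + j)%:R :> R by rewrite ler_nat leq_addl.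
move: h; rewrite ltr_norml => /andP[h1 h2].
exists (i + j)%N; apply/boxP; split => //; lra.
Qed.

(** For p = 0 the cone is a whole line, contained in no box. The part of the event outside the box
    of rank [M] is covered by countably many boxes, and the second hypothesis makes it null in
    each. *)
Lemma fire_count (m : {measure set (R * R) -> \bar R}) (sM : nat -> seq (R * R)) Z H x t M :
  (forall N : nat, lists_marks m (box (- N%:R) N%:R N%:R) (sM N)) ->
  (forall N q, q \in sM N -> cone p x t q -> burning p Z H x t q -> q \in sM M) ->
  (\int[m]_(q in cone p x t) (\1_(burning p Z H x t) q)%:E)%E =
  (count (fun q => (arrival p q x == t) && `[<burning p Z H x t q>]) (sM M))%:R%:E.
Proof.
move=> hs hM; rewrite integral_indic; [|exact: measurable_cone|exact: measurable_burning].
set B := _ `&` _; pose D : set (R * R) := box (- M%:R) M%:R M%:R.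
have mB : measurable B.
  by apply: measurableI; [exact: measurable_burning|exact: measurable_cone].
have mD : measurable D by exact: measurable_box.
rewrite (@measureDI _ _ _ _ B D)// [X in (X + _)%E](_ : _ = 0%E); last first.
  apply/negligibleP; first exact: measurableD.
  have /negligibleS : m.-negligible (\bigcup_(N : nat) ((B `\` D) `&` box (- N%:R) N%:R N%:R)).
    apply: negligible_bigcup => N; apply/negligibleP.
      by apply: measurableI; [exact: measurableD|exact: measurable_box].
    apply: (etrans (hs N (B `\` D) (measurableD mB mD))).
    rewrite big_seq big1// => q qs; rewrite diracE memNset// => -[[hb hc] nD].
    have := hM _ _ qs hc hb => /(mem_marks _ mD (@box_ge0 _ _ _ _) (hs M))[]//.
  apply; move=> q [[hb hc] nD]; have [q0 _] := (coneP x t q).1 hc.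
  by have [N hN] := box_cover q0; exists N.
rewrite add0e; apply: (etrans (hs M B mB)); rewrite (eq_big_seq (fun q => ((arrival p q x == t) &&
    `[<burning p Z H x t q>])%:R%:E)); last first.
  move=> q /(mem_marks _ mD (@box_ge0 _ _ _ _) (hs M))[/box_ge0 q0 _].
  rewrite diracE.
  suff -> : (q \in B) = (arrival p q x == t) && `[<burning p Z H x t q>] by [].
  apply/idP/andP => [/set_mem[hb hc]|[/eqP qt /asboolP hb]].
    by have [_ qt] := (coneP x t q).1 hc; split; [exact/eqP|exact/asboolP].
  by apply/mem_set; split => //; exact/coneP.
elim: (sM M) => [|k l ih]; first by rewrite big_nil.
by rewrite big_cons ih /= natrD EFinD.
Qed.

End cones.

(** * Existence and uniqueness for a fixed configuration of marks *)

Section good_configuration.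
Context {R : realType} (p : R).
Hypothesis p_ge0 : 0 <= p.
Variable m : {measure set (R * R) -> \bar R}.

Local Notation nbox N := (box (- N%:R) N%:R N%:R : set (R * R)).

Variable sM : nat -> seq (R * R).
Hypothesis sM_lists : forall N, lists_marks m (nbox N) (sM N).
Hypothesis sM_uniq : forall N, uniq (map fst (sM N)).

Lemma mem_sM N q : q \in sM N <-> nbox N q /\ marks m q.
Proof. exact: mem_marks (measurable_box _ _ _) (@box_ge0 _ _ _ _) (sM_lists N). Qed.

Lemma sM_ge0 N q : q \in sM N -> 0 <= q.2.
Proof. by move=> /mem_sM[/box_ge0]. Qed.

Definition sol N : R * R -> R -> Prop :=
  projT1 (cid (fire_system_exists p_ge0 (critical_pointsP p (sM N) 0))).

Lemma solP N : fire_system p [set` sM N] (sol N).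
Proof. by rewrite /sol; case: cid. Qed.

Definition stable_from (T a c : R) (M0 : nat) :=
  [/\ - M0%:R <= a, c <= M0%:R & T <= M0%:R].

Lemma box_nbox T a c M0 : stable_from T a c M0 -> forall M q, (M0 <= M)%N ->
  box a c T q -> nbox M q.
Proof.
move=> [h1 h2 h3] M q hM /boxP[q1 q2 q3 q4].
have hM' : M0%:R <= M%:R :> R by rewrite ler_nat.
by apply/boxP; split => //; lra.
Qed.

Lemma stable_fromP (T a c : R) : exists M0, stable_from T a c M0.
Proof.
have ha := archi_boundP (normr_ge0 a); have hc := archi_boundP (normr_ge0 c).
have hT := archi_boundP (normr_ge0 T).
set i := Num.Def.archi_bound _ in ha; set j := Num.Def.archi_bound _ in hc.
set k := Num.Def.archi_bound _ in hT.
exists (i + j + k)%N; rewrite /stable_from !natrD.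
have i0 : 0 <= i%:R :> R by []. have j0 : 0 <= j%:R :> R by []. have k0 : 0 <= k%:R :> R by [].
move: ha hc hT; rewrite !ltr_norml => /andP[? ?] /andP[? ?] /andP[? ?].
by split; lra.
Qed.

Lemma sM_agrees T a c M0 M : stable_from T a c M0 -> (M0 <= M)%N ->
  forall q, box a c T q -> [set` sM M] q <-> marks m q.
Proof.
move=> st hM q bq; rewrite /= mem_sM; split => [[]//|mq]; split => //.
exact: (box_nbox st hM bq).
Qed.

Lemma sol_agree n T a c M0 M Q b : localizes p (marks m) n T a c ->
  stable_from T a c M0 -> (M0 <= M)%N ->
  (forall q, Q q -> 0 <= q.2) -> (forall q, box a c T q -> Q q <-> marks m q) ->
  fire_system p Q b ->
  forall q x, `|x| <= n -> arrival p q x <= T -> b q x <-> sol M q x.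
Proof.
move=> loc st hM Q0 hQ sb.
apply: (localizes_agree p_ge0 loc (s := sM M) _ Q0 _ hQ _ sb (@solP M)).
- by move=> q bq mq; apply/(sM_agrees st hM).
- exact: sM_ge0.
- exact: (sM_agrees st hM).
Qed.

Lemma localizes_abscissa n T a c x : localizes p (marks m) n T a c -> 0 <= T ->
  `|x| <= n -> a <= x <= c.
Proof.
move=> [K [_ Kn Kbox _]] T0 xn.
have /boxP[/= -> -> _ _] // := Kbox (x, 0) (Kn _ _ xn T0) (lexx 0).
Qed.

(** Both lists contain the marks of the window, in whatever order; [localizes] makes all other marks
    invisible at the queried points. *)
Lemma forest_fire_stable n T a c M0 M s : localizes p (marks m) n T a c ->
  stable_from T a c M0 -> (M0 <= M)%N -> 0 <= T ->
  lists_marks m (box a c T) s ->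
  forall x t, `|x| <= n -> t <= T -> forest_fire p t x s = forest_fire p t x (sM M).
Proof.
move=> loc st hM T0 hs x t xn tT.
have mB : measurable (box a c T) by exact: measurable_box.
have sub : box a c T `<=` nbox M by move=> q; exact: (box_nbox st hM).
have hs' := lists_marks_sub mB sub (sM_lists M).
have us : uniq (map fst s).
  rewrite (perm_uniq (perm_map _ (lists_marks_perm mB hs hs'))).
  by apply: subseq_uniq (sM_uniq M); exact/map_subseq/filter_subseq.
have mem_s := mem_marks _ mB (@box_ge0 _ _ _ _) hs.
have [b sb] := fire_system_exists p_ge0 (critical_pointsP p s 0).
apply: (forest_fire_eq p_ge0 us (sM_uniq M) sb (@solP M)).
  move=> k kx kt; apply/idP/idP => [/mem_s[bk mk]|/mem_sM[bk mk]].
    by apply/mem_sM; split => //; exact: sub.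
  apply/mem_s; split => //; have /boxP[_ _ k0 _] := bk.
  have /andP[ax xc] := localizes_abscissa loc T0 xn.
  by apply/boxP; split; rewrite ?kx// (le_trans kt).
move=> q qt; apply: (sol_agree loc st hM _ _ sb) => //.
- by move=> k /= /mem_s[/box_ge0].
- by move=> k bk /=; rewrite mem_s; split=> [[]|].
- exact: le_trans qt tT.
Qed.

(** Several fires may arrive at once. Duplicates are removed here because Z drops by one only,
    whereas F counts all of them. *)
Definition burn_list M x T := undup [seq u <- fire_times p (sM M) x | u <= T].

Lemma mem_burn_list M x T u : u \in burn_list M x T <->
  u <= T /\ burns p (sol M) x u.
Proof.
rewrite mem_undup mem_filter (fire_timesE p_ge0 x (@solP M)); split.
  by move=> /andP[uT /mapP[q]]; rewrite mem_filter => /andP[/asboolP bq _] e; split => //; exists q.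
move=> [uT [q bq e]]; rewrite uT /=; apply/mapP; exists q => //.
by rewrite mem_filter; apply/andP; split; [exact/asboolP|exact: (fire_mem (@solP M) bq)].
Qed.

Lemma burn_list_spaced M x T : spaced (burn_list M x T).
Proof.
split => [u /mem_burn_list[_ [q bq <-]]|u v].
  exact: le_trans (fire_time_ge1 (@solP M) bq) (arrival_ge p_ge0 _ _).
move=> /mem_burn_list[_ bu] /mem_burn_list[_ [q bq <-]] uv.
have [_ /(_ _ (betweenr _ _))[_ /(_ _ bu)]] := (@solP M q x).1 bq.
by rewrite uv andbT -leNgt lerBrDr.
Qed.

Lemma Zval_burn_list M x T t : t <= T ->
  Zval (fire_times p (sM M) x) t = Zval (burn_list M x T) t.
Proof.
by move=> tT; apply: Zval_eq => u ut; rewrite mem_undup mem_filter (le_trans ut).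
Qed.

Lemma Hval_burn_list M x T t : t <= T ->
  Hval (fire_times p (sM M) x) (sM M) x t = Hval (burn_list M x T) (sM M) x t.
Proof.
by move=> tT; apply: Hval_eq => // u ut; rewrite mem_undup mem_filter (le_trans ut).
Qed.

Hypothesis loc : forall N : nat, exists a c, localizes p (marks m) N%:R N%:R a c.

(* Above the rank stab N, all approximations agree on [-N, N] x [0, N]. *)
Definition window N := projT1 (cid (loc N)).
Definition window' N := projT1 (cid (projT2 (cid (loc N)))).
Lemma windowP N : localizes p (marks m) N%:R N%:R (window N) (window' N).
Proof. by rewrite /window /window'; case: cid => /= a h; case: cid. Qed.
Definition stab N := projT1 (cid (stable_fromP N%:R (window N) (window' N))).
Lemma stabP N : stable_from N%:R (window N) (window' N) (stab N).
Proof. by rewrite /stab; case: cid. Qed.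

Lemma le_stab N : (N <= stab N)%N.
Proof. by have [_ _] := stabP N; rewrite ler_nat. Qed.

Lemma forest_fire_stab N M x t : (stab N <= M)%N -> `|x| <= N%:R -> t <= N%:R ->
  forest_fire p t x (sM M) = forest_fire p t x (sM (stab N)).
Proof.
move=> hM xN tN.
have mB : measurable (box (window N) (window' N) N%:R : set (R * R)) by exact: measurable_box.
have sub : box (window N) (window' N) N%:R `<=` nbox (stab N).
  by move=> q; exact: (box_nbox (stabP N) (leqnn _)).
have hs := lists_marks_sub mB sub (sM_lists (stab N)).
have N0 : 0 <= N%:R :> R by [].
rewrite -(forest_fire_stable (windowP N) (stabP N) hM N0 hs)//.
by rewrite -(forest_fire_stable (windowP N) (stabP N) (leqnn _) N0 hs).
Qed.

Lemma sol_stab N M q x : (stab N <= M)%N -> `|x| <= N%:R -> arrival p q x <= N%:R ->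
  sol M q x <-> sol (stab N) q x.
Proof.
move=> hM xN qN.
apply: (sol_agree (windowP N) (stabP N) (leqnn _) _ _ (@solP M)) => //.
- exact: sM_ge0.
- exact: (sM_agrees (stabP N) hM).
Qed.

Lemma nat_above (x : R) : exists N : nat, `|x| <= N%:R.
Proof. by exists (Num.Def.archi_bound `|x|); exact/ltW/archi_boundP. Qed.

Lemma nat_above2 (x y : R) : exists N : nat, `|x| <= N%:R /\ `|y| <= N%:R.
Proof.
have [[i hi] [j hj]] := (nat_above x, nat_above y).
by exists (i + j)%N; rewrite natrD; have := ler0n R i; have := ler0n R j; split; lra.
Qed.

Lemma column_sub N x : `|x| <= N%:R -> [set x] `*` `[0, N%:R] `<=` nbox N.
Proof.
rewrite ler_norml => /andP[? ?] [q1 q2] [/= ->]; rewrite in_itv /= => /andP[? ?].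
exact/boxP.
Qed.

Section path.
Variables (Z H : R -> R -> R) (F : R -> R -> nat).

(* The fires seen by the path. *)
Definition path_fire (q : R * R) (x : R) :=
  marks m q /\ burning p Z H x (arrival p q x) q.

Definition explicit_on N M := forall x t, `|x| <= N%:R -> 0 <= t <= N%:R ->
  Z t x = Zval (burn_list M x N%:R) t /\ H t x = Hval (burn_list M x N%:R) (sM M) x t.

Lemma path_fire_sol N M q x : explicit_on N M -> (N <= M)%N ->
  `|q.1| <= N%:R -> `|x| <= N%:R -> arrival p q x <= N%:R ->
  path_fire q x <-> sol M q x.
Proof.
move=> ex NM qN xN aN.
have NM' : N%:R <= M%:R :> R by rewrite ler_nat.
have mq : marks m q -> q \in sM M.
  move=> mq; apply/mem_sM; split => //; have [q0 _] := mq.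
  have := arrival_ge p_ge0 q x.
  move: qN; rewrite ler_norml => /andP[? ?] ?; apply/boxP; split => //; lra.
have rN r : between q.1 x r -> `|r| <= N%:R.
  move: qN xN; rewrite !ler_norml betweenE => /andP[? ?] /andP[? ?].
  by move=> /orP[]/andP[? ?]; apply/andP; split; lra.
have main : 0 <= q.2 -> forall r, between q.1 x r ->
    (left_lim (Z ^~ r) (arrival p q r) = 1 /\ left_lim (H ^~ r) (arrival p q r) = 0) <->
    clear p [set` sM M] (sol M) r (arrival p q r).
  move=> q0 r hr; have hrN := rN _ hr.
  have arN : arrival p q r <= N%:R by apply: le_trans (arrival_between p_ge0 hr) aN.
  have ar0 : 0 <= arrival p q r by apply: le_trans (arrival_ge p_ge0 q r).
  rewrite (@site_passable _ (sM M) r N%:R (burn_list M r N%:R))//.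
  - split; apply: passable_sub => // u.
      by move=> bu uv; apply/mem_burn_list; split => //; exact: le_trans (ltW uv) arN.
    by move=> /= /mem_burn_list[].
  - exact: sM_ge0.
  - by move=> t tN; have [] := ex r t hrN tN.
  - by move=> t tN; have [] := ex r t hrN tN.
  - exact: burn_list_spaced.
  - by rewrite ar0.
split.
  move=> [Qq /burningP hq]; have [q0 _] := Qq; apply/solP; split; first exact: mq.
  by move=> r hr; apply/main => //; exact: hq.
move=> bq; have [qs hq] := (solP M q x).1 bq.
have [bxq Qq] := (mem_sM M q).1 qs; split => //.
by apply/burningP => r hr; apply/main => //; [exact: box_ge0 bxq|exact: hq].
Qed.

Lemma path_count x t M : (forall q, arrival p q x = t -> path_fire q x <-> sol M q x) ->
  (\int[m]_(q in cone p x t) (\1_(burning p Z H x t) q)%:E)%E =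
  (count_mem t (fire_times p (sM M) x))%:R%:E.
Proof.
move=> h; rewrite (fire_count (m := m) (sM := sM) (M := M))//; last first.
  move=> N q /mem_sM[_ mq] /coneP[_ qt] bq.
  have bq' : path_fire q x by split => //; rewrite qt.
  exact: fire_mem (@solP M) _ _ ((h q qt).1 bq').
rewrite (fire_timesE p_ge0 x (@solP M)) count_map count_filter; congr (_%:R%:E).
apply: eq_in_count => q qs /=; case: eqVneq => //= qt; apply/asboolP/asboolP => [bq|].
  by apply/h => //; split; [have /mem_sM[] := qs|rewrite qt].
by move=> /h[]//; rewrite qt.
Qed.

Section existence.
Hypothesis limit : forall x t, 0 <= t -> exists M0, forall M, (M0 <= M)%N ->
  forest_fire p t x (sM M) = (Z t x, (H t x, (F t x)%:R)).

Lemma limit_stab N M x t : (stab N <= M)%N -> `|x| <= N%:R -> 0 <= t <= N%:R ->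
  forest_fire p t x (sM M) = (Z t x, (H t x, (F t x)%:R)).
Proof.
move=> hM xN /andP[t0 tN]; have [M0 hM0] := limit x t0.
rewrite -(hM0 (maxn M0 (stab N)) (leq_maxl _ _)).
by rewrite (forest_fire_stab hM)// [RHS](forest_fire_stab (leq_maxr _ _)).
Qed.

Lemma limit_explicit N M : (stab N <= M)%N -> explicit_on N M.
Proof.
move=> hM x t xN tN; have := limit_stab hM xN tN; case/andP: tN => _ tN.
by move=> [<- <- _]; split; [exact: Zval_burn_list|exact: Hval_burn_list].
Qed.

Lemma limit_count N M x t : (stab N <= M)%N -> `|x| <= N%:R -> 0 <= t <= N%:R ->
  F t x = count_mem t (fire_times p (sM M) x).
Proof.
move=> hM xN tN; have := limit_stab hM xN tN.
by move=> [_ _ /eqP]; rewrite eqr_nat => /eqP <-.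
Qed.

Lemma path_exists : LFFP_path p m Z H F.
Proof.
have E N x t : `|x| <= N%:R -> 0 <= t <= N%:R ->
    Z t x = Zval (burn_list (stab N) x N%:R) t /\
    H t x = Hval (burn_list (stab N) x N%:R) (sM (stab N)) x t.
  exact: limit_explicit.
have EZ N x (xN : `|x| <= N%:R) t (tN : 0 <= t <= N%:R) := (E N x t xN tN).1.
have EH N x (xN : `|x| <= N%:R) t (tN : 0 <= t <= N%:R) := (E N x t xN tN).2.
have lt_above (x t : R) : 0 <= t -> exists N : nat, `|x| <= N%:R /\ 0 <= t < N%:R.
  move=> t0; have [N [xN tN]] := nat_above2 x (t + 1); exists N; split => //.
  by move: tN; rewrite ler_norml => /andP[? ?]; apply/andP; split; lra.
have cZ x t : 0 <= t -> Z u x @[u --> t^'+] --> Z t x.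
  move=> t0; have [N [xN tN]] := lt_above x t t0.
  exact: (right_cont_Z (EZ N x xN) tN).
have cH x t : 0 <= t -> H u x @[u --> t^'+] --> H t x.
  move=> t0; have [N [xN tN]] := lt_above x t t0.
  exact: (right_cont_H (sM_uniq _) (EH N x xN) tN).
have le_above (x t : R) : 0 <= t -> exists N : nat, `|x| <= N%:R /\ 0 <= t <= N%:R.
  by move=> /(lt_above x)[N [xN /andP[t0 /ltW tN]]]; exists N; rewrite t0.
have N0 N : 0 <= N%:R :> R by [].
have Nbox N x : `|x| <= N%:R -> [set x] `*` `[0, N%:R] `<=` nbox (stab N).
  move=> xN q /(column_sub xN)/boxP[? ? ? ?].
  have : N%:R <= (stab N)%:R :> R by rewrite ler_nat le_stab.
  by move=> ?; apply/boxP; split => //; lra.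
have FU N x : `|x| <= N%:R -> forall u, 0 <= u <= N%:R ->
    (0 < F u x)%N <-> u \in burn_list (stab N) x N%:R.
  move=> xN u uN; rewrite (limit_count (leqnn _) xN uN) -has_count has_pred1.
  by rewrite mem_undup mem_filter; case/andP: uN => _ ->.
have cutT (N : nat) (t : R) : 0 <= t <= N%:R -> t <= N%:R by case/andP.
split.
- move=> x; split; split => [t t0|t t0]; [exact: cZ| |exact: cH|].
    have [N [xN /andP[_ tN]]] := lt_above x t (ltW t0).
    have tN' : 0 < t <= N%:R by rewrite t0 ltW.
    by have [] := left_cvg (sM_uniq _) (@sM_ge0 _) (EZ N x xN) (EH N x xN) tN'.
  have [N [xN /andP[_ tN]]] := lt_above x t (ltW t0).
  have tN' : 0 < t <= N%:R by rewrite t0 ltW.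
  by have [] := left_cvg (sM_uniq _) (@sM_ge0 _) (EZ N x xN) (EH N x xN) tN'.
- move=> t x /(le_above x)[N [xN tN]].
  exact: (site_Z_exists (N0 N) (EZ N x xN) (cZ x) (undup_uniq _)
    (burn_list_spaced _ _ _) (FU N x xN) tN).
- move=> t x /(le_above x)[N [xN tN]].
  exact: (site_H_exists (sM_lists _) (sM_uniq _) (@sM_ge0 _) (N0 N) (Nbox N x xN)
    (EZ N x xN) (EH N x xN) (cH x) tN).
- move=> t x /(le_above x)[N [xN tN]].
  rewrite (limit_count (leqnn _) xN tN) (path_count (M := stab N))// => q qt.
  (* For p = 0 the mark [q] may be arbitrarily far away, so the region of rank [N1] depends on it;
     [sol_stab] then returns to the fixed list [sM (stab N)]. *)
  have [N' [qN xN']] := nat_above2 q.1 x.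
  pose N1 := maxn N N'; pose M1 := maxn (stab N) (stab N1).
  have NN1 : N%:R <= N1%:R :> R by rewrite ler_nat leq_maxl.
  have N'N1 : N'%:R <= N1%:R :> R by rewrite ler_nat leq_maxr.
  rewrite (@path_fire_sol N1 M1).
  + apply: sol_stab => //; first exact: leq_maxl.
    by rewrite qt; exact: cutT tN.
  + by apply: limit_explicit; exact: leq_maxr.
  + exact: leq_trans (le_stab _) (leq_maxr _ _).
  + exact: le_trans N'N1.
  + exact: le_trans NN1.
  + by rewrite qt; exact: le_trans (cutT _ _ tN) NN1.
Qed.

End existence.

Section uniqueness.
Hypothesis ZH_ge0 : nonneg_path Z H.
Hypothesis ZHF : LFFP_path p m Z H F.

Lemma path_fireP x t : 0 <= t ->
  (0 < F t x)%N <-> exists2 q, path_fire q x & arrival p q x = t.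
Proof.
move=> t0; have FE := LFFP_F ZHF x t0; split.
  apply: contraPP => nq; apply/negP; rewrite -eqn0Ngt.
  (* When no fire reaches [(x, t)], no list contributes anything, so any rank will do for [M]. *)
  move: FE; rewrite (fire_count (m := m) (sM := sM) (M := 0%N))//.
    move=> [/eqP]; rewrite eqr_nat => /eqP ->; rewrite -leqn0 leqNgt -has_count.
    apply/hasPn => q /mem_sM[_ mq]; apply/negP => /andP[/eqP qt /asboolP bq].
    by apply: nq; exists q => //; split => //; rewrite qt.
  move=> N q /mem_sM[_ mq] /coneP[_ qt] bq.
  by exfalso; apply: nq; exists q => //; split => //; rewrite qt.
move=> [q [[q0 mq] bq] qt]; rewrite lt0n; apply/eqP => F0.
move: FE; rewrite F0 integral_indic; [|exact: measurable_cone|exact: measurable_burning].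
move=> /esym B0; move/eqP: mq; apply; apply/eqP; rewrite eq_le measure_ge0 andbT.
rewrite -[X in (_ <= X)%E]B0; apply: le_measure; rewrite ?inE.
- exact: measurable_mark.
- by apply: measurableI; [exact: measurable_burning|exact: measurable_cone].
- by move=> _ ->; split; [rewrite -qt|exact/coneP].
Qed.

(** A fire enters a site only when the left limit of Z is 1 there, which is what makes the burn
    times spaced. *)
Lemma path_site N x : `|x| <= N%:R -> exists U, [/\ uniq U, spaced U,
  forall u, u \in U <-> u <= N%:R /\ burns p path_fire x u,
  forall t, 0 <= t <= N%:R -> Z t x = Zval U t &
  forall t, 0 <= t <= N%:R -> H t x = Hval U (sM N) x t].
Proof.
move=> xN; have [cZ cH] := LFFP_cadlag ZHF x.
have N0 : 0 <= N%:R :> R by [].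
have [U [uU UE zE hE]] := @site_unique R m (nbox N) (sM N) (sM_lists N) (sM_uniq N)
  (@sM_ge0 N) x N%:R N0 (column_sub xN) (Z ^~ x) (H ^~ x) (F ^~ x) cZ.1 cH.1
  (fun t t0 => ZH_ge0 x t0)
  (fun t (tN : 0 <= t <= N%:R) => LFFP_Z ZHF x (andP tN).1)
  (fun t (tN : 0 <= t <= N%:R) => LFFP_H ZHF x (andP tN).1).
have UE' u : u \in U <-> u <= N%:R /\ burns p path_fire x u.
  rewrite UE; split => [[/andP[u0 uN] /(path_fireP x u0)]|[uN bu]]; first by split.
  have [q [[q0 _] _] qu] := bu.
  have u0 : 0 <= u by rewrite -qu; exact: le_trans q0 (arrival_ge p_ge0 _ _).
  by rewrite u0 uN; split => //; apply/path_fireP.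
exists U; split => //; apply: (spaced_left_lim zE).
  by move=> u /UE[].
move=> u /UE'[_ [q [_ /burningP bq] <-]].
by have [] := bq x (betweenr _ _).
Qed.

(** Any solution of the integral equations yields a solution of the fixed-point equation driven by
    all the marks; this reduces uniqueness of the process to that of fires. *)
Lemma path_fire_system : fire_system p (marks m) path_fire.
Proof.
move=> q x; rewrite /path_fire burningP.
suff main r : marks m q -> (left_lim (Z ^~ r) (arrival p q r) = 1 /\
    left_lim (H ^~ r) (arrival p q r) = 0) <->
    clear p (marks m) path_fire r (arrival p q r).
  by split => -[mq h]; split => // r hr; apply/main => //; exact: h.
move=> [q0 _].
have ar0 : 0 <= arrival p q r by apply: le_trans (arrival_ge p_ge0 q r).
have [N [rN arN]] := nat_above2 r (arrival p q r).
have [U [uU sU UE zE hE]] := path_site rN.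
have aN : 0 <= arrival p q r <= N%:R by rewrite ar0 -(ger0_norm ar0).
rewrite (site_passable (sM_uniq N) (@sM_ge0 N) zE hE sU aN).
split; apply: passable_sub => u.
- move=> mu uv; apply/mem_sM; split => //; have [/= u0 _] := mu.
  move: rN; rewrite ler_norml => /andP[? ?]; apply/boxP; split => //.
  by case/andP: aN => _; exact/le_trans/ltW.
- by move=> bu uv; apply/UE; split => //; case/andP: aN => _; exact/le_trans/ltW.
- by move=> /= /mem_sM[].
- by move=> /= /UE[].
Qed.

Lemma path_unique x t : 0 <= t -> exists M0, forall M, (M0 <= M)%N ->
  forest_fire p t x (sM M) = (Z t x, (H t x, (F t x)%:R)).
Proof.
move=> t0; have [N [xN]] := nat_above2 x t; rewrite (ger0_norm t0) => tN.
exists (stab N) => M hM; have NM := leq_trans (le_stab N) hM.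
have agree q : arrival p q x <= N%:R -> path_fire q x <-> sol M q x.
  move=> qN; apply: (sol_agree (windowP N) (stabP N) hM _ _ path_fire_system) => //.
  by move=> k [].
have [U [uU sU UE zE hE]] := path_site xN.
have tN' : 0 <= t <= N%:R by rewrite t0.
have UE' u : u <= t -> (u \in fire_times p (sM M) x) = (u \in U).
  move=> ut; have uN : u <= N%:R by exact: le_trans tN.
  apply/idP/idP.
    rewrite (fire_timesE p_ge0 x (@solP M)) => /mapP[q].
    rewrite mem_filter => /andP[/asboolP bq _] e; apply/UE; split => //.
    by exists q => //; apply/agree; rewrite -?e.
  move=> /UE[_ [q bq e]]; rewrite (fire_timesE p_ge0 x (@solP M)).
  have bq' : sol M q x by apply/agree; rewrite ?e.
  apply/mapP; exists q => //; rewrite mem_filter.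
  by apply/andP; split; [exact/asboolP|exact: (fire_mem (@solP M) bq')].
rewrite zE// hE// /forest_fire (Zval_eq UE').
rewrite (Hval_eq UE' (sM_uniq M) (sM_uniq N)); last first.
  move=> k kx kt; apply/idP/idP => /mem_sM[/boxP[h1 h2 h3 h4] mk]; apply/mem_sM; split => //.
    by move: xN; rewrite -kx ler_norml => /andP[? ?]; apply/boxP; split => //; exact: le_trans tN.
  have : N%:R <= M%:R :> R by rewrite ler_nat.
  by move=> ?; apply/boxP; split => //; lra.
congr (_, (_, _)); have := LFFP_F ZHF x t0; rewrite (path_count (M := M)).
  by move=> [->].
by move=> q qt; apply: agree; rewrite qt.
Qed.

End uniqueness.

End path.

End good_configuration.

(** * Barriers for p = 0 *)

Section barrier.
Context {R : realType}.
Implicit Types (Q : set (R * R)).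

(* Cycle k: the interval (a k.-1, b k.-1) burns entirely at time tau k, marks
   fall at a k and b k before its recovery and protect the interval (a k, b k)
   until a mark at f k burns it entirely at time tau k.+1. *)
Record barrier Q (T : R) (K : nat) (a f b sa sb tau : nat -> R) : Prop := {
  bar_pos : forall k, [/\ a k < f k, f k < b k, f k < a k.+1 & b k.+1 < b k];
  bar_tau0 : tau 0%N = 0;
  bar_tau : forall k, tau k + 1 <= tau k.+1;
  bar_sa : forall k, [/\ tau k < sa k, sa k < tau k + 1 & tau k.+1 < sa k + sa k - tau k];
  bar_sb : forall k, [/\ tau k < sb k, sb k < tau k + 1 & tau k.+1 < sb k + sb k - tau k];
  bar_marks : forall k, (k < K)%N -> [/\ sa k <= T -> Q (a k, sa k),
    sb k <= T -> Q (b k, sb k) & tau k.+1 <= T -> Q (f k, tau k.+1)];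
  bar_only : forall q, Q q -> a 0%N <= q.1 <= b 0%N -> q.2 <= T ->
    exists2 k, (k < K)%N & [\/ q = (a k, sa k), q = (b k, sb k) | q = (f k, tau k.+1)] }.

Section barrier_theory.
Variables (Q : set (R * R)) (T : R) (K : nat) (a f b sa sb tau : nat -> R).
Hypothesis bar : barrier Q T K a f b sa sb tau.
Variable B : R * R -> R -> Prop.
Hypothesis sB : fire_system 0 Q B.

Lemma arrival0 (q : R * R) x : arrival 0 q x = q.2.
Proof. by rewrite /arrival mul0r addr0. Qed.

Lemma bar_a_lt : {homo a : i j / (i < j)%N >-> i < j}.
Proof.
apply: homo_ltn => [x y z|k]; first exact: lt_trans.
by have [h1 _ h2 _] := bar_pos bar k; exact: lt_trans h2.
Qed.

Lemma bar_b_lt : {homo b : i j / (i < j)%N >-> j < i}.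
Proof.
apply: (homo_ltn (r := fun x y => y < x)) => [x y z h1 h2|k].
  exact: lt_trans h2 h1.
by have [] := bar_pos bar k.
Qed.

Lemma bar_a_le : {homo a : i j / (i <= j)%N >-> i <= j}.
Proof. by move=> i j; rewrite leq_eqVlt => /orP[/eqP ->//|/bar_a_lt/ltW]. Qed.

Lemma bar_b_le : {homo b : i j / (i <= j)%N >-> j <= i}.
Proof. by move=> i j; rewrite leq_eqVlt => /orP[/eqP ->//|/bar_b_lt/ltW]. Qed.

Lemma bar_tau_le : {homo tau : i j / (i <= j)%N >-> i <= j}.
Proof.
apply: homo_leq => [//|x y z|k]; first exact: le_trans.
by have := bar_tau bar k; lra.
Qed.

(** The intervals are nested and every mark of an earlier cycle lies outside [(a k, b k)]; the
    guards of cycle k lie on its ends. *)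
Lemma bar_inside k q : Q q -> a k < q.1 < b k -> q.2 <= T -> tau k.+1 <= q.2.
Proof.
move=> Qq /andP[aq qb] qT.
have [|k' k'K hq] := bar_only bar Qq _ qT.
  have := bar_a_le (leq0n k); have := bar_b_le (leq0n k).
  by move=> ? ?; apply/andP; split; lra.
have kk' : q.1 <= a k' \/ b k' <= q.1 -> (k < k')%N.
  move=> h; rewrite ltnNge; apply/negP => k'k.
  by have := bar_a_le k'k; have := bar_b_le k'k; case: h; lra.
case: hq => e; move: aq qb kk'; rewrite e /= => aq qb kk'.
- have /bar_tau_le : (k < k')%N by apply: kk'; left.
  by have [h _ _] := bar_sa bar k'; lra.
- have /bar_tau_le : (k < k')%N by apply: kk'; right.
  by have [h _ _] := bar_sb bar k'; lra.
- apply: bar_tau_le; rewrite ltnS leqNgt; apply/negP => k'k.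
  by have := bar_a_le k'k; have [] := bar_pos bar k'; lra.
Qed.

Definition reset k x := tau k = 0 \/ burns 0 B x (tau k).

Lemma reset_blocked k x v : reset k x -> tau k < v < tau k + 1 -> ~ clear 0 Q B x v.
Proof.
move=> [t0|bt] /andP[h1 h2] [v1 hB _]; first by lra.
by have /negP := hB _ bt; apply; apply/andP; split; lra.
Qed.

(** During one unit after the burn an end has not recovered; after that, the guard mark keeps it
    blocked past [tau k.+1]. *)
Lemma barrier_blocked k v : (k < K)%N -> reset k (a k) -> reset k (b k) ->
  tau k < v -> v <= tau k.+1 -> v <= T ->
  ~ clear 0 Q B (a k) v /\ ~ clear 0 Q B (b k) v.
Proof.
move=> kK ra rb tv vt vT; have [ha hb _] := bar_marks bar kK.
have [vt1|vt1] := ltP v (tau k + 1).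
  by split; apply: (@reset_blocked k) => //; rewrite tv.
split => -[_ _ hA].
  have [h1 h2 h3] := bar_sa bar k.
  have Qa : Q (a k, sa k) by apply: ha; lra.
  by have /negP := hA _ _ Qa ra; apply; apply/and4P; split; lra.
have [h1 h2 h3] := bar_sb bar k.
have Qb : Q (b k, sb k) by apply: hb; lra.
by have /negP := hA _ _ Qb rb; apply; apply/and4P; split; lra.
Qed.

(** During a cycle nothing enters through the blocked ends and nothing starts inside before
    [tau k.+1], so the fire at [f k] finds every site up to the next, smaller interval clear and
    resets it. *)
Lemma barrier_reset k x : (k < K)%N -> tau k <= T -> a k <= x <= b k -> reset k x.
Proof.
elim: k x => [x _ _ _|k ih x kK tT /andP[ax xb]]; first by left; exact: bar_tau0 bar.
have kK' := ltnW kK.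
have tk := bar_tau bar k.
have aa := bar_a_lt (ltnSn k); have bb := bar_b_lt (ltnSn k).
have ab : a k <= b k by have [] := bar_pos bar k; lra.
have ra : reset k (a k) by apply: ih => //; [lra|rewrite lexx].
have rb : reset k (b k) by apply: ih => //; [lra|rewrite lexx ab].
have blocked v := barrier_blocked (v := v) kK' ra rb.
have [_ _ /(_ tT) Qf] := bar_marks bar kK'.
have [af fb _ _] := bar_pos bar k.
right; exists (f k, tau k.+1); last by rewrite arrival0.
apply/sB; split => // r hr; rewrite arrival0 /=.
have {hr}/andP[ar rb'] : a k < r < b k.
  by move: hr; rewrite betweenE /= => /orP[]/andP[? ?]; apply/andP; split; lra.
have tau1 : 1 <= tau k.+1.
  by have := bar_tau_le (leq0n k); rewrite (bar_tau0 bar); lra.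
split=> //.
  move=> u [q Bq]; rewrite arrival0 => <-{u}; apply/negP => /andP[h1 h2].
  have [Qq hq] := (sB q r).1 Bq.
  have [na nb] : ~ clear 0 Q B (a k) q.2 /\ ~ clear 0 Q B (b k) q.2.
    by apply: blocked; lra.
  have qab : a k < q.1 < b k.
    apply/andP; split; rewrite ltNge; apply/negP => h.
      by have := hq (a k); rewrite arrival0 betweenE h (ltW ar) => /(_ isT).
    by have := hq (b k); rewrite arrival0 betweenE h (ltW rb') orbT => /(_ isT).
  have : tau k.+1 <= q.2 by apply: bar_inside; rewrite ?qab//; lra.
  lra.
move=> t u Qt _; apply/negP => /and4P[_ _ h3 _].
have : tau k.+1 <= (r, t).2 by apply: bar_inside => //=; [rewrite ar|lra].
by rewrite /=; lra.
Qed.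

Lemma barrierP k v : (k < K)%N -> tau k < v -> v <= tau k.+1 -> v <= T ->
  ~ clear 0 Q B (a k) v /\ ~ clear 0 Q B (b k) v.
Proof.
move=> kK tv vt vT.
have ab : a k <= b k by have [] := bar_pos bar k; lra.
by apply: barrier_blocked => //; apply: barrier_reset => //; rewrite ?lexx ?ab//; lra.
Qed.

Lemma last_cycle v : T <= tau K -> 0 < v <= T ->
  exists k, [/\ (k < K)%N, tau k < v & v <= tau k.+1].
Proof.
move=> TK /andP[v0 vT].
have vK : v <= tau K by lra.
elim: (K) vK => [|k ih] vk; first by rewrite (bar_tau0 bar) in vk; lra.
have [/ih[k' [k'k ? ?]]|kv] := leP v (tau k).
  by exists k'; split => //; exact: ltnW.
by exists k.
Qed.

End barrier_theory.
End barrier.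

(** * Windows that determine the fires in a box *)

Section localization.
Context {R : realType}.

Lemma localizes_pos_aux (p n T x r v : R) : 0 < p -> `|x| <= n + (T - v) / p ->
  `|r| <= n + (T - (v - p * `|r - x|)) / p.
Proof.
move=> p0 h; have -> : (T - (v - p * `|r - x|)) / p = (T - v) / p + `|r - x|.
  by rewrite opprB addrCA addrC mulrDl [p * _]mulrC mulfK ?gt_eqF.
have : `|r| <= `|x| + `|r - x| by rewrite -{1}(subrK x r) addrC ler_normD.
lra.
Qed.

End localization.

Section localization.
Context {R : realType}.
Implicit Types (Q : set (R * R)).

Lemma localizes_pos (p n T : R) Q : 0 < p -> 0 <= n -> 0 <= T ->
  localizes p Q n T (- (n + T / p)) (n + T / p).
Proof.
move=> p0 n0 T0.
exists [set q | q.2 <= T /\ `|q.1| <= n + (T - q.2) / p]; split.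
- move=> r u v [/= vT h] uv; split => /=; first exact: le_trans vT.
  apply: le_trans h _; rewrite lerD2l ler_pM2r ?invr_gt0//; lra.
- move=> x t xn tT; split => //=; apply: le_trans xn _.
  by rewrite lerDl divr_ge0 ?subr_ge0 ?(ltW p0).
- move=> q [qT h] q0; have : (T - q.2) / p <= T / p.
    by rewrite ler_pM2r ?invr_gt0//; lra.
  by move: h; rewrite ler_norml => /andP[? ?] ?; apply/boxP; split => //; lra.
- move=> Q' b _ _ sb q x bq [/= aT h] r hr; split => /=.
    by apply: le_trans aT; apply: arrival_between => //; exact: ltW.
  by rewrite -(arrival_part p hr); exact: localizes_pos_aux.
Qed.

(** A barrier sees only marks of the window, so it also stops the fires of every configuration that
    agrees there; [localizes] quantifies over all of these. *)
Lemma barrier_transfer Q Q' T K a f b sa sb tau al c :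
  al <= a 0%N -> b 0%N <= c -> (forall q, Q' q -> 0 <= q.2) ->
  (forall q, box al c T q -> Q' q <-> Q q) ->
  barrier Q T K a f b sa sb tau -> barrier Q' T K a f b sa sb tau.
Proof.
move=> la bc Q'0 h bar; have [h1 h2 h3 h4 h5 h6 h7] := bar; split => //.
- move=> k kK; have [ha hb hf] := h6 k kK.
  have a0 := bar_a_le bar (leq0n k); have b0 := bar_b_le bar (leq0n k).
  have t0 := bar_tau_le bar (leq0n k); rewrite h2 in t0.
  have [? ? _ _] := h1 k; have ? := h3 k; have [? _ _] := h4 k; have [? _ _] := h5 k.
  split => [t|t|t]; apply/h; [|exact: ha| |exact: hb| |exact: hf];
    by apply/boxP; split => //=; lra.
- move=> q Q'q qab qT; have /andP[aq qb] := qab; apply: h7 => //; apply/h => //.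
  by apply/boxP; split => //; [lra|lra|exact: Q'0].
Qed.

(** The region narrows with time, bounded by the outer ends of the cycles already begun. The ends
    move inwards, so the current cycle gives the decisive bound, and it is the end that [barrierP]
    blocks. *)
Lemma localizes_barriers Q (n T al c : R) (K : nat) a f b sa sb tau a' f' b' sa' sb' tau' :
  0 <= n -> 0 <= T ->
  barrier Q T K a f b sa sb tau -> barrier Q T K a' f' b' sa' sb' tau' ->
  T <= tau K -> T <= tau' K ->
  al <= a 0%N -> (forall k, a k < - n) -> b 0%N <= c ->
  al <= a' 0%N -> (forall k, n < b' k) -> b' 0%N <= c ->
  localizes 0 Q n T al c.
Proof.
move=> n0 T0 bar bar' TK TK' ala an bc ala' nb' b'c.
(* Cycle 0 is always active, so that the region is still bounded at time 0, where no cycle has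
   begun. *)
pose active (t : nat -> R) k v := k = 0%N \/ t k < v.
exists [set q | q.2 <= T /\ (forall k, active tau k q.2 -> a k < q.1) /\
                (forall k, active tau' k q.2 -> q.1 < b' k)]; split.
- move=> r u v [/= vT [h h']] uv; split => /=; first exact: le_trans vT.
  by split => k [->|ku]; [apply: h; left|apply: h; right; lra|apply: h'; left|apply: h'; right; lra].
- move=> x t; rewrite ler_norml => /andP[? ?] tT; split => //=.
  split => k _; first by have := an k; lra.
  by have := nb' k; lra.
- move=> q [qT [h h']] q0; have := h 0%N (or_introl erefl).
  by have := h' 0%N (or_introl erefl); move=> ? ?; apply/boxP; split => //; lra.
- move=> Q' B Q'0 hQ sB q x Bq; rewrite arrival0 => -[/= qT [h h']] r hr.
  rewrite arrival0; split => //=.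
  have barQ := barrier_transfer ala bc Q'0 hQ bar.
  have barQ' := barrier_transfer ala' b'c Q'0 hQ bar'.
  have [Qq hq] := (sB q x).1 Bq.
  have q_gt0 : 0 < q.2.
    by have [] := hq _ (betweenl _ _); rewrite arrival0; lra.
  have vT : 0 < q.2 <= T by rewrite q_gt0.
  have clr r' : between r x r' -> clear 0 Q' B r' q.2.
    move=> hr'; rewrite -(arrival0 q r'); apply: hq.
    by move: hr hr'; rewrite !betweenE => /orP[]/andP[? ?] /orP[]/andP[? ?];
      apply/orP; by [left; apply/andP; split; lra|right; apply/andP; split; lra].
  split => k hk.
    have [j [jK tj tj']] := last_cycle barQ TK vT.
    have kj : a k <= a j.
      apply: (bar_a_le bar); rewrite leqNgt; apply/negP => jk.
      case: hk => [k0|tk]; first by rewrite k0 in jk.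
      by have := bar_tau_le bar jk; lra.
    have ajx : a j < x by apply: h; right.
    apply: le_lt_trans kj _; rewrite ltNge; apply/negP => raj.
    have [] := barrierP barQ sB jK tj tj' qT; case.
    by apply: clr; rewrite betweenE raj ltW.
  have [j [jK tj tj']] := last_cycle barQ' TK' vT.
  have kj : b' j <= b' k.
    apply: (bar_b_le bar'); rewrite leqNgt; apply/negP => jk.
    case: hk => [k0|tk]; first by rewrite k0 in jk.
    by have := bar_tau_le bar' jk; lra.
  have xbj : x < b' j by apply: h'; right.
  apply: lt_le_trans kj; rewrite ltNge; apply/negP => raj.
  have [_] := barrierP barQ' sB jK tj tj' qT; case.
  by apply: clr; rewrite betweenE raj (ltW xbj) orbT.
Qed.

End localization.

(** * Patterns of marks that form barriers *)

Section cells.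
Context {R : realType}.
Implicit Types (m : {measure set (R * R) -> \bar R}).

(** An increasing sequence in [0, 1/2): any number of cycles fits in half a unit on either side,
    with positions that do not depend on that number. *)
Definition slot (i : nat) : R := i%:R / (2 * i.+1%:R).

Lemma slot_lt i : slot i < slot i.+1.
Proof.
rewrite /slot ltr_pdivrMr ?mulr_gt0// mulrAC ltr_pdivlMr ?mulr_gt0//.
by rewrite -!natrM ltr_nat; lia.
Qed.

Lemma slot_le : {homo slot : i j / (i <= j)%N >-> i <= j}.
Proof. by apply: homo_leq => [//|x y z|k]; [exact: le_trans|exact/ltW/slot_lt]. Qed.

Lemma slot_ge0 i : 0 <= slot i.
Proof. by rewrite divr_ge0. Qed.

Lemma slot_lt_half i : slot i < 1 / 2.
Proof.
rewrite /slot ltr_pdivrMr ?mulr_gt0// mulrA mulfVK// mul1r ltr_nat.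
exact: ltnSn.
Qed.

(* The three marks of cycle k are indexed by 3 k (left end), 3 k + 1 (fire) and
   3 k + 2 (right end). *)
Definition rect_lo (al : R) (l : nat) : R :=
  if (l %% 3 == 2)%N then al + 1 - slot (l %/ 3).+1
  else al + slot ((l %/ 3).*2 + l %% 3).
Definition rect_hi (al : R) (l : nat) : R :=
  if (l %% 3 == 2)%N then al + 1 - slot (l %/ 3)
  else al + slot ((l %/ 3).*2 + l %% 3).+1.
(** Fires are due at multiples of 9/8 and guards 7/8 into a cycle, with tolerance 1/16. In the worst
    case fires are 17/16 apart, a guard falls before 15/16, less than the recovery time, and it
    blocks until 27/16, while the next fire comes before 19/16. *)
Definition rect_start (l : nat) : R :=
  if (l %% 3 == 1)%N then (l %/ 3).+1%:R * (9 / 8)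
  else (l %/ 3)%:R * (9 / 8) + 7 / 8.
Definition rect al l : set (R * R) :=
  `[rect_lo al l, rect_hi al l[ `*` `[rect_start l, rect_start l + 1 / 16[.
Definition cell (al : R) (K : nat) : set (R * R) :=
  `[al, al + 1[ `*` `[0, K%:R * (9 / 8) + 1 / 16[.
Definition cell_rest al K := cell al K `\` \bigcup_(l < 3 * K) rect al l.

Definition cell_event m al K :=
  (forall l, (l < 3 * K)%N -> m (rect al l) = 1%E) /\ m (cell_rest al K) = 0%E.

Lemma rectP al l q : rect al l q <->
  [/\ rect_lo al l <= q.1, q.1 < rect_hi al l, rect_start l <= q.2 &
      q.2 < rect_start l + 1 / 16].
Proof.
rewrite /rect; split => [[/=]|[h1 h2 h3 h4]]; last by split; rewrite /= in_itv /= ?h1 ?h3.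
by rewrite !in_itv /= => /andP[? ?] /andP[? ?].
Qed.

Lemma rect_lo_lt_hi al l : rect_lo al l < rect_hi al l.
Proof.
rewrite /rect_lo /rect_hi; case: ifP => _; last by rewrite ltrD2l slot_lt.
by rewrite ltrD2l ltrN2 slot_lt.
Qed.

Lemma rect_bounds al l : al <= rect_lo al l /\ rect_hi al l <= al + 1.
Proof.
rewrite /rect_lo /rect_hi; case: ifP => _.
  by have := slot_lt_half (l %/ 3).+1; have := slot_ge0 (l %/ 3); split; lra.
set i := (_ + _)%N.
by have := slot_lt_half i.+1; have := slot_ge0 i; split; lra.
Qed.

Lemma rect_start_ge0 l : 0 <= rect_start l.
Proof.
rewrite /rect_start; case: ifP => _; last first.
  by have := ler0n R (l %/ 3); lra.
by have := ler0n R (l %/ 3).+1; lra.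
Qed.

Lemma rect_disjoint al l l' q : rect al l q -> rect al l' q -> l = l'.
Proof.
wlog ll' : l l' / (l < l')%N.
  move=> H h h'; have [ll'|ll'|//] := ltngtP l l'; first exact: H.
  by apply/esym; apply: H.
move=> /rectP[h1 h2 _ _] /rectP[h3 h4 _ _]; exfalso.
have : rect_hi al l <= rect_lo al l' \/ rect_hi al l' <= rect_lo al l; last by case; lra.
rewrite /rect_hi /rect_lo; case: ifPn => l2; case: ifPn => l'2.
- by right; rewrite lerD2l lerN2; apply: slot_le; lia.
- right; have := slot_lt_half ((l' %/ 3).*2 + l' %% 3).+1.
  by have := slot_lt_half (l %/ 3).+1; lra.
- left; have := slot_lt_half ((l %/ 3).*2 + l %% 3).+1.
  by have := slot_lt_half (l' %/ 3).+1; lra.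
- by left; rewrite lerD2l; apply: slot_le; lia.
Qed.

Lemma measurable_rect al l : measurable (rect al l).
Proof. exact: measurableX. Qed.

Lemma measurable_cell al K : measurable (cell al K).
Proof. exact: measurableX. Qed.

Lemma measurable_cell_rest al K : measurable (cell_rest al K).
Proof.
apply: measurableD; first exact: measurable_cell.
by apply: bigcup_measurable => l _; exact: measurable_rect.
Qed.

Lemma lists_marks_mass m D s B : lists_marks m D s -> measurable B -> B `<=` D ->
  m B = (count (fun q => q \in B) s)%:R%:E.
Proof.
move=> hs mB BD; rewrite -{1}(setIidl BD) hs//.
elim: s {hs} => [|q s ih]; first by rewrite big_nil.
by rewrite big_cons ih /= natrD EFinD diracE.
Qed.

Lemma lists_marks_unique m D s B : lists_marks m D s -> measurable B -> B `<=` D ->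
  m B = 1%E -> exists q, [/\ q \in s, B q & forall q', q' \in s -> B q' -> q' = q].
Proof.
move=> hs mB BD; rewrite (lists_marks_mass hs mB BD) => -[/eqP].
rewrite pnatr_eq1 -size_filter => /eqP.
case E : [seq q <- s | q \in B] => [//|q [|//]] _; exists q.
have : q \in [seq q <- s | q \in B] by rewrite E mem_head.
rewrite mem_filter => /andP[/set_mem Bq qs]; split => // q' q's Bq'.
have : q' \in [seq q <- s | q \in B] by rewrite mem_filter q's andbT; exact/mem_set.
by rewrite E inE => /eqP.
Qed.

Lemma null_no_mark m B q : measurable B -> m B = 0%E -> marks m q -> ~ B q.
Proof.
move=> mB B0 [_ /eqP mq] Bq; apply: mq; apply/eqP; rewrite eq_le measure_ge0 andbT.
rewrite -[X in (_ <= X)%E]B0; apply: le_measure; rewrite ?inE//.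
  exact: measurable_mark.
by move=> _ ->.
Qed.

Lemma cell_barrier m (sM : nat -> seq (R * R)) al K T :
  (forall N, lists_marks m (box (- N%:R) N%:R N%:R) (sM N)) ->
  cell_event m al K -> T <= K%:R * (9 / 8) ->
  exists a f b sa sb tau, [/\ barrier (marks m) T K a f b sa sb tau,
    T <= tau K, forall k, al <= a k /\ a k < al + 1 &
    forall k, al < b k /\ b k <= al + 1].
Proof.
move=> hs [h1 h0] TK.
have [N cellN] : exists N : nat, cell al K `<=` box (- N%:R) N%:R N%:R.
  have ha := archi_boundP (normr_ge0 al); set i := Num.Def.archi_bound _ in ha.
  exists (i + K.*2.+2)%N => q [/=]; rewrite !in_itv /= => /andP[? ?] /andP[? ?].
  move: ha; rewrite ltr_norml => /andP[? ?].
  have K0 := ler0n R K.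
  have -> : (i + K.*2.+2)%:R = i%:R + 2 * K%:R + 2 :> R.
    by rewrite -addn2 -muln2 !natrD natrM; lra.
  by apply/boxP; split => //; lra.
have rectcell l : (l < 3 * K)%N -> rect al l `<=` cell al K.
  move=> lK q /rectP[? ? ? ?]; have [? ?] := rect_bounds al l.
  have ? := rect_start_ge0 l; split; rewrite /= in_itv /=; first by apply/andP; split; lra.
  apply/andP; split; first lra.
  have lK' : (l %/ 3).+1%:R <= K%:R :> R by rewrite ler_nat; lia.
  rewrite -natr1 in lK'.
  suff : rect_start l <= K%:R * (9 / 8) by lra.
  by rewrite /rect_start -natr1; case: ifP => _; lra.
have mk l : exists q, rect al l q /\ ((l < 3 * K)%N -> marks m q /\
    forall q', marks m q' -> rect al l q' -> q' = q).
  have [lK|lK] := ltnP l (3 * K); last first.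
    (* A barrier consists of infinite sequences; beyond the K cycles, corners of rectangles complete
       them. *)
    exists (rect_lo al l, rect_start l); split => //.
    by apply/rectP; split => //=; [exact: rect_lo_lt_hi|lra].
  have rN : rect al l `<=` box (- N%:R) N%:R N%:R.
    exact: subset_trans (rectcell _ lK) cellN.
  have [q [qs rq uq]] := lists_marks_unique (hs N) (measurable_rect al l) rN (h1 l lK).
  exists q; split => // _.
  have mem q' := mem_marks q' (measurable_box _ _ _) (@box_ge0 _ _ _ _) (hs N).
  split; first by have /mem[] := qs.
  by move=> q' mq' rq'; apply: uq => //; apply/mem; split => //; exact: rN.
have [x hx] := choice mk.
have xr l : rect al l (x l) by have [] := hx l.
have xm l : (l < 3 * K)%N -> marks m (x l) by move=> lK; have [_ /(_ lK)[]] := hx l.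
have xu l q : (l < 3 * K)%N -> marks m q -> rect al l q -> q = x l.
  by move=> lK; have [_ /(_ lK)[_]] := hx l; apply.
(* The fire mark of cycle k' opens cycle k'.+1, whereas cycle 0 is opened by the initial state. *)
pose tau k := if k is k'.+1 then (x (3 * k' + 1)%N).2 else 0.
have d0 k : ((3 * k) %/ 3 = k)%N by lia. have m0 k : ((3 * k) %% 3 = 0)%N by lia.
have d1 k : ((3 * k + 1) %/ 3 = k)%N by lia. have m1 k : ((3 * k + 1) %% 3 = 1)%N by lia.
have d2 k : ((3 * k + 2) %/ 3 = k)%N by lia. have m2 k : ((3 * k + 2) %% 3 = 2)%N by lia.
have xa k := (rectP _ _ _).1 (xr (3 * k)%N).
have xf k := (rectP _ _ _).1 (xr (3 * k + 1)%N).
have xb k := (rectP _ _ _).1 (xr (3 * k + 2)%N).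
rewrite /rect_lo /rect_hi /rect_start in xa xf xb.
have {}xa k : [/\ al + slot k.*2 <= (x (3 * k)%N).1, (x (3 * k)%N).1 < al + slot k.*2.+1,
    k%:R * (9 / 8) + 7 / 8 <= (x (3 * k)%N).2 &
    (x (3 * k)%N).2 < k%:R * (9 / 8) + 7 / 8 + 1 / 16].
  by have := xa k; rewrite d0 m0 addn0.
have {}xf k : [/\ al + slot k.*2.+1 <= (x (3 * k + 1)%N).1,
    (x (3 * k + 1)%N).1 < al + slot k.*2.+2,
    (k%:R + 1) * (9 / 8) <= (x (3 * k + 1)%N).2 &
    (x (3 * k + 1)%N).2 < (k%:R + 1) * (9 / 8) + 1 / 16].
  by have := xf k; rewrite d1 m1 addn1 -natr1.
have {}xb k : [/\ al + 1 - slot k.+1 <= (x (3 * k + 2)%N).1,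
    (x (3 * k + 2)%N).1 < al + 1 - slot k,
    k%:R * (9 / 8) + 7 / 8 <= (x (3 * k + 2)%N).2 &
    (x (3 * k + 2)%N).2 < k%:R * (9 / 8) + 7 / 8 + 1 / 16].
  by have := xb k; rewrite d2 m2.
have tauP k : k%:R * (9 / 8) <= tau k /\ tau k < k%:R * (9 / 8) + 1 / 16.
  case: k => [|k]; first by rewrite /tau !mul0r; split; lra.
  by have [_ _ ? ?] := xf k; rewrite /tau -natr1.
exists (fun k => (x (3 * k)%N).1), (fun k => (x (3 * k + 1)%N).1),
  (fun k => (x (3 * k + 2)%N).1), (fun k => (x (3 * k)%N).2),
  (fun k => (x (3 * k + 2)%N).2), tau; split.
- split.
  + move=> k; have [a1 a2 _ _] := xa k; have [f1 f2 _ _] := xf k.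
    have [b1 b2 _ _] := xb k; have [a3 _ _ _] := xa k.+1; have [_ b3 _ _] := xb k.+1.
    have := slot_lt_half k.*2.+2; have := slot_lt_half k.+1.
    by rewrite doubleS in a3; split; lra.
  + by [].
  + by move=> k; have [_ ?] := tauP k; have [h _] := tauP k.+1; rewrite -natr1 in h; lra.
  + move=> k; have [_ _ ? ?] := xa k; have [? ?] := tauP k; have [_ h] := tauP k.+1.
    by rewrite -natr1 in h; split; lra.
  + move=> k; have [_ _ ? ?] := xb k; have [? ?] := tauP k; have [_ h] := tauP k.+1.
    by rewrite -natr1 in h; split; lra.
  + by move=> k kK; split => _; rewrite /tau -surjective_pairing; apply: xm; lia.
  + move=> q mq /andP[q1 q2] qT; have [q0 _] := mq.
    have [a1 _ _ _] := xa 0%N; have [_ b2 _ _] := xb 0%N.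
    have s0 := slot_ge0 0; have s0' := slot_ge0 0.*2.
    have cq : cell al K q.
      by split; rewrite /= in_itv /=; apply/andP; split; lra.
    have [l /= lK rq] : (\bigcup_(l < 3 * K) rect al l) q.
      apply: contrapT => nq.
      by apply: (null_no_mark (measurable_cell_rest al K) h0 mq).
    have qx := xu l q lK mq rq; exists (l %/ 3)%N; first lia.
    rewrite qx /tau -!surjective_pairing; have : (l %% 3 < 3)%N by rewrite ltn_mod.
    case E : (l %% 3)%N => [|[|[|//]]] _; [constructor 1|constructor 3|constructor 2];
      congr x; lia.
- by have [? _] := tauP K; lra.
- move=> k; have [a1 a2 _ _] := xa k; have := slot_lt_half k.*2.+1.
  by have := slot_ge0 k.*2; split; lra.
- move=> k; have [b1 b2 _ _] := xb k; have := slot_lt_half k.+1.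
  by have := slot_ge0 k; split; lra.
Qed.

(* Two well behaved cells screen the space between them from the outside. *)
Lemma localizes_cells m (sM : nat -> seq (R * R)) al be K n T :
  (forall N, lists_marks m (box (- N%:R) N%:R N%:R) (sM N)) ->
  0 <= n -> 0 <= T -> T <= K%:R * (9 / 8) ->
  cell_event m al K -> cell_event m be K -> al + 1 <= - n -> n <= be ->
  localizes 0 (marks m) n T al (be + 1).
Proof.
move=> hs n0 T0 TK ea eb aln nbe.
have [a [f [b [sa [sb [tau [bar tT ha hb]]]]]]] := cell_barrier hs ea TK.
have [a' [f' [b' [sa' [sb' [tau' [bar' tT' ha' hb']]]]]]] := cell_barrier hs eb TK.
apply: (localizes_barriers n0 T0 bar bar') => //.
- by have [] := ha 0%N.
- by move=> k; have [_ ?] := ha k; lra.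
- by have [_ ?] := hb 0%N; lra.
- by have [? _] := ha' 0%N; lra.
- by move=> k; have [? _] := hb' k; lra.
- by have [_ ?] := hb' 0%N; lra.
Qed.

End cells.

Lemma natSinv_lt (R : realType) (e : R) : 0 < e -> exists k, k.+1%:R^-1 < e :> R.
Proof.
move=> e0; exists (Num.Def.archi_bound e^-1).
rewrite invf_plt ?posrE//; apply: lt_le_trans (archi_boundP _) _.
  by rewrite invr_ge0 ltW.
by rewrite ler_nat.
Qed.

(** * A unit mass with values 0 and 1 is a point mass *)

Section atoms.
Context {R : realType}.
Implicit Types (m : {measure set (R * R) -> \bar R}).

(** The distribution function of g takes only the values 0 and 1; it jumps at the infimum x of the
    levels of full mass, where g is concentrated. *)
Lemma level_atom m (S : set (R * R)) (g : R * R -> R) (c : R) :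
  measurable S -> m S = 1%E ->
  (forall B, measurable B -> m (B `&` S) = 0%E \/ m (B `&` S) = 1%E) ->
  measurable_fun setT g -> (forall q, S q -> `|g q| <= c) ->
  exists x, m (S `\` g @^-1` [set x]) = 0%E.
Proof.
move=> mS S1 h01 mg gc.
have mpre (I : interval R) : measurable (g @^-1` [set` I]).
  by rewrite -[_ @^-1` _]setTI; exact: mg.
pose F := [set a | m (g @^-1` `]-oo, a] `&` S) = 1%E].
have FS : F c.
  rewrite /F /= (_ : _ `&` _ = S)//; apply/setIidr => q /gc; rewrite ler_norml.
  by move=> /andP[_ h] /=; rewrite in_itv.
have Flb : lbound F (- c).
  move=> a Fa; rewrite leNgt; apply/negP => ac; move: Fa.
  rewrite /F /= (_ : _ `&` _ = set0) ?measure0; first by move=> /eqP; rewrite eqe eq_sym oner_eq0.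
  apply/seteqP; split => // q [/= + /gc]; rewrite in_itv /= ler_norml => h1 /andP[h2 _].
  by have := le_trans h2 h1; rewrite leNgt ac.
have infF : has_inf F by split; [exists c|exists (- c)].
pose x := inf F; exists x.
have mlt a : a < x -> m (g @^-1` `]-oo, a] `&` S) = 0%E.
  move=> ax; case: (h01 _ (mpre `]-oo, a])) => // Fa.
  by have := ge_inf infF.2 Fa; rewrite -/x leNgt ax.
have mgt a : x < a -> m (g @^-1` `]a, +oo[ `&` S) = 0%E.
  move=> xa; have [a' Fa' a'a] : exists2 a', F a' & a' < a.
    by have [] := inf_lt infF.1 xa; move=> a' [? ?]; exists a'.
  case: (h01 _ (mpre `]a, +oo[)) => // Fa; exfalso.
  have : (m ((g @^-1` `]-oo, a'] `&` S) `|` (g @^-1` `]a, +oo[ `&` S)) <= m S)%E.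
    apply: le_measure; rewrite ?inE//; last by move=> q [] [].
    by apply: measurableU; apply: measurableI.
  rewrite measureU; [|exact: measurableI|exact: measurableI|].
    rewrite [X in (X + _)%E](Fa' : m _ = 1%E) [X in (_ + X)%E](Fa : m _ = 1%E) S1.
    by rewrite -EFinD lee_fin gerDl ler10.
  apply/seteqP; split => // q [[/=]] + _ [/= + _]; rewrite !in_itv /= andbT => h1 h2.
  by have := lt_trans a'a (lt_le_trans h2 h1); rewrite ltxx.
have N : m.-negligible (\bigcup_(k : nat) (g @^-1` `]-oo, x - k.+1%:R^-1] `&` S) `|`
    \bigcup_(k : nat) (g @^-1` `]x + k.+1%:R^-1, +oo[ `&` S)).
  apply: negligibleU; apply: negligible_bigcup => k; apply/negligibleP.
  - exact: measurableI.
  - by apply: mlt; rewrite ltrBlDr ltrDl invr_gt0.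
  - exact: measurableI.
  - by apply: mgt; rewrite ltrDl invr_gt0.
have mD : measurable (S `\` g @^-1` [set x]).
  by apply: measurableD => //; rewrite -set_itv1.
apply/negligibleP => //; apply: negligibleS N => q [Sq /= /eqP].
rewrite neq_lt => /orP[qx|xq]; [left|right].
  have [k hk] : exists k, k.+1%:R^-1 < x - g q by apply: natSinv_lt; rewrite subr_gt0.
  by exists k => //; split => //=; rewrite in_itv /= lerBrDr -lerBrDl ltW.
have [k hk] : exists k, k.+1%:R^-1 < g q - x by apply: natSinv_lt; rewrite subr_gt0.
by exists k => //; split => //=; rewrite in_itv /= andbT -ltrBrDl.
Qed.

(** Each coordinate is constant up to a null set, so the mass sits at a single point. *)
Lemma atomP m (S : set (R * R)) (c : R) : measurable S -> m S = 1%E ->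
  (forall B, measurable B -> m (B `&` S) = 0%E \/ m (B `&` S) = 1%E) ->
  (forall q, S q -> `|q.1| <= c /\ `|q.2| <= c) ->
  exists q, S q /\ forall B, measurable B -> m (B `&` S) = \d_q B.
Proof.
move=> mS S1 h01 Sc.
have [x hx] := level_atom mS S1 h01 measurable_fst (fun q Sq => (Sc q Sq).1).
have [y hy] := level_atom mS S1 h01 measurable_snd (fun q Sq => (Sc q Sq).2).
have mq : measurable [set (x, y)] by exact: measurable_mark.
have N : m (S `\ (x, y)) = 0%E.
  apply/negligibleP; first exact: measurableD.
  have : m.-negligible ((S `\` fst @^-1` [set x]) `|` (S `\` snd @^-1` [set y])).
    apply: negligibleU; apply/negligibleP => //; apply: measurableD => //;
      rewrite -[_ @^-1` _]setTI; [exact: measurable_fst|exact: measurable_snd].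
  apply: negligibleS => -[q1 q2] [Sq /= nq].
  have [q1x|q1x] := eqVneq q1 x; last by left; split => //=; exact/eqP.
  by right; split => //= q2y; apply: nq; rewrite q1x q2y.
have out B : measurable B -> ~ B (x, y) -> m (B `&` S) = 0%E.
  move=> mB nB; apply/eqP; rewrite eq_le measure_ge0 andbT -[X in (_ <= X)%E]N.
  apply: le_measure; rewrite ?inE; [exact: measurableI|exact: measurableD|].
  by move=> q [Bq Sq]; split => //= e; rewrite e in Bq.
exists (x, y); split.
  apply: contrapT => nS; have := out S mS nS; rewrite setIid S1.
  by move/eqP; rewrite eqe oner_eq0.
move=> B mB; rewrite diracE; have [Bq|nB] := pselect (B (x, y)); last first.
  by rewrite memNset// out.
rewrite mem_set//; case: (h01 B mB) => // B0; exfalso.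
have := out (~` B) (measurableC mB) (fun n => n Bq).
move: S1; rewrite (@measureDI _ _ _ m S B)// setIC => /= + C0.
rewrite [X in (_ + X)%E](B0 : m _ = 0%E) adde0 setDE [X in X = _](_ : _ = 0%E).
  by move/esym/eqP; rewrite eqe oner_eq0.
by rewrite setIC.
Qed.

End atoms.

(** * Extraction of the marks by vertical strips *)

Section strips.
Context {R : realType}.
Implicit Types (m : {measure set (R * R) -> \bar R}) (N n j : nat).

Local Notation nbox N := (box (- N%:R) N%:R N%:R : set (R * R)).

(** The strips exceed the box by 1 in total width: being half-open, they would otherwise miss its
    right edge. *)
Definition width N n : R := (2 * N%:R + 1) / n.+1%:R.
Definition strip_lo N n j : R := - N%:R + j%:R * width N n.
Definition strip N n j : set (R * R) :=
  nbox N `&` (`[strip_lo N n j, strip_lo N n j.+1[ `*` setT).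

Definition counting_measure m := forall B, measurable B ->
  m B = +oo%E \/ exists k : nat, m B = k%:R%:E.

(** This one condition yields both a finite list of the marks and the distinctness of their
    abscissas. *)
Definition strips_ok m N n := forall j, (j < n.+1)%N ->
  m (strip N n j) = 0%E \/ m (strip N n j) = 1%E.

Definition atom m (S : set (R * R)) : R * R :=
  xget (0, 0) [set q | S q /\ forall B, measurable B -> m (B `&` S) = \d_q B].

Definition strip_list m N n :=
  [seq atom m (strip N n j) | j <- iota 0 n.+1 & m (strip N n j) == 1%E].

Lemma measurable_strip N n j : measurable (strip N n j).
Proof.
by apply: measurableI; [exact: measurable_box|exact: measurableX].
Qed.

Lemma width_gt0 N n : 0 < width N n.
Proof. by rewrite divr_gt0//; have := ler0n R N; lra. Qed.

Lemma stripP N n j q : strip N n j q <->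
  nbox N q /\ strip_lo N n j <= q.1 < strip_lo N n j.+1.
Proof.
rewrite /strip; split => [[bq [/=]]|[bq h]]; first by rewrite in_itv.
by split => //; split => //=; rewrite in_itv.
Qed.

Lemma strip_lo_le N n i j : (i <= j)%N -> strip_lo N n i <= strip_lo N n j.
Proof.
by move=> ij; rewrite lerD2l ler_pM2r ?width_gt0// ler_nat.
Qed.

Lemma strip_disjoint N n i j q : strip N n i q -> strip N n j q -> i = j.
Proof.
move=> /stripP[_ /andP[h1 h2]] /stripP[_ /andP[h3 h4]].
have [ij|ji|//] := ssrnat.ltngtP i j.
  by have h := strip_lo_le N n ij; exfalso; lra.
by have h := strip_lo_le N n ji; exfalso; lra.
Qed.

Lemma strip_cover N n : nbox N = \big[setU/set0]_(j < n.+1) strip N n j.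
Proof.
rewrite -bigcup_mkord; apply/seteqP; split => [q bq|q [j _ /stripP[]//]].
have w0 := width_gt0 N n; have /boxP[h1 h2 _ _] := bq.
have x0 : 0 <= (q.1 + N%:R) / width N n by apply: divr_ge0; [lra|exact: ltW].
have /andP[t1 t2] := truncn_itv x0; set j := Num.truncn _ in t1 t2.
rewrite ler_pdivlMr// in t1; rewrite ltr_pdivrMr// in t2.
exists j; last by apply/stripP; split => //; rewrite /strip_lo; apply/andP; split; lra.
rewrite /= -(ltr_nat R) -(ltr_pM2r w0); apply: le_lt_trans t1 _.
by rewrite /width mulrC mulfVK ?pnatr_eq0//; lra.
Qed.

Lemma strips_mass m N n B : measurable B ->
  m (B `&` nbox N) = (\sum_(j < n.+1) m (B `&` strip N n j))%E.
Proof.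
move=> mB; rewrite (strip_cover N n) big_distrr /=.
rewrite (@measure_bigsetU _ _ _ m (fun j => B `&` strip N n j))//.
  by move=> j; apply: measurableI => //; exact: measurable_strip.
move=> i j _ _ [q [[_ hi] [_ hj]]]; exact: strip_disjoint hi hj.
Qed.

Lemma atom_spec m N n j : counting_measure m -> m (strip N n j) = 1%E ->
  strip N n j (atom m (strip N n j)) /\
  forall B, measurable B -> m (B `&` strip N n j) = \d_(atom m (strip N n j)) B.
Proof.
move=> cm S1; have mS := measurable_strip N n j.
have [q hq] : exists q, strip N n j q /\
    forall B, measurable B -> m (B `&` strip N n j) = \d_q B.
  apply: (@atomP _ m (strip N n j) N%:R mS S1) => [B mB|q /stripP[/boxP[? ? ? ?] _]].
    have le1 : (m (B `&` strip N n j) <= 1)%E.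
      by rewrite -S1; apply: le_measure; rewrite ?inE//; exact: measurableI.
    have [e|[k e]] := cm _ (measurableI _ _ mB mS); rewrite e in le1 *.
      by rewrite leye_eq in le1.
    by move: le1; rewrite lee_fin lern1; case: k {e} => [|[|//]]; [left|right].
  by rewrite !ler_norml; split; apply/andP; split; lra.
exact: (@xgetI _ (0, 0) [set q | strip N n j q /\ forall B, measurable B ->
  m (B `&` strip N n j) = \d_q B] q hq).
Qed.

Lemma strip_list_marks m N n : counting_measure m -> strips_ok m N n ->
  lists_marks m (nbox N) (strip_list m N n).
Proof.
move=> cm ok B mB; rewrite (strips_mass m N n mB) /strip_list big_map big_filter.
rewrite [RHS]big_mkcond -(big_mkord xpredT (fun j => m (B `&` strip N n j))) /= /index_iota subn0.
apply: eq_big_seq => j; rewrite mem_iota add0n => /= jn.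
have [e|e] := ok j jn; rewrite e.
  rewrite eqe eq_sym oner_eq0; apply/eqP; rewrite eq_le measure_ge0 andbT -e.
  apply: le_measure; rewrite ?inE; [|exact: measurable_strip|exact: subIsetr].
  by apply: measurableI => //; exact: measurable_strip.
by rewrite eqxx (atom_spec cm e).2.
Qed.

Lemma strip_list_uniq m N n : counting_measure m ->
  uniq (map fst (strip_list m N n)).
Proof.
move=> cm; rewrite -map_comp map_inj_in_uniq ?filter_uniq ?iota_uniq// => i j.
rewrite !mem_filter => /andP[/eqP ei _] /andP[/eqP ej _] /= e.
have [si _] := atom_spec cm ei; have [sj _] := atom_spec cm ej.
apply: (strip_disjoint si).
apply/stripP; split; first by have /stripP[] := si.
by have /stripP[_ h] := sj; rewrite e.
Qed.

End strips.

(** * Almost surely, fine strips hold at most one mark each *)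

Section poisson.
Context {R : realType} {d : measure_display} {W : measurableType d}.
Variables (P : probability W R) (M : R.-ker W ~> (R * R)%type).
Hypothesis MP : poisson_measure P M.

Lemma intensity_rect (a b t u : R) : a < b -> 0 <= t -> t < u ->
  intensity (`[a, b[ `*` `[t, u[) = ((b - a) * (u - t))%:E.
Proof.
move=> ab t0 tu; rewrite /intensity (setIidl _).
  rewrite product_measure1E//= !lebesgue_measure_itv /= !lte_fin ab tu.
  by rewrite -!EFinB -EFinM.
by move=> q [_ /=]; rewrite !in_itv /= andbT => /andP[tq _]; split => //=;
  rewrite ?in_itv /= ?andbT (le_trans t0).
Qed.

Lemma intensity_le (A B : set (R * R)) : measurable A -> measurable B -> A `<=` B ->
  (intensity A <= intensity B)%E.
Proof.
move=> mA mB AB; apply: le_measure; rewrite ?inE; last exact: setSI.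
  by apply: measurableI => //; exact: measurableX.
by apply: measurableI => //; exact: measurableX.
Qed.

Lemma intensity_le_rect (A : set (R * R)) (a b t u : R) : measurable A ->
  a < b -> 0 <= t -> t < u -> A `<=` `[a, b[ `*` `[t, u[ ->
  exists2 r, intensity A = r%:E & 0 <= r <= (b - a) * (u - t).
Proof.
move=> mA ab t0 tu sA.
have mB : measurable (`[a, b[ `*` `[t, u[ : set (R * R)) by exact: measurableX.
have h := intensity_le mA mB sA; rewrite intensity_rect// in h.
have h0 : (0 <= intensity A)%E by exact: measure_ge0.
case: (intensity A) h h0 => [r|//|//]; rewrite !lee_fin => h h0.
by exists r; rewrite ?h0.
Qed.

Lemma measurable_count (B : set (R * R)) (c : \bar R) : measurable B ->
  measurable [set w | M w B = c].
Proof.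
move=> mB; have := measurable_kernel M B mB measurableT _ (emeasurable_set1 c).
by rewrite setTI.
Qed.

(** The bound $1-e^{-r}(1+r)\le r^2$ follows from $e^{-r}\ge 1-r$. *)
Lemma poisson_le1 (B : set (R * R)) (r : R) : measurable B ->
  intensity B = r%:E -> 0 <= r ->
  (P (~` ([set w | M w B = 0%E] `|` [set w | M w B = 1%E])) <= (r ^+ 2)%:E)%E.
Proof.
move=> mB Br r0.
have m0 := measurable_count 0%E mB; have m1 := measurable_count 1%E mB.
rewrite probability_setC; last exact: measurableU.
rewrite measureU//; last first.
  apply/seteqP; split => // w [/= ->] /eqP; rewrite eqe eq_sym oner_eq0//.
have := poisson_law_fin MP mB Br 0%N; have := poisson_law_fin MP mB Br 1%N.
rewrite /= expr0 expr1 fact0 (_ : 1`! = 1%N)// !invr1 !mulr1.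
move=> p1 p0; rewrite [X in (_ - (X + _))%E](p0 : P _ = _) [X in (_ - (_ + X))%E](p1 : P _ = _).
rewrite -!EFinD lee_fin.
have e1 := expR_ge1Dx (- r).
have e0 := expR_gt0 (- r).
have [r1|r1] := leP r 1; last by nra.
by nra.
Qed.

Definition ok_event N n : set W := [set w | strips_ok (M w) N n].

Lemma ok_eventE N n : ~` ok_event N n = \big[setU/set0]_(j < n.+1)
  ~` ([set w | M w (strip N n j) = 0%E] `|` [set w | M w (strip N n j) = 1%E]).
Proof.
rewrite -(bigcup_mkord _ (fun j => ~` ([set w | M w (strip N n j) = 0%E] `|`
  [set w | M w (strip N n j) = 1%E]))) /ok_event; apply/seteqP; split => w /=.
  move=> /existsNP[j] /not_implyP[jn h]; by exists j.
by move=> [j /= jn h] H; apply: h; exact: H.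
Qed.

Lemma measurable_bad N n j : measurable
  (~` ([set w | M w (strip N n j) = 0%E] `|` [set w | M w (strip N n j) = 1%E])).
Proof.
by apply/measurableC/measurableU; apply: measurable_count; exact: measurable_strip.
Qed.

Lemma measurable_ok N n : measurable (ok_event N n).
Proof.
rewrite -[ok_event N n]setCK ok_eventE; apply: measurableC.
by apply: bigsetU_measurable => j _; exact: measurable_bad.
Qed.

(** There are n + 1 strips, each failing with probability of order $(n+1)^{-2}$. The height N + 1
    makes room for the closed top edge of the box. *)
Lemma bad_le N n : (P (~` ok_event N n) <=
  (((2 * N%:R + 1) * (N%:R + 1)) ^+ 2 / n.+1%:R)%:E)%E.
Proof.
rewrite ok_eventE; apply: le_trans (@Boole_inequality _ _ _ P (fun j => ~` ([set w | M w (strip N n j) = 0%E]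
  `|` [set w | M w (strip N n j) = 1%E])) n.+1 _) _.
  by move=> j _; exact: measurable_bad.
apply: le_trans (_ : \sum_(j < n.+1) ((width N n * (N%:R + 1)) ^+ 2)%:E <= _)%E.
  apply: lee_sum => j _.
  have w0 := width_gt0 (R := R) N n.
  have mS := measurable_strip (R := R) N n j.
  have N1 : 0 < N%:R + 1 :> R by have := ler0n R N; lra.
  have lohi : strip_lo N n j < strip_lo N n j.+1 :> R.
    by rewrite /strip_lo -natr1 mulrDl; lra.
  have sub : strip N n j `<=` `[strip_lo N n j, strip_lo N n j.+1[ `*` `[(0 : R), N%:R + 1[.
    move=> q /stripP[/boxP[_ _ q0 qN] h]; split; rewrite /= in_itv /=; first exact: h.
    by rewrite q0 /=; lra.
  have [r rE /andP[r0 rle]] := intensity_le_rect mS lohi (lexx 0) N1 sub.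
  apply: le_trans (poisson_le1 mS rE r0) _; rewrite lee_fin ler_pXn2r ?nnegrE//.
    by apply: le_trans rle _; rewrite /strip_lo -natr1 subr0; lra.
  by apply: mulr_ge0; exact: ltW.
rewrite sumEFin lee_fin sumr_const card_ord -[X in X <= _]mulr_natr /width.
have k0 : n.+1%:R != 0 :> R by rewrite pnatr_eq0.
by move: (n.+1%:R) k0 => k k0; rewrite le_eqVlt; apply/orP; left; apply/eqP; field.
Qed.

Lemma ok_as N : P (~` \bigcup_n ok_event N n) = 0%E.
Proof.
have mU : measurable (~` \bigcup_n ok_event N n).
  by apply/measurableC/bigcup_measurable => n _; exact: measurable_ok.
set c := ((2 * N%:R + 1) * (N%:R + 1)) ^+ 2 : R.
have c0 : 0 <= c by exact: sqr_ge0.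
have h n : (P (~` \bigcup_n ok_event N n) <= (c / n.+1%:R)%:E)%E.
  apply: le_trans (bad_le N n); apply: le_measure; rewrite ?inE//.
    by apply: measurableC; exact: measurable_ok.
  by move=> w hw ok; apply: hw; exists n.
have fin : P (~` \bigcup_n ok_event N n) \is a fin_num by exact: fin_num_measure.
apply/eqP; rewrite eq_le measure_ge0 andbT -(fineK fin) lee_fin leNgt; apply/negP => x0.
have x0' : 0 < fine (P (~` \bigcup_n ok_event N n)) / (c + 1).
  by rewrite divr_gt0//; lra.
have [k hk] := natSinv_lt x0'.
have := h k; rewrite -(fineK fin) lee_fin leNgt => /negP; apply.
rewrite ltr_pdivlMr in hk; last lra.
apply: le_lt_trans hk; rewrite mulrC ler_pM2l ?invr_gt0//; lra.
Qed.

Definition all_ok : set W := \bigcap_N \bigcup_n ok_event N n.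

Lemma measurable_all_ok : measurable all_ok.
Proof.
apply: bigcap_measurable => // N _; apply: bigcup_measurable => n _.
exact: measurable_ok.
Qed.

Lemma all_ok_as : P (~` all_ok) = 0%E.
Proof.
rewrite /all_ok setC_bigcap; apply/negligibleP.
  apply: bigcup_measurable => N _; apply/measurableC/bigcup_measurable => n _.
  exact: measurable_ok.
apply: negligible_bigcup => N; apply/negligibleP; last exact: ok_as.
by apply/measurableC/bigcup_measurable => n _; exact: measurable_ok.
Qed.

End poisson.

(** * A measurable choice of strips and of the list of marks *)

Section first_index.
Context {d : measure_display} {W : measurableType d}.
Variable E : nat -> set W.
Hypothesis mE : forall n, measurable (E n).

Definition first_set n : set W := E n `\` \bigcup_(i < n) E i.
Definition first_index (w : W) : nat := xget 0%N [set n | first_set n w].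

Lemma first_set_inj n n' w : first_set n w -> first_set n' w -> n = n'.
Proof.
move=> [En nE] [En' nE']; have [nn'|n'n|//] := ssrnat.ltngtP n n'.
  by exfalso; apply: nE'; exists n.
by exfalso; apply: nE; exists n'.
Qed.

Lemma first_indexE n w : first_set n w -> first_index w = n.
Proof.
by move=> h; exact: (first_set_inj (@xgetI _ 0%N [set n | first_set n w] n h) h).
Qed.

Lemma first_set_exists w : (\bigcup_n E n) w -> exists n, first_set n w.
Proof.
move=> [n _ En]; elim/ltn_ind: n En => n ih En.
have [[i /= ni Ei]|h] := pselect ((\bigcup_(i < n) E i) w); first exact: ih ni Ei.
by exists n.
Qed.

Lemma first_indexP w : (\bigcup_n E n) w -> E (first_index w) w.
Proof. by move=> /first_set_exists[n h]; rewrite (first_indexE h); case: h. Qed.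

Lemma measurable_first_set n : measurable (first_set n).
Proof. by apply: measurableD => //; apply: bigcup_measurable. Qed.

End first_index.

Section mark_list.
Import Defs.
Context {R : realType} {d : measure_display} {W : measurableType d}.
Variables (P : probability W R) (M : R.-ker W ~> (R * R)%type).
Hypothesis MP : poisson_measure P M.

Definition mark_list N (w : W) : seq (R * R) :=
  strip_list (M w) N (first_index (ok_event M N) w).

Lemma counting_M w : counting_measure (M w).
Proof. by move=> B mB; exact: (poisson_counting MP w mB). Qed.

Lemma mark_list_marks N w : all_ok M w ->
  lists_marks (M w) (box (- N%:R) N%:R N%:R) (mark_list N w).
Proof.
move=> h; apply: strip_list_marks; first exact: counting_M.
exact: (first_indexP (h N I)).
Qed.

Lemma mark_list_uniq N w : uniq (map fst (mark_list N w)).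
Proof. exact/strip_list_uniq/counting_M. Qed.

Definition occupied N n (b : seq bool) : set W :=
  [set w | [seq M w (strip N n j) == 1%E | j <- iota 0 n.+1] = b].

Lemma measurable_occupied N n b : measurable (occupied N n b).
Proof.
rewrite /occupied; elim: (iota 0 n.+1) b => [|j l ih] [|c b].
- by rewrite (_ : [set w | _] = setT)//; apply/seteqP; split.
- by rewrite (_ : [set w | _] = set0)//; apply/seteqP; split.
- by rewrite (_ : [set w | _] = set0)//; apply/seteqP; split.
rewrite (_ : [set w | _] = [set w | (M w (strip N n j) == 1%E) = c] `&`
  [set w | [seq M w (strip N n j) == 1%E | j <- l] = b]); last first.
  by apply/seteqP; split => w /= [-> ->].
apply: measurableI; last exact: ih.
have m1 := measurable_count M 1%E (measurable_strip (R := R) N n j).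
case: c.
  rewrite (_ : [set w | _] = [set w | M w (strip N n j) = 1%E])//.
  by apply/seteqP; split => w /= /eqP.
rewrite (_ : [set w | _] = ~` [set w | M w (strip N n j) = 1%E]).
  exact: measurableC.
apply/seteqP; split => w /= h; first by move=> e; rewrite e eqxx in h.
exact/negbTE/eqP.
Qed.

Lemma measurable_fun_ge (D : set W) (f : W -> R) :
  (forall a, measurable (D `&` [set w | a <= f w])) -> measurable_fun D f.
Proof.
move=> h; move=> mD; apply: (measurability _ (RGenCInfty.measurableE R)) => //.
move=> _ [_ [a ->] <-].
rewrite (_ : _ `&` _ = D `&` [set w | a <= f w])//.
by apply/seteqP; split => w [Dw /=]; rewrite in_itv /= andbT.
Qed.

(** In a strip of mass one, the atom lies in a set exactly when the set has mass one in that strip;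
    its coordinates thus inherit the measurability of the kernel. *)
Lemma measurable_atom N n j (D : set W) (g : R * R -> R) : measurable D ->
  (forall w, D w -> M w (strip N n j) = 1%E) -> measurable_fun setT g ->
  measurable_fun D (fun w => g (atom (M w) (strip N n j))).
Proof.
move=> mD D1 mg; apply: measurable_fun_ge => a.
have ma : measurable [set q | a <= g q].
  have := mg measurableT _ (measurable_itv `[a, +oo[); rewrite setTI.
  rewrite (_ : g @^-1` _ = [set q | a <= g q])//.
  by apply/seteqP; split => q /=; rewrite in_itv /= andbT.
have mI : measurable ([set q | a <= g q] `&` strip N n j).
  by apply: measurableI => //; exact: measurable_strip.
rewrite (_ : _ `&` _ = D `&` [set w | M w ([set q | a <= g q] `&` strip N n j) = 1%E]).
  by apply: measurableI => //; exact: measurable_count.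
apply/seteqP; split => w [Dw /=]; rewrite (atom_spec (counting_M w) (D1 w Dw)).2// diracE.
  by move=> h; split => //; rewrite mem_set.
move=> h; split => //; apply: contrapT => h'; move: h; rewrite memNset// => /eqP.
by rewrite eqe eq_sym oner_eq0.
Qed.

Lemma mval_const_list A (D : set W) (J : seq nat) (f : nat -> W -> val_of R A) :
  measurable D -> (forall j, j \in J -> mval D (f j)) ->
  mval D (fun w => [seq f j w | j <- J] : val_of R (List A)).
Proof.
move=> mD hf k /=; have [->|kJ] := eqVneq k (size J); last first.
  rewrite (_ : D `&` _ = set0); last first.
    apply/seteqP; split => // w [_ /=]; rewrite size_map => /esym/eqP.
    by rewrite (negbTE kJ).
  by split => // i _; exact: mval_set0.
rewrite (_ : D `&` _ = D); last first.
  by apply/seteqP; split => [w []//|w Dw]; split => //=; rewrite size_map.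
split => // i iJ; apply: (@mval_eq _ _ _ _ _ (f (nth 0%N J i))).
  by move=> w _; rewrite (nth_map 0%N).
exact/hf/mem_nth.
Qed.

(** [all_ok M] is cut into countably many pieces, indexed through [pickle] by the number of strips
    and the occupied ones; on each piece the list has a fixed shape. *)
Lemma mval_mark_list N :
  mval (all_ok M) (mark_list N : W -> val_of R (List (Pair Real Real))).
Proof.
pose piece (c : nat * seq bool) := all_ok M `&` (first_set (ok_event M N) c.1 `&` occupied N c.1 c.2).
pose F (k : nat) := if unpickle k is Some c then piece c else set0.
have mok n : measurable (ok_event M N n) by exact: measurable_ok.
have mpiece c : measurable (piece c).
  apply: measurableI; first exact: measurable_all_ok.
  by apply: measurableI; [exact: measurable_first_set|exact: measurable_occupied].
apply: (mval_bigcup (F := F)).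
- by move=> k; rewrite /F; case: unpickle.
- apply/seteqP; split => [w ow|w [k _]]; last by rewrite /F; case: unpickle => // c [].
  have [n fn] := first_set_exists (ow N I).
  exists (pickle (n, [seq M w (strip N n j) == 1%E | j <- iota 0 n.+1])) => //.
  by rewrite /F pickleK.
- move=> k; rewrite /F; case: unpickle => [[n b]|]; last exact: mval_set0.
  have mp := mpiece (n, b).
  apply: (@mval_eq _ _ _ _ _ (fun w => [seq atom (M w) (strip N n j) |
      j <- mask b (iota 0 n.+1)] : val_of R (List (Pair Real Real)))).
    move=> w /set_mem[_ [/= fn occ]].
    by rewrite /mark_list (first_indexE fn) /strip_list filter_mask occ.
  apply: mval_const_list => // j jb.
  have one w : piece (n, b) w -> M w (strip N n j) = 1%E.
    move=> [_ [_ /= occ]]; move: jb; rewrite -occ -filter_mask mem_filter.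
    by move=> /andP[/eqP].
  split; first exact: (measurable_atom mp one measurable_fst).
  exact: (measurable_atom mp one measurable_snd).
Qed.

Lemma measurable_simulate (alg : simulator) (p t x : R) (D : set W) (l : W -> seq (R * R)) :
  measurable D -> mval D (l : W -> val_of R (List (Pair Real Real))) ->
  measurable_fun D (fun w => (simulate alg p t x (l w)).1) /\
  (measurable_fun D (fun w => (simulate alg p t x (l w)).2.1) /\
   measurable_fun D (fun w => (simulate alg p t x (l w)).2.2)).
Proof.
move=> mD ml.
have := @run_measurable R d W _ _ alg D (fun w => ((p, (t, x)), l w)) mD; apply.
by split => //; split; [exact: measurable_cst|split; exact: measurable_cst].
Qed.

End mark_list.

(** * Independent events of probability bounded below *)

Section independence.
Context {R : realType} {d : measure_display} {W : measurableType d}.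
Variable P : probability W R.

Lemma measurable_bigI (I : Type) (E : I -> set W) (s : seq I) :
  (forall i, measurable (E i)) -> measurable (\big[setI/setT]_(i <- s) E i).
Proof.
by move=> mE; elim/big_ind : _ => //; exact: measurableI.
Qed.

(** Events are complemented one at a time, by subtracting the probability of the part inside the
    event. *)
Lemma indep_setC (I : eqType) (E : I -> set W) : (forall i, measurable (E i)) ->
  (forall s, uniq s -> P (\big[setI/setT]_(i <- s) E i) =
    (\prod_(i <- s) fine (P (E i)))%:E) ->
  forall s1 s2, uniq (s1 ++ s2) ->
  P ((\big[setI/setT]_(i <- s1) ~` E i) `&` \big[setI/setT]_(i <- s2) E i) =
  ((\prod_(i <- s1) (1 - fine (P (E i)))) * \prod_(i <- s2) fine (P (E i)))%:E.
Proof.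
move=> mE ind; elim=> [|i s1 ih] s2 /= us.
  by rewrite !big_nil setTI mul1r; exact: ind.
rewrite !big_cons; set X := \big[setI/setT]_(i <- s1) ~` E i.
set Y := \big[setI/setT]_(i <- s2) E i.
have mX : measurable X by apply: measurable_bigI => j; exact: measurableC.
have mY : measurable Y by exact: measurable_bigI.
have us2 : uniq (s1 ++ s2) by case/andP: us.
have us3 : uniq (s1 ++ i :: s2) by rewrite (uniq_catCA s1 [:: i] s2).
have := ih _ us2; have := ih _ us3; rewrite -/X -/Y !big_cons -/Y => h1 h2.
rewrite (_ : _ `&` Y = (X `&` Y) `\` E i); last first.
  by apply/seteqP; split => [w [[? ?] ?]|w [[? ?] ?]].
have fin : (P (X `&` Y) < +oo)%E.
  by rewrite ltey_eq fin_num_measure//; exact: measurableI.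
have hD : P ((X `&` Y) `\` E i) = (P (X `&` Y) - P (X `&` Y `&` E i))%E.
  by apply: measureD => //; exact: measurableI.
rewrite hD h2 (_ : _ `&` E i = X `&` (E i `&` Y)); last by rewrite -setIA (setIC Y).
by rewrite h1 -EFinB; congr EFin; ring.
Qed.

(** The first k events all fail with probability at most $(1-q)^k$. The estimate $(1-q)^k(1+kq)\le
    1$, of Bernoulli type, makes this smaller than any positive number. *)
Lemma indep_bigcup_as (E : nat -> set W) (q : R) : (forall i, measurable (E i)) ->
  (forall s, uniq s -> P (\big[setI/setT]_(i <- s) E i) =
    (\prod_(i <- s) fine (P (E i)))%:E) ->
  0 < q -> (forall i, (q%:E <= P (E i))%E) ->
  P (~` \bigcup_i E i) = 0%E.
Proof.
move=> mE ind q0 qE; set X := ~` _.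
have mX : measurable X by apply/measurableC/bigcup_measurable.
have q1 : q <= 1 by rewrite -lee_fin (le_trans (qE 0%N))// probability_le1.
have XP k : (P X <= ((1 - q) ^+ k)%:E)%E.
  have us : uniq (iota 0 k ++ [::]) by rewrite cats0 iota_uniq.
  have := indep_setC mE ind us; rewrite !big_nil setIT mulr1 => h.
  apply: le_trans (_ : _ <= P (\big[setI/setT]_(i <- iota 0 k) ~` E i))%E _.
    apply: le_measure; rewrite ?inE//.
      by apply: measurable_bigI => i; exact: measurableC.
    move=> w Xw; rewrite -bigcap_seq => i _ Ei.
    by apply: Xw; exists i.
  rewrite h lee_fin; clear us h X mX; elim: k 0%N => [|k ih] n; first by rewrite big_nil expr0.
  rewrite /= big_cons exprS.
  have p1 : fine (P (E n)) <= 1 by rewrite -lee_fin fineK ?fin_num_measure ?probability_le1.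
  have pq : q <= fine (P (E n)) by rewrite -lee_fin fineK ?fin_num_measure ?qE.
  apply: ler_pM; [lra| |lra|exact: ih].
  apply: prodr_ge0 => i _; rewrite subr_ge0 -lee_fin fineK ?fin_num_measure//.
  exact: probability_le1.
have fin : P X \is a fin_num by exact: fin_num_measure.
apply/eqP; rewrite eq_le measure_ge0 andbT -(fineK fin) lee_fin leNgt; apply/negP => x0.
have x0' : 0 < fine (P X) * q by rewrite mulr_gt0.
have [k hk] := natSinv_lt x0'; have := XP k.+1; rewrite -(fineK fin) lee_fin => hX.
have bern j : (1 - q) ^+ j * (1 + j%:R * q) <= 1.
  elim: j => [|j ih]; first by rewrite mul0r addr0 mulr1.
  have c0 : 0 <= (1 - q) ^+ j by apply: exprn_ge0; lra.
  have j0 := ler0n R j; rewrite exprS -natr1.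
  apply: le_trans ih; rewrite mulrAC -subr_ge0 -mulrA.
  set c := (1 - q) ^+ j in c0 *; set J := j%:R in j0 *.
  rewrite (_ : _ - _ = c * ((J + 1) * (q * q))); first by rewrite !mulr_ge0//; lra.
  by ring.
have k0 : 0 < k.+1%:R :> R by rewrite ltr0n.
have := bern k.+1; rewrite -subr_ge0 => hb.
have e : k.+1%:R^-1 * k.+1%:R = 1 :> R by rewrite mulVf// gt_eqF.
have hk' : 1 < fine (P X) * q * k.+1%:R by rewrite -[ltLHS]e ltr_pM2r.
move: {e bern} hb hk' hX x0 k0; set y := fine _; set a := (1 - q) ^+ _; set K := k.+1%:R.
by move=> *; nra.
Qed.

End independence.

(** * Probability of the barrier patterns *)

Section cell_events.
Context {R : realType} {d : measure_display} {W : measurableType d}.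
Variables (P : probability W R) (M : R.-ker W ~> (R * R)%type).
Hypothesis MP : poisson_measure P M.

(** Independence is passed from ordinals to any finite index type, in view of pairs of a cell and
    one of its pieces. *)
Lemma indep_counts (I : finType) (B : I -> set (R * R)) (c : I -> \bar R) :
  (forall i, measurable (B i)) -> (forall i j, i != j -> B i `&` B j = set0) ->
  P [set w | forall i, M w (B i) = c i] =
  (\prod_i fine (P [set w | M w (B i) = c i]))%:E.
Proof.
move=> mB dB.
have h := poisson_indep MP (B := fun i : 'I_#|I| => B (enum_val i)) (fun i => mB _).
have {}h := h (fun i j ij => dB _ _ (contra_neq (@enum_val_inj _ _ i j) ij))
  (fun i => [set c (enum_val i)]) (fun i => emeasurable_set1 _).
rewrite (_ : [set w | _] = \bigcap_(i : 'I_#|I|)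
    ((fun w => M w (B (enum_val i))) @^-1` [set c (enum_val i)])); last first.
  apply/seteqP; split => w /= hw i; first by move=> _; exact: hw.
  by rewrite -(enum_rankK i); exact: hw.
rewrite h (reindex_onto (@enum_val I I) enum_rank); last by move=> i _; exact: enum_rankK.
rewrite (eq_bigl xpredT); last by move=> i; rewrite enum_valK eqxx.
have mQ i : measurable [set w | M w (B i) = c i] by exact: measurable_count.
elim/big_ind2 : _ => // [_ x _ y -> -> //|i _]; by rewrite fineK ?fin_num_measure.
Qed.

(** The index 3K stands for the rest of the cell, so that a pattern prescribes 3K + 1 counts on
    disjoint sets. *)
Definition piece (al : R) K l := if (l < 3 * K)%N then rect al l else cell_rest al K.
Definition piece_count K l : \bar R := if (l < 3 * K)%N then 1%E else 0%E.

Lemma measurable_piece al K l : measurable (piece al K l).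
Proof. by rewrite /piece; case: ifP => _; [exact: measurable_rect|exact: measurable_cell_rest]. Qed.

Lemma cell_eventE al K w : cell_event (M w) al K <->
  forall l : 'I_(3 * K).+1, M w (piece al K l) = piece_count K l.
Proof.
split=> [[h1 h2] l|h]; first by rewrite /piece /piece_count; case: ifP => // /h1.
split=> [l lK|]; last by have := h ord_max; rewrite /piece /piece_count /= ltnn.
have lK' : (l < (3 * K).+1)%N by exact: ltnW.
by have := h (Ordinal lK'); rewrite /piece /piece_count /= lK.
Qed.

Lemma piece_disjoint al K (l l' : 'I_(3 * K).+1) q :
  piece al K l q -> piece al K l' q -> l = l'.
Proof.
have H (k k' : 'I_(3 * K).+1) : (k < 3 * K)%N -> ~~ (k' < 3 * K)%N ->
    rect al k q -> cell_rest al K q -> k = k' by move=> kK _ kq [_ []]; exists k.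
rewrite /piece; case: ifPn => lK; case: ifPn => l'K hq hq'.
- exact/val_inj/(rect_disjoint hq hq').
- exact: (H _ _ lK l'K hq hq').
- exact/esym/(H _ _ l'K lK hq' hq).
- apply: val_inj => /=; move: (ltn_ord l) (ltn_ord l') lK l'K; rewrite -!leqNgt !ltnS.
  by move=> a b a' b'; apply/eqP; rewrite eqn_leq (leq_trans a b')// (leq_trans b a').
Qed.

Lemma piece_abscissa al K l q : piece al K l q -> al <= q.1 < al + 1.
Proof.
rewrite /piece; case: ifP => _.
  by move=> /rectP[h1 h2 _ _]; have [] := rect_bounds al l; lra.
by move=> [[/=]]; rewrite in_itv.
Qed.

Section disjoint_cells.
Variable al : nat -> R.
Hypothesis al_far : forall i j, i != j -> al i + 1 <= al j \/ al j + 1 <= al i.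
Variable K : nat.

Let E i : set W := [set w | cell_event (M w) (al i) K].
Let Q i (l : 'I_(3 * K).+1) : set W := [set w | M w (piece (al i) K l) = piece_count K l].
Let f i (l : 'I_(3 * K).+1) : R := fine (P (Q i l)).

Lemma cell_events_product (s : seq nat) : uniq s ->
  P (\big[setI/setT]_(i <- s) E i) =
  (\prod_(i <- s) \prod_(l < (3 * K).+1) f i l)%:E.
Proof.
move=> us; rewrite [in RHS](big_nth 0%N) [in RHS]big_mkord pair_bigA /= /f /Q.
pose a (i : 'I_(size s)) := al (nth 0%N s i).
rewrite -(@indep_counts ('I_(size s) * 'I_(3 * K).+1)%type (fun u => piece (a u.1) K u.2) (fun u => piece_count K u.2)).
- rewrite -bigcap_seq; congr (P _); apply/seteqP; split => w /= hw.
    by move=> [i l] /=; apply: (cell_eventE _ _ _).1; apply: hw; exact: mem_nth.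
  move=> i si; have si' : (index i s < size s)%N by rewrite index_mem.
  apply/cell_eventE => l; rewrite -(nth_index 0%N si).
  exact: (hw (Ordinal si', l)).
- by move=> u; exact: measurable_piece.
- move=> [i l] [i' l'] /= ne; apply/seteqP; split => // q [h h'].
  have [ii'|ii'] := eqVneq i i'.
    by subst i'; move/eqP: ne; apply; rewrite (piece_disjoint h h').
  have : nth 0%N s i != nth 0%N s i' by rewrite nth_uniq.
  move: (piece_abscissa h) (piece_abscissa h') => /andP[? ?] /andP[? ?].
  by move=> /al_far[]; rewrite -/(a i) -/(a i'); lra.
Qed.

Lemma cell_event_prob i : P (E i) = (\prod_(l < (3 * K).+1) f i l)%:E.
Proof.
by have := @cell_events_product [:: i] isT; rewrite !big_seq1.
Qed.

Lemma measurable_cell_event i : measurable (E i).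
Proof.
rewrite (_ : E i = \bigcap_(l in [set: 'I_(3 * K).+1]) Q i l).
  by apply: fin_bigcap_measurable => // l _; apply: measurable_count; exact: measurable_piece.
apply/seteqP; split => w; first by move=> /cell_eventE h l _; exact: h.
by move=> h; apply/cell_eventE => l; exact: h.
Qed.

(** Evaluated at the cell of origin 0, since the bound must be the same for all cells; the area of
    the rest is bounded by that of the whole cell. *)
Definition piece_prob_bound (l : nat) : R :=
  if (l < 3 * K)%N then expR (- ((rect_hi 0 l - rect_lo 0 l) / 16)) * ((rect_hi 0 l - rect_lo 0 l) / 16)
  else expR (- (K%:R * (9 / 8) + 1 / 16)).

Lemma piece_prob_bound_gt0 l : 0 < piece_prob_bound l.
Proof.
rewrite /piece_prob_bound; case: ifP => _; last exact: expR_gt0.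
by rewrite mulr_gt0 ?expR_gt0// divr_gt0// subr_gt0 rect_lo_lt_hi.
Qed.

Lemma piece_prob i (l : 'I_(3 * K).+1) : piece_prob_bound l <= f i l.
Proof.
have mp := measurable_piece (al i) K l.
rewrite /f /Q /piece_prob_bound; move: mp; rewrite /piece /piece_count; case: ifP => lK mp.
  have wE : rect_hi (al i) l - rect_lo (al i) l = rect_hi 0 l - rect_lo 0 l.
    by rewrite /rect_hi /rect_lo; case: ifP => _; lra.
  have rE : intensity (rect (al i) l) = ((rect_hi 0 l - rect_lo 0 l) / 16)%:E.
    rewrite /rect intensity_rect ?rect_lo_lt_hi ?rect_start_ge0//; last lra.
    by rewrite wE; congr EFin; lra.
  have := poisson_law_fin MP mp rE 1%N.
  by rewrite /= expr1 (_ : 1`! = 1%N)// invr1 mulr1 => ->.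
have T0 : 0 < K%:R * (9 / 8) + 1 / 16 :> R by have := ler0n R K; lra.
have al1 : al i < al i + 1 by lra.
have [r rE /andP[r0 rle]] := intensity_le_rect mp al1 (lexx 0) T0 (@subDsetl _ _ _).
have := poisson_law_fin MP mp rE 0%N; rewrite expr0 fact0 invr1 !mulr1 => -> /=.
by rewrite ler_expR; lra.
Qed.

Lemma cell_events_as : P (~` \bigcup_i E i) = 0%E.
Proof.
apply: (@indep_bigcup_as _ _ _ P E (\prod_(l < (3 * K).+1) piece_prob_bound l)).
- exact: measurable_cell_event.
- move=> s us; rewrite cell_events_product//; congr EFin; apply: eq_bigr => i _.
  by rewrite cell_event_prob.
- by apply: prodr_gt0 => l _; exact: piece_prob_bound_gt0.
- move=> i; rewrite cell_event_prob lee_fin; apply: ler_prod => l _.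
  by rewrite piece_prob ltW ?piece_prob_bound_gt0.
Qed.

End disjoint_cells.
End cell_events.

(** * Barriers on both sides of every box *)

Section cells_everywhere.
Context {R : realType} {d : measure_display} {W : measurableType d}.
Variables (P : probability W R) (M : R.-ker W ~> (R * R)%type).
Hypothesis MP : poisson_measure P M.

Definition right_cell K n i : set W := [set w | cell_event (M w) (n + i)%:R K].
Definition left_cell K n i : set W := [set w | cell_event (M w) (- (n + i).+1%:R) K].

Lemma natr_far (i j : nat) : (i < j)%N -> i%:R + 1 <= j%:R :> R.
Proof. by rewrite natr1 ler_nat. Qed.

Lemma right_cell_far n i j : i != j ->
  (n + i)%:R + 1 <= (n + j)%:R :> R \/ (n + j)%:R + 1 <= (n + i)%:R :> R.
Proof.
by rewrite neq_ltn => /orP[ij|ij]; [left|right]; apply: natr_far; rewrite ltn_add2l.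
Qed.

Lemma left_cell_far n i j : i != j ->
  - (n + i).+1%:R + 1 <= - (n + j).+1%:R :> R \/ - (n + j).+1%:R + 1 <= - (n + i).+1%:R :> R.
Proof.
rewrite neq_ltn => /orP[ij|ij]; [right|left].
  by have : (n + i).+1%:R + 1 <= (n + j).+1%:R :> R;
    [apply: natr_far; rewrite ltnS ltn_add2l|lra].
by have : (n + j).+1%:R + 1 <= (n + i).+1%:R :> R;
  [apply: natr_far; rewrite ltnS ltn_add2l|lra].
Qed.

Definition cells_around : set W :=
  \bigcap_K \bigcap_n (\bigcup_i right_cell K n i `&` \bigcup_i left_cell K n i).

Lemma measurable_right_cell K n i : measurable (right_cell K n i).
Proof. exact: (measurable_cell_event M (fun i => (n + i)%:R)). Qed.

Lemma measurable_left_cell K n i : measurable (left_cell K n i).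
Proof. exact: (measurable_cell_event M (fun i => - (n + i).+1%:R)). Qed.

Lemma measurable_cells_around : measurable cells_around.
Proof.
apply: bigcap_measurable => // K _; apply: bigcap_measurable => // n _.
apply: measurableI; apply: bigcup_measurable => i _.
  exact: measurable_right_cell.
exact: measurable_left_cell.
Qed.

Lemma cells_around_as : P.-negligible (~` cells_around).
Proof.
rewrite /cells_around setC_bigcap; apply: negligible_bigcup => K.
rewrite setC_bigcap; apply: negligible_bigcup => n.
rewrite setCI; apply: negligibleU; apply/negligibleP.
- by apply/measurableC/bigcup_measurable => i _; exact: measurable_right_cell.
- exact: (cell_events_as MP (right_cell_far n)).
- by apply/measurableC/bigcup_measurable => i _; exact: measurable_left_cell.
- exact: (cell_events_as MP (left_cell_far n)).
Qed.

Lemma localizes_around w K n T j i : all_ok M w -> 0 <= n -> 0 <= T ->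
  T <= K%:R * (9 / 8) -> forall N : nat, n <= N%:R ->
  left_cell K N j w -> right_cell K N i w ->
  localizes 0 (marks (M w)) n T (- (N + j).+1%:R) ((N + i)%:R + 1).
Proof.
move=> ok n0 T0 TK N nN lc rc.
have j0 := ler0n R j; have i0 := ler0n R i.
apply: (localizes_cells (fun N => mark_list_marks MP N ok) n0 T0 TK lc rc).
  by rewrite -natr1 natrD; lra.
by rewrite natrD; lra.
Qed.

End cells_everywhere.

(** * The process and its perfect simulation *)

Section solution.
Context {R : realType} (p : R).
Hypothesis p_ge0 : 0 <= p.
Context {d : measure_display} {W : measurableType d}.
Variables (P : probability W R) (M : R.-ker W ~> (R * R)%type).
Hypothesis MP : poisson_measure P M.

Definition good : set W :=
  all_ok M `&` (if p == 0 then cells_around M else setT).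

Lemma measurable_good : measurable good.
Proof.
apply: measurableI; first exact: measurable_all_ok.
by case: ifP => _; [exact: measurable_cells_around|exact: measurableT].
Qed.

Lemma good_as : P.-negligible (~` good).
Proof.
rewrite setCI; apply: negligibleU.
  by apply/negligibleP; [apply/measurableC/measurable_all_ok|exact: all_ok_as].
case: ifP => _; first exact: cells_around_as.
by rewrite setCT; exact: negligible_set0.
Qed.

Lemma good_localizes w : good w -> forall N : nat,
  exists a c, localizes p (marks (M w)) N%:R N%:R a c.
Proof.
move=> [ok hw] N; have N0 := ler0n R N.
have [p0|p0] := eqVneq p 0; last first.
  have pp : 0 < p by rewrite lt_neqAle eq_sym p0.
  by do 2 eexists; exact: localizes_pos.
move: hw; rewrite p0 eqxx => /(_ N I N I)[[i _ rc] [j _ lc]].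
by do 2 eexists; apply: (localizes_around MP ok N0 N0 _ _ lc rc) => //; lra.
Qed.

(** The value on which the approximations settle; as a limit, it inherits the measurability of the
    outputs of the simulator. *)
Definition limit_state w t x : R * (R * R) := xget (0, (0, 0))
  [set v | exists M0, forall N, (M0 <= N)%N -> forest_fire p t x (mark_list M N w) = v].

Lemma limit_stateE w t x v :
  (exists M0, forall N, (M0 <= N)%N -> forest_fire p t x (mark_list M N w) = v) ->
  limit_state w t x = v.
Proof.
move=> hv; have [M0 h0] := hv; rewrite /limit_state; case: xgetP => [_ -> [M1 h1]|/(_ v)//].
by rewrite -(h1 (maxn M0 M1)) ?leq_maxr// h0 ?leq_maxl.
Qed.

Lemma limit_stateP w t x : good w ->
  exists M0, forall N, (M0 <= N)%N ->
    forest_fire p t x (mark_list M N w) = limit_state w t x.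
Proof.
move=> gw; have [N [xN tN]] := nat_above2 x t.
have ok : all_ok M w by case: gw.
have st K (hK : (stab (good_localizes gw) N <= K)%N) :=
  forest_fire_stab p_ge0 (fun N => mark_list_marks MP N ok)
    (fun N => mark_list_uniq MP N w) hK xN (le_trans (ler_norm t) tN).
have [v hv] : exists v, exists M0, forall N, (M0 <= N)%N ->
    forest_fire p t x (mark_list M N w) = v by do 2 eexists; exact: st.
by rewrite (limit_stateE hv).
Qed.

(** The value 0 outside [good] provides the nonnegativity that is required for every w. *)
Definition Zsol w t x := if w \in good then (limit_state w t x).1 else 0.
Definition Hsol w t x := if w \in good then (limit_state w t x).2.1 else 0.
Definition Fsol w t x : nat :=
  if w \in good then Num.truncn (limit_state w t x).2.2 else 0%N.

Lemma solP_limit w t x : good w -> exists M0, forall N, (M0 <= N)%N ->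
  forest_fire p t x (mark_list M N w) = (Zsol w t x, (Hsol w t x, (Fsol w t x)%:R)).
Proof.
move=> gw; have [M0 h] := limit_stateP t x gw; exists M0 => N hN; rewrite h//.
rewrite /Zsol /Hsol /Fsol mem_set// -(h M0 (leqnn _)) /forest_fire /=.
by rewrite natrK.
Qed.

Lemma sol_ge0 w : nonneg_path (Zsol w) (Hsol w).
Proof.
move=> t x t0; have [gw|gw] := pselect (good w); last by rewrite /Zsol /Hsol memNset.
have [M0 /(_ _ (leqnn _))[<- <- _]] := solP_limit t x gw; split.
  by rewrite le_min ler01 subr_ge0 last_time_le.
rewrite /Hval; move: (fire_times _ _ _) => U; elim: (mark_list _ _ _) => //= k s ih.
by case: (boolP (_ && _)) => // _; rewrite le_max lexx.
Qed.

Lemma measurable_nat_fun d' (T : measurableType d') (f : W -> nat) (g : nat -> T) :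
  (forall k, measurable (f @^-1` [set k])) -> measurable_fun setT (g \o f).
Proof.
move=> mf _ Y _; rewrite setTI.
rewrite (_ : _ @^-1` Y = \bigcup_(k in g @^-1` Y) f @^-1` [set k]).
  exact: bigcup_measurable.
by apply/seteqP; split => [w /= h|w [k /= gk e]]; [exists (f w)|rewrite /= e].
Qed.

Lemma measurable_limit (g : R * (R * R) -> R) t x :
  (forall N, measurable_fun (all_ok M)
    (fun w => g (forest_fire p t x (mark_list M N w)))) ->
  measurable_fun setT (fun w => if w \in good then g (limit_state w t x) else 0).
Proof.
move=> mg; apply/(measurable_restrictT (fun w => g (limit_state w t x)) measurable_good).
apply: (measurable_fun_cvg
    (h := fun N w => g (forest_fire p t x (mark_list M N w)))).
  by move=> N; apply: measurable_funS (mg N); [exact: measurable_all_ok|move=> w []].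
move=> w /(limit_stateP t x)[M0 h]; apply: cvg_near_cst.
by exists M0 => // N /= hN; rewrite h.
Qed.

Lemma measurable_sol t x :
  measurable_fun setT (fun w => Zsol w t x) /\
  (measurable_fun setT (fun w => Hsol w t x) /\
   measurable_fun setT (fun w => Fsol w t x)).
Proof.
have h N := measurable_simulate pforest_fire p t x (measurable_all_ok M)
  (mval_mark_list MP N).
have ffE N w := simulate_forest_fire p t x (mark_list M N w).
split; first by apply: (@measurable_limit fst) => N; under eq_fun do rewrite -ffE; case: (h N).
split.
  apply: (@measurable_limit (fun v => v.2.1)) => N; under eq_fun do rewrite -ffE.
  by case: (h N) => _ [].
have mF : measurable_fun setT (fun w => if w \in good then (limit_state w t x).2.2 else 0).
  apply: (@measurable_limit (fun v => v.2.2)) => N; under eq_fun do rewrite -ffE.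
  by case: (h N) => _ [].
apply: (@measurable_nat_fun _ _ (fun w => Fsol w t x) id) => k.
have := mF measurableT _ (measurable_set1 k%:R); rewrite setTI.
congr measurable; apply/seteqP; split => w /=; rewrite /Fsol; case: ifPn => // gw.
- by move=> ->; rewrite natrK.
- by move=> /eqP; rewrite eq_sym pnatr_eq0 => /eqP.
- have [M0 /(_ _ (leqnn _))] := limit_stateP t x (set_mem gw).
  by move=> <- <-; rewrite /forest_fire /= natrK.
- by move=> <-.
Qed.

Lemma sol_LFFP : LFFP P p M Zsol Hsol Fsol.
Proof.
split.
- by move=> t x _; case: (measurable_sol t x).
- by move=> t x _; case: (measurable_sol t x) => _ [].
- by move=> t x _; case: (measurable_sol t x) => _ [].
- exact: sol_ge0.
apply: negligibleS good_as => w; apply: contra_not => gw.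
have ok : all_ok M w by case: gw.
apply: (path_exists p_ge0 (fun N => mark_list_marks MP N ok)
  (fun N => mark_list_uniq MP N w) (good_localizes gw)) => x t _.
exact: solP_limit.
Qed.

Lemma sol_unique w Z H F : good w -> nonneg_path Z H -> LFFP_path p (M w) Z H F ->
  forall t x, 0 <= t -> [/\ Z t x = Zsol w t x, H t x = Hsol w t x & F t x = Fsol w t x].
Proof.
move=> gw ge0 ZHF t x t0; have ok : all_ok M w by case: gw.
have [M0 h0] := path_unique p_ge0 (fun N => mark_list_marks MP N ok)
  (fun N => mark_list_uniq MP N w) (good_localizes gw) ge0 ZHF x t0.
have [M1 h1] := solP_limit t x gw.
have := h0 (maxn M0 M1) (leq_maxl _ _); rewrite h1 ?leq_maxr// => -[-> -> /eqP].
by rewrite eqr_nat => /eqP ->.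
Qed.

Lemma sol_simulated (T n : R) (a c : W -> R) : 0 <= T ->
  measurable_fun setT a -> measurable_fun setT c ->
  (forall w, a w <= - n /\ n <= c w) ->
  (forall w, good w -> localizes p (marks (M w)) n T (a w) (c w)) ->
  perfectly_simulated P p M Zsol Hsol Fsol pforest_fire T n.
Proof.
move=> T0 ma mc ac hloc; exists a, c; split => //.
apply: negligibleS good_as => w /= nP gw; apply: nP.
have ok : all_ok M w by case: gw.
have ms N := mark_list_marks MP N ok.
have [M0 st] := stable_fromP T (a w) (c w).
have mD : measurable (box (a w) (c w) T : set (R * R)) by exact: measurable_box.
split.
  exists [seq q <- mark_list M M0 w | q \in box (a w) (c w) T].
  by apply: lists_marks_sub (ms M0) => // q; exact: (box_nbox st (leqnn _)).
move=> s hs t x /andP[_ tT] xn; rewrite simulate_forest_fire.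
have [M1 h1] := solP_limit t x gw; rewrite -(h1 (maxn M0 M1)) ?leq_maxr//.
apply: (forest_fire_stable p_ge0 ms (fun N => mark_list_uniq MP N w)
  (hloc w gw) st (leq_maxl _ _) T0 hs) => //.
by rewrite ler_norml.
Qed.

(** The default value of [xget] adds to the level set of 0 the event that no [E i] occurs. *)
Lemma measurable_first_index (E : nat -> set W) (g : nat -> R) :
  (forall i, measurable (E i)) -> measurable_fun setT (fun w => g (first_index E w)).
Proof.
move=> mE; apply: (@measurable_nat_fun _ _ (first_index E) g) => k.
rewrite (_ : _ @^-1` _ = first_set E k `|` (if k == 0%N then ~` \bigcup_i E i else set0)).
  apply: measurableU; first exact: measurable_first_set.
  by case: ifP => // _; apply/measurableC/bigcup_measurable.
apply/seteqP; split => w /=.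
  move=> e; have [/first_set_exists[i hi]|nE] := pselect ((\bigcup_i E i) w).
    by left; rewrite -e (first_indexE hi).
  right; rewrite -e /first_index; case: xgetP => [i _ [Ei _]|_]; last by rewrite eqxx.
  by exfalso; apply: nE; exists i.
move=> [/first_indexE//|]; case: eqVneq => // -> nE.
rewrite /first_index; case: xgetP => [i _ [Ei _]|//].
by exfalso; apply: nE; exists i.
Qed.

(** For p > 0 the window is deterministic. For p = 0 it ends at the far sides of the first suitable
    cells beyond [N], whose indices are random variables. *)
Lemma perfect_simulation (T n : R) : 0 <= T -> 0 <= n ->
  perfectly_simulated P p M Zsol Hsol Fsol pforest_fire T n.
Proof.
move=> T0 n0; have [p0|p0] := eqVneq p 0; last first.
  have pp : 0 < p by rewrite lt_neqAle eq_sym p0.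
  have Tp : 0 <= T / p by rewrite divr_ge0.
  apply: (sol_simulated T0 (a := cst (- (n + T / p))) (c := cst (n + T / p))).
  - exact: measurable_cst.
  - exact: measurable_cst.
  - by move=> w /=; lra.
  - by move=> w _; exact: localizes_pos.
(* [T <= K] is more than enough for K cycles of length 9/8 to cover [0, T]. *)
have [N hN] := nat_above n; have [K hK] := nat_above T.
rewrite ger0_norm// in hN; rewrite ger0_norm// in hK.
apply: (sol_simulated T0 (a := fun w => - (N + first_index (left_cell M K N) w).+1%:R)
  (c := fun w => (N + first_index (right_cell M K N) w)%:R + 1)).
- apply: (measurable_first_index (fun i => - (N + i).+1%:R)) => i.
  exact: measurable_left_cell.
- apply: (measurable_first_index (fun i => (N + i)%:R + 1)) => i.
  exact: measurable_right_cell.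
- move=> w; rewrite -natr1 !natrD; have := ler0n R (first_index (left_cell M K N) w).
  by have := ler0n R (first_index (right_cell M K N) w); split; lra.
move=> w [ok]; rewrite p0 eqxx => /(_ K I N I)[/first_indexP rc /first_indexP lc].
by apply: (localizes_around MP ok n0 T0 _ hN lc rc); lra.
Qed.

End solution.

Theorem theorem2p4 (R : realType) (p : R) (p_ge0 : 0 <= p)
    (d : measure_display) (W : measurableType d) (P : probability W R)
    (M : R.-ker W ~> (R * R)%type) (M_poisson : poisson_measure P M) :
  exists (Z H : W -> R -> R -> R) (F : W -> R -> R -> nat),
  [/\ LFFP P p M Z H F,
      {ae P, forall w, forall (Z' H' : R -> R -> R) (F' : R -> R -> nat),
        nonneg_path Z' H' -> LFFP_path p (M w) Z' H' F' ->
        forall t x : R, 0 <= t ->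
        [/\ Z' t x = Z w t x, H' t x = H w t x & F' t x = F w t x]} &
      exists alg : simulator, forall T n : R, 0 <= T -> 0 <= n ->
        perfectly_simulated P p M Z H F alg T n].
Proof.
exists (Zsol p M), (Hsol p M), (Fsol p M); split.
- exact: sol_LFFP.
- apply: negligibleS (good_as p M_poisson) => w; apply: contra_not => gw Z' H' F'.
  exact: (sol_unique p_ge0 M_poisson gw).
- by exists pforest_fire; exact: perfect_simulation.
Qed.
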